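(* Assume the setting below. Let $\mathcal{S}=\{j\in\mathcal{A}:\zeta_j<1\}$ and $\mathcal{C}=\{j\in\mathcal{A}:\zeta_j=1\}$, and assume $\mathcal{A}=\mathcal{S}\cup\mathcal{C}$. Let $M$ be the submatrix of $\mathcal{H}_K(\boldsymbol{\tau})^{-1}$ formed by the rows and columns indexed by $\mathcal{C}$. Then, as $n\to+\infty$, \[ \mathbb{P}(m \text{ is an } \boldsymbol{\alpha}\text{-winner}) \sim \frac{P(\boldsymbol{\zeta})^n}{\prod_{j\in\mathcal{S}}\big((1-\zeta_j)\zeta_j^{\lceil\beta_j n\rceil-1}\big)}\cdot\frac{1}{\sqrt{(2\pi)^{m-1}n^{|\mathcal{S}|}\det(\mathcal{H}_K(\boldsymbol{\tau}))}}\int_{(0,+\infty)^{|\mathcal{C}|}}e^{-\mathbf{u}^TM\mathbf{u}/2}\,d\mathbf{u}. \]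
   Context: Fix an integer $m\ge 2$ of candidates $\{1,\dots,m\}$ and let $\mathcal{A}=\{1,\dots,m-1\}$. There are $n$ voters; each voter independently draws a strict ranking $r$ of the candidates with probability $p_r$, where $p_r>0$ for each of the $m!$ rankings and $\sum_r p_r=1$ (independent of $n$). For $\mathcal{X}\subseteq\mathcal{A}$, let $p_{\mathcal{X}}$ be the probability that, in a random ranking, the set of adversaries ranked above $m$ is exactly $\mathcal{X}$; let $P(\mathbf{x})=\sum_{\mathcal{X}\subseteq\mathcal{A}} p_{\mathcal{X}}\prod_{j\in\mathcal{X}}x_j$. Fix $\boldsymbol{\alpha}\in(0,1)^{m-1}$, $\boldsymbol{\beta}=\mathbf{1}-\boldsymbol{\alpha}$. Candidate $m$ is an $\boldsymbol{\alpha}$-winner if for every $j\in\mathcal{A}$, strictly more than $\alpha_j n$ voters rank $m$ above $j$. Let $K(\mathbf{t})=\log P(e^{t_1},\dots,e^{t_{m-1}})$; $\boldsymbol{\tau}$ is the unique maximizer over $\mathbb{R}^{m-1}$ of $-K(\mathbf{t})+\boldsymbol{\beta}^T\mathbf{t}$, $\boldsymbol{\zeta}=e^{\boldsymbol{\tau}}$ componentwise, and $\mathcal{H}_K(\boldsymbol{\tau})$ is the Hessian of $K$ at $\boldsymbol{\tau}$. When $\mathcal{C}=\emptyset$ the integral is interpreted as $1$. *)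

(* Defs.v *)
From HB Require Import structures.
From mathcomp Require Import all_boot all_order all_algebra.
From mathcomp Require Import perm.
From mathcomp Require Import all_classical all_reals all_analysis.
Set Implicit Arguments. Unset Strict Implicit. Unset Printing Implicit Defensive.
Import Order.TTheory GRing.Theory Num.Theory.
Import numFieldNormedType.Exports.
Local Open Scope classical_set_scope.
Local Open Scope ring_scope.

(* Candidates are 'I_k.+1 (so m = k.+1); the distinguished candidate "m" is
   ord_max; adversaries are 'I_k, adversary j is the candidate widen_ord j.
   A ranking is a permutation r : 'S_k.+1 mapping each candidate to its
   position (0 = top); candidate a is ranked above b iff r a < r b. *)
Definition adv (k : nat) (j : 'I_k) : 'I_k.+1 := widen_ord (leqnSn k) j.

Definition ranked_above (k : nat) (r : 'S_k.+1) (a b : 'I_k.+1) : bool :=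
  (r a < r b)%N.

Definition above_m (k : nat) (r : 'S_k.+1) : {set 'I_k} :=
  [set j | ranked_above r (adv j) ord_max].

Definition pX (R : realType) (k : nat) (p : {ffun 'S_k.+1 -> R}) (X : {set 'I_k}) : R :=
  \sum_(r : 'S_k.+1 | above_m r == X) p r.

Definition Ppoly (R : realType) (k : nat) (p : {ffun 'S_k.+1 -> R}) (x : 'I_k -> R) : R :=
  \sum_(X : {set 'I_k}) pX p X * \prod_(j in X) x j.

Definition Kfun (R : realType) (k : nat) (p : {ffun 'S_k.+1 -> R}) (t : 'rV[R]_k) : R :=
  ln (Ppoly p (fun j => expR (t 0 j))).

Definition hessian (R : realType) (k : nat) (f : 'rV[R]_k -> R) (x : 'rV[R]_k) : 'M[R]_k :=
  \matrix_(i, j) derive (fun y => derive f y (delta_mx 0 j)) x (delta_mx 0 i).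

Definition alpha_winner (R : realType) (k n : nat) (alpha : 'I_k -> R)
    (f : {ffun 'I_n -> 'S_k.+1}) : bool :=
  [forall j : 'I_k,
     alpha j * n%:R < (#|[set v : 'I_n | ranked_above (f v) ord_max (adv j)]|)%:R].

Definition win_prob (R : realType) (k : nat) (p : {ffun 'S_k.+1 -> R})
    (alpha : 'I_k -> R) (n : nat) : R :=
  \sum_(f : {ffun 'I_n -> 'S_k.+1} | alpha_winner alpha f) \prod_(v : 'I_n) p (f v).

Fixpoint iter_int_pos_rec (R : realType) (c : nat) (g : seq R -> \bar R) : \bar R :=
  match c with
  | 0 => g [::]
  | c'.+1 => (\int[@lebesgue_measure R]_(x in [set x : R | (0 < x)%R])
               iter_int_pos_rec c' (fun s => g (x :: s)))%E
  end.
Definition iter_int_pos (R : realType) (c : nat) (g : seq R -> \bar R) : \bar R :=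
  iter_int_pos_rec c g.

Definition qform (R : realType) (c : nat) (M : 'M[R]_c) (u : seq R) : R :=
  \sum_(a < c) \sum_(b < c) nth 0 u a * M a b * nth 0 u b.

Definition submx_set (R : realType) (k : nat) (A : 'M[R]_k) (C : {set 'I_k}) : 'M[R]_#|C| :=
  \matrix_(a, b) A (enum_val a) (enum_val b).

(* Main.v *)
(* Tilting the law p_X to q_X = p_X (prod_(j in X) zeta_j) / P(zeta) turns the
   winning probability into P(zeta)^n / prod_j zeta_j^(y_j) times the expectation
   of prod_j g_j(y_j - S_j), where y = ceil(beta n) - 1, S is the n-th position of
   the walk on Z^k with steps of law q, and g_j(x) = zeta_j^x for x >= 0 and 0 for
   x < 0. Since tau is critical, q has mean beta, and its covariance is the
   Hessian of K.

   As q charges every set, comparing the empty set with {j} in a variance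
   estimate shows that each difference in the coordinate j costs a factor
   n^(-1/2) after n steps. Hence, for zeta_j < 1, the weight g_j may be replaced by
   a point mass 1 / (1 - zeta_j) at 0, up to a relative error n^(-1/2), and the
   starting point of the walk may be averaged at any scale T^(1/2) = o(n^(1/2)).
   Averaged against the Gaussian kernel of time T, the expectation becomes, by
   commutation of convolutions, n steps of the walk applied to a sum of Gaussian
   kernels over a grid. The kernel solves the recursion of the walk up to an error
   of order T^(-3/2) relative to its size, so n steps turn the time T into T + n,
   and the remaining sum is a Riemann sum of the Gaussian integral over the
   positive orthant indexed by C. *)

Require Import Defs.
From HB Require Import structures.
From mathcomp Require Import all_boot all_order all_algebra.
From mathcomp Require Import perm.
From mathcomp Require Import all_classical all_reals all_analysis.
From mathcomp Require Import measurable_realfun.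
From mathcomp Require Import ring lra zify.
Import Order.TTheory GRing.Theory Num.Theory.
Import numFieldNormedType.Exports.
Local Open Scope classical_set_scope.
Local Open Scope ring_scope.
Set Implicit Arguments. Unset Strict Implicit. Unset Printing Implicit Defensive.

(** * Random walks on the integer lattice *)

(** The order n^(-|S|/2) comes from differences as well. A point mass on the integers is the
    difference of the indicator of a half-line, so a product with point masses in the coordinates of
    S is an |S|-fold difference of a bounded function. Replacing a weight or moving the starting
    point then costs one difference more, so at most k + 1 are ever taken. The coordinates of C give
    no such gain: there the weight is the indicator of a half-line, which is not summable. As beta_j
    < 1, its values on 0, ..., n suffice and it can be cut to a finite grid. The grid has of the
    order of n^|C| points, so the estimates on the kernel must be pointwise, with a decay that sums
    coordinate by coordinate; hence the products of the one-variable weight [decay]. Smoothing is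
    needed because the kernel solves the recursion of the walk only approximately, with an error
    that is too large at times of order 1: it has to be started at a large time T, not at a point
    mass. The kernel is not a probability on the lattice, but its mass tends to 1, by the same
    theorem on Riemann sums that evaluates the sum over the grid. *)

Section WeightedMean.
Context {R : realFieldType} {T : finType} (q : T -> R).
Hypotheses (q_ge0 : forall x, 0 <= q x) (q_sum : \sum_x q x = 1).

Lemma mean_const (c : R) : \sum_x q x * c = c.
Proof. by rewrite -mulr_suml q_sum mul1r. Qed.

Lemma mean_le (a b : T -> R) :
  (forall x, a x <= b x) -> \sum_x q x * a x <= \sum_x q x * b x.
Proof. by move=> ab; apply: ler_sum => x _; apply: ler_wpM2l. Qed.

Lemma mean_var (a : T -> R) (m := \sum_x q x * a x) :
  \sum_x q x * (a x - m) ^+ 2 = \sum_x q x * a x ^+ 2 - m ^+ 2.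
Proof.
rewrite (eq_bigr (fun x => q x * a x ^+ 2 - 2 * m * (q x * a x) + q x * m ^+ 2)).
  rewrite big_split /= mean_const sumrB -mulr_sumr -/m; ring.
by move=> x _; ring.
Qed.

(** The variance is at least its two terms at x0 and x1. Multiplied by q x0 + q x1 <= 1, these make
    a square plus q x0 q x1 (a x0 - a x1)^2. *)
Lemma sqr_mean_le_gap (a : T -> R) (x0 x1 : T) : x0 != x1 ->
  (\sum_x q x * a x) ^+ 2
    <= \sum_x q x * a x ^+ 2 - q x0 * q x1 * (a x0 - a x1) ^+ 2.
Proof.
move=> x01; set m := \sum_x q x * a x.
have hvar := mean_var a; rewrite -/m in hvar.
have split2 (F : T -> R) : \sum_x F x = F x0 + (F x1 + \sum_(x | (x != x0) && (x != x1)) F x).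
  by rewrite (bigD1 x0) //= (bigD1 x1) ?(eq_sym x1) //= .
have q01 : q x0 + q x1 <= 1.
  by rewrite -q_sum split2 addrA lerDl sumr_ge0.
have h : q x0 * (a x0 - m) ^+ 2 + q x1 * (a x1 - m) ^+ 2
      <= \sum_x q x * (a x - m) ^+ 2.
  rewrite split2 addrA lerDl sumr_ge0 // => x _.
  by rewrite mulr_ge0 // sqr_ge0.
have h0 := q_ge0 x0; have h1 := q_ge0 x1.
have h2 : (q x0 + q x1) * (q x0 * (a x0 - m) ^+ 2 + q x1 * (a x1 - m) ^+ 2)
  <= q x0 * (a x0 - m) ^+ 2 + q x1 * (a x1 - m) ^+ 2.
  by apply: ler_piMl => //; apply: addr_ge0; apply: mulr_ge0 => //; exact: sqr_ge0.
have h3 : 0 <= (q x0 * (a x0 - m) + q x1 * (a x1 - m)) ^+ 2 by exact: sqr_ge0.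
have e : (q x0 + q x1) * (q x0 * (a x0 - m) ^+ 2 + q x1 * (a x1 - m) ^+ 2)
  = (q x0 * (a x0 - m) + q x1 * (a x1 - m)) ^+ 2
    + q x0 * q x1 * (a x0 - a x1) ^+ 2 by ring.
rewrite lerBrDr addrC -lerBrDr -hvar (le_trans _ h) // (le_trans _ h2) //.
by rewrite e lerDr.
Qed.

Lemma sqr_mean_le (a : T -> R) : (\sum_x q x * a x) ^+ 2 <= \sum_x q x * a x ^+ 2.
Proof.
rewrite -subr_ge0 -mean_var; apply: sumr_ge0 => x _.
by rewrite mulr_ge0 // sqr_ge0.
Qed.

End WeightedMean.

Notation lat k := {ffun 'I_k -> int}.

Definition ind (k : nat) (X : {set 'I_k}) : lat k := [ffun j => ((j \in X) : nat)%:Z].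

Section Walk.
Context {R : realType} {k : nat}.
Implicit Types (f g : lat k -> R) (y v : lat k) (j : 'I_k) (s : seq 'I_k).

Definition diff j f y : R := f y - f (y - ind [set j]%SET).

Definition diffs s f : lat k -> R := foldr diff f s.

Variable q : {set 'I_k} -> R.

(** The mean of f(y - X) for X of law q. The walk acts on functions: [iter n walk f y] is the mean
    of f(y - S) after n steps, and the law of S is never formed. *)
Definition walk f y : R := \sum_(X : {set 'I_k}) q X * f (y - ind X).

Lemma eq_diff j f g : f =1 g -> diff j f =1 diff j g.
Proof. by move=> fg y; rewrite /diff !fg. Qed.

Lemma eq_diffs s f g : f =1 g -> diffs s f =1 diffs s g.
Proof. by move=> fg; elim: s => //= j s; apply: eq_diff. Qed.

Lemma eq_walk f g : f =1 g -> walk f =1 walk g.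
Proof. by move=> fg y; apply: eq_bigr => X _; rewrite fg. Qed.

Lemma eq_iter_walk n f g : f =1 g -> iter n walk f =1 iter n walk g.
Proof. by move=> fg; elim: n => //= n; apply: eq_walk. Qed.

Lemma walk_diff j f : walk (diff j f) =1 diff j (walk f).
Proof.
move=> y; rewrite /walk /diff -sumrB; apply: eq_bigr => X _.
by rewrite mulrBr; congr (_ - _ * f _); rewrite addrAC.
Qed.

Lemma iter_walk_diff n j f : iter n walk (diff j f) =1 diff j (iter n walk f).
Proof.
elim: n => //= n IH y; rewrite -walk_diff; exact: eq_walk.
Qed.

Lemma iter_walk_diffs n s f : iter n walk (diffs s f) =1 diffs s (iter n walk f).
Proof.
elim: s f => //= j s IH f y; rewrite iter_walk_diff; exact: eq_diff.
Qed.

Hypotheses (q_gt0 : forall X, 0 < q X) (q_sum : \sum_X q X = 1).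

Let q_ge0 X : 0 <= q X. Proof. exact: ltW. Qed.

Lemma walk_bounded n f (M : R) : (forall y, `|f y| <= M) ->
  forall y, `|iter n walk f y| <= M.
Proof.
move=> fM; elim: n => //= n IH y; rewrite /walk.
apply: (le_trans (ler_norm_sum _ _ _)).
rewrite -[leRHS](mean_const q_sum); apply: ler_sum => X _.
by rewrite normrM ger0_norm // ler_wpM2l.
Qed.

(* Energy estimate: the two-point part of the variance of f(y - X) pays for the
   squared increment gained at each step. *)
Lemma diff_walk_energy j f (M : R) n y : (forall y, `|f y| <= M) ->
  q finset.set0 * q [set j]%SET * n.+1%:R * (diff j (iter n walk f) y) ^+ 2
    + (iter n.+1 walk f y) ^+ 2 <= M ^+ 2.
Proof.
move=> fM; set c := q finset.set0 * q [set j]%SET.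
have c_ge0 : 0 <= c by rewrite mulr_ge0.
have ne : (finset.set0 : {set 'I_k}) != [set j]%SET.
  by apply/eqP => /setP /(_ j); rewrite !inE eqxx.
have gap g z : (walk g z) ^+ 2 + c * (diff j g z) ^+ 2 <= walk (fun x => g x ^+ 2) z.
  have := sqr_mean_le_gap q_ge0 q_sum (fun X => g (z - ind X)) ne.
  have -> : z - ind (finset.set0 : {set 'I_k}) = z.
    by apply/ffunP => i; rewrite !ffunE inE subr0.
  by rewrite -/c lerBrDr.
have monow g h z : (forall x, g x <= h x) -> walk g z <= walk h z.
  by move=> gh; apply: mean_le.
have cstw z : walk (fun=> M ^+ 2) z = M ^+ 2 by rewrite /walk mean_const.
elim: n y => [|n IH] y.
  rewrite mulr1 addrC (le_trans (gap _ _)) //= -(cstw y); apply: monow => x.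
  rewrite -[f x ^+ 2]real_normK ?num_real // lerXn2r ?nnegrE //.
  exact: le_trans (normr_ge0 (f x)) (fM x).
set d := diff j (iter n walk f); set a := iter n.+1 walk f.
(* By Jensen's inequality the squared increment after one more step is at most the average of the
   previous ones, so the factor [n.+1] carries over and [gap] adds one. *)
have hd : (diff j (iter n.+1 walk f) y) ^+ 2 <= walk (fun x => d x ^+ 2) y.
  rewrite -[diff j _ y]/(diff j (walk (iter n walk f)) y) -walk_diff.
  exact: sqr_mean_le.
have := gap a y; rewrite -[iter n.+2 walk f]/(walk a) -/a => ga.
have IHw : walk (fun x => c * n.+1%:R * d x ^+ 2 + a x ^+ 2) y <= M ^+ 2.
  by rewrite -(cstw y); apply: monow => x; exact: IH.
have e : walk (fun x => c * n.+1%:R * d x ^+ 2 + a x ^+ 2) y =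
   c * n.+1%:R * walk (fun x => d x ^+ 2) y + walk (fun x => a x ^+ 2) y.
  by rewrite /walk mulr_sumr -big_split; apply: eq_bigr => X _ /=; ring.
rewrite e in IHw.
have : c * n.+1%:R * (diff j a y) ^+ 2 <= c * n.+1%:R * walk (fun x => d x ^+ 2) y.
  by rewrite ler_wpM2l // mulr_ge0.
rewrite -[in n.+2%:R]natr1.
lra.
Qed.

Lemma diff_walk_le j f (M : R) n y : (forall y, `|f y| <= M) ->
  `|diff j (iter n walk f) y|
    <= M / (Num.sqrt (q finset.set0 * q [set j]%SET) * Num.sqrt n.+1%:R).
Proof.
move=> fM; have := diff_walk_energy j n y fM.
set c := q _ * _; set d := diff _ _ _; set a := iter _ _ _ _ => h.
have c_gt0 : 0 < c by rewrite mulr_gt0.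
have M_ge0 : 0 <= M by exact: le_trans (normr_ge0 (f y)) (fM y).
rewrite ler_pdivlMr ?mulr_gt0 ?sqrtr_gt0 //.
rewrite -ler_sqr ?nnegrE ?mulr_ge0 ?sqrtr_ge0 //.
rewrite !exprMn !sqr_sqrtr ?ler0n ?(ltW c_gt0) // real_normK ?num_real //.
have := sqr_ge0 a; lra.
Qed.

(** Cut the n steps into k + 2 blocks of equal length, up to a remainder: each of the at most k + 1
    differences is paid by a block of its own, and the other steps only average. *)
Lemma diffs_walk_le : exists2 C : R, 0 <= C & forall s f (M : R) n,
  (size s <= k.+1)%N -> (0 < n)%N -> (forall y, `|f y| <= M) ->
  forall y, `|diffs s (iter n walk f) y| <= M * (C / Num.sqrt n%:R) ^+ size s.
Proof.
pose c := \big[Num.min/1]_(j < k) (q finset.set0 * q [set j]%SET).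
have c_gt0 : 0 < c by apply: lt_bigmin => // i _; rewrite mulr_gt0.
have c_le j : c <= q finset.set0 * q [set j]%SET by exact: bigmin_le.
(* From n <= (m + 1)(k + 2), where m is the block length: 1 / sqrt (c (m + 1)) <= D / sqrt n. *)
pose D : R := Num.sqrt (k.+2%:R / c).
exists D => [|s f M n sk n_gt0 fM]; first exact: sqrtr_ge0.
pose m := (n %/ k.+2)%N.
have nm : (n <= m.+1 * k.+2)%N by rewrite ltnW // ltn_ceil.
have key s' p : (p >= size s' * m)%N -> forall y,
    `|diffs s' (iter p walk f) y| <= M * (D / Num.sqrt n%:R) ^+ size s'.
  elim: s' p => [|j s' IH] p pm y /=; first by rewrite mulr1 walk_bounded.
  have pE : p = (m + (p - m))%N.
    by rewrite subnKC // (leq_trans _ pm) //= mulSn leq_addr.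
  have -> : diff j (diffs s' (iter p walk f)) y
          = diff j (iter m walk (diffs s' (iter (p - m) walk f))) y.
    apply: eq_diff => z; rewrite iter_walk_diffs; apply: eq_diffs => x.
    by rewrite -iterD -pE.
  have {}IH := IH (p - m)%N; rewrite /= mulSn in pm.
  have /IH {}IH : (p - m >= size s' * m)%N by rewrite leq_subRL // (leq_trans _ pm) // leq_addr.
  apply: (le_trans (diff_walk_le j m y IH)).
  rewrite exprSr mulrA ler_wpM2l //.
    rewrite mulr_ge0 ?exprn_ge0 ?divr_ge0 ?sqrtr_ge0 //.
    exact: le_trans (normr_ge0 (f y)) (fM y).
  have n0 : 0 < Num.sqrt (n%:R : R) by rewrite sqrtr_gt0 ltr0n.
  rewrite ler_pdivlMr // mulrC ler_pdivrMr ?mulr_gt0 ?sqrtr_gt0 ?mulr_gt0 //.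
  rewrite /D -!sqrtrM ?mulr_ge0 ?divr_ge0 ?invr_ge0 ?(ltW c_gt0) //.
  rewrite ler_sqrt ?mulr_ge0 ?divr_ge0 ?invr_ge0 ?(ltW c_gt0) //.
  rewrite -mulrA [leRHS]mulrCA ler_pdivlMl // [leRHS]mulrCA.
  apply: ler_pM => //; first exact: ltW.
  by rewrite mulrC -natrM ler_nat.
apply: key; apply: leq_trans (leq_trunc_div n k.+2).
by rewrite mulnC leq_mul2l (leq_trans sk) ?orbT.
Qed.

End Walk.

(** * Iterated Riemann sums *)

Section Decay.
Context {R : realType}.

(** An integrable weight of one variable. Gaussians and kernel errors are bounded by products of it,
    which sum coordinate by coordinate. *)
Definition decay (x : R) : R := ((1 + `|x|) ^+ 2)^-1.

Lemma decay_gt0 x : 0 < decay x.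
Proof. by rewrite invr_gt0 exprn_gt0 // ltr_wpDr. Qed.

Lemma decay_le1 x : decay x <= 1.
Proof. by rewrite invf_le1 ?exprn_gt0 ?ltr_wpDr // exprn_ege1 // lerDl. Qed.

(** x / (1 + |x|) is a primitive of [decay], and a step of length at most 1 changes 1 + |x| by a
    factor at most 2, whence the constant. *)
Lemma decay_le_primitive (h x : R) : 0 < h <= 1 ->
  h * decay x <= 2 * ((x + h) / (1 + `|x + h|) - x / (1 + `|x|)).
Proof.
move=> /andP[h0 h1].
have key (p r : R) : 0 < p -> 0 < r -> r <= 2 * p ->
    h * (p ^+ 2)^-1 <= 2 * (h / (p * r)).
  move=> p0 r0 rp; rewrite mulrCA ler_pM2l // -[2]invrK -invfM.
  rewrite lef_pV2 ?posrE ?mulr_gt0 ?exprn_gt0 //; nra.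
rewrite /decay; have [x0|x0] := leP 0 x.
  rewrite !ger0_norm ?addr_ge0 ?(ltW h0) //.
  have -> : (x + h) / (1 + (x + h)) - x / (1 + x) = h / ((1 + x) * (1 + (x + h))).
    by field; rewrite !gt_eqF // ltr_wpDr ?addr_ge0 // ltW.
  by apply: key; lra.
rewrite (ltr0_norm x0); have [xh|xh] := leP (x + h) 0.
  rewrite ler0_norm //.
  have -> : (x + h) / (1 - (x + h)) - x / (1 - x) = h / ((1 - x) * (1 - (x + h))).
    field; apply/andP; split; apply: lt0r_neq0; lra.
  by apply: key; lra.
rewrite gtr0_norm //.
have h2 : (x + h) / 2 <= (x + h) / (1 + (x + h)).
  by rewrite ler_pM2l // lef_pV2 ?posrE; lra.
have h3 : - x / 2 <= - x / (1 - x).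
  by rewrite ler_pM2l ?oppr_gt0 // lef_pV2 ?posrE; lra.
have h4 : h * ((1 - x) ^+ 2)^-1 <= h.
  rewrite ler_piMr ?(ltW h0) // invf_le1; last by apply: exprn_gt0; lra.
  by apply: exprn_ege1; lra.
have -> : x / (1 - x) = - (- x / (1 - x)) by rewrite mulNr opprK.
lra.
Qed.

(** The sum telescopes along the primitive, which stays in [-1, 1]; hence a bound free of the start,
    the mesh and the number of terms. *)
Lemma sum_decay_le (a h : R) (B : nat) : 0 < h <= 1 ->
  \sum_(l < B) h * decay (a + h * l%:R) <= 4.
Proof.
move=> h01; pose E (l : nat) : R := (a + h * l%:R) / (1 + `|a + h * l%:R|).
have E1 l : `|E l| <= 1.
  rewrite normrM normfV (ger0_norm (_ : 0 <= 1 + _)) ?addr_ge0 //.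
  by rewrite ler_pdivrMr ?ltr_wpDr // mul1r lerDr.
have le (l : nat) : h * decay (a + h * l%:R) <= 2 * (E l.+1 - E l).
  have := decay_le_primitive (a + h * l%:R) h01.
  by rewrite -addrA -[X in h * l%:R + X]mulr1 -mulrDr natr1.
rewrite -(big_mkord xpredT (fun l => h * decay (a + h * l%:R))).
apply: (le_trans (ler_sum_nat (fun l _ => le l))).
rewrite -mulr_sumr telescope_sumr //.
have := E1 B; have := E1 0%N; rewrite !ler_norml => /andP[? ?] /andP[? ?]; lra.
Qed.

(** Moves the weight from the left end of a cell to any point t of it, since dominated convergence
    needs a bound that does not depend on the mesh. *)
Lemma decay_shift (x t : R) : `|x - t| <= 1 -> decay x <= 4 * (oneDsqr t)^-1.
Proof.
move=> xt; have tx : 1 + `|t| <= 2 * (1 + `|x|).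
  have := ler_normB x (x - t); rewrite subKr; have := normr_ge0 x; lra.
have o0 : 0 < oneDsqr t by exact: lt_le_trans (oneDsqr_ge1 t).
have n0 := normr_ge0 t; have n1 := normr_ge0 x.
rewrite /decay ler_pdivlMr // mulrC ler_pdivrMr ?exprn_gt0 ?ltr_wpDr //.
by rewrite /oneDsqr -(real_normK (num_real t)); nra.
Qed.

Let mu := @lebesgue_measure R.

Lemma integrable_oneDsqrV : mu.-integrable setT (fun t : R => ((oneDsqr t)^-1)%:E).
Proof.
have c : continuous (fun t : R => (oneDsqr t)^-1) by exact: continuous_oneDsqrV.
have m : measurable_fun [set: R] (EFin \o (fun t : R => (oneDsqr t)^-1)).
  by apply/measurable_EFinP; exact: continuous_measurable_fun.
apply/integrableP; split => //.
under eq_integral do rewrite gee0_abs ?lee_fin ?invr_ge0 //.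
rewrite ge0_symfun_integralT //.
- rewrite (_ : [set x | _] = `[0, +oo[%classic); last first.
    by apply/seteqP; split => x/=; rewrite in_itv/= andbT.
  by rewrite integral0y_oneDsqr -EFinM ltry.
- by move=> x /=; rewrite /oneDsqr sqrrN.
Qed.

End Decay.

Section RiemannSums.
Context {R : realType}.
Let mu := @lebesgue_measure R.
Implicit Types (D : set R) (F : seq R -> R).

(** The domain is a parameter because two are used: the half-line for the integral over the orthant,
    the whole line for the total mass of the kernel. *)
Fixpoint iter_int D (c : nat) (g : seq R -> \bar R) : \bar R :=
  if c is c'.+1 then (\int[mu]_(x in D) iter_int D c' (fun s => g (x :: s)))%E
  else g [::].

Fixpoint iter_rsum (a h : R) (B c : nat) F : R :=
  if c is c'.+1 then
    \sum_(l < B) h * iter_rsum a h B c' (fun s => F (a + h * l%:R :: s))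
  else F [::].

Lemma eq_iter_int D c g1 g2 : (forall s, size s = c -> g1 s = g2 s) ->
  iter_int D c g1 = iter_int D c g2.
Proof.
elim: c g1 g2 => /= [|c IH] g1 g2 g12; first exact: g12.
by apply: eq_integral => x _; apply: IH => s sc; rewrite g12 //= sc.
Qed.

Lemma iter_rsum_ge0 a h B c F : 0 <= h -> (forall s, 0 <= F s) ->
  0 <= iter_rsum a h B c F.
Proof.
move=> h0; elim: c F => //= c IH F F0.
by apply: sumr_ge0 => l _; rewrite mulr_ge0 // IH.
Qed.

Lemma iter_rsum_le a h B c F (K : R) : 0 < h <= 1 -> 0 <= K ->
  (forall s, size s = c -> F s <= K * \prod_(x <- s) decay x) ->
  iter_rsum a h B c F <= K * 4 ^+ c.
Proof.
move=> h01; have h0 : 0 <= h by case/andP: h01 => /ltW.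
elim: c F K => /= [|c IH] F K K0 FK.
  by have := FK [::] erefl; rewrite big_nil.
rewrite exprS mulrA (mulrC K) -mulrA.
apply: (@le_trans _ _ (\sum_(l < B) (h * decay (a + h * l%:R)) * (K * 4 ^+ c))).
  apply: ler_sum => l _; rewrite -mulrA ler_wpM2l // mulrA IH //.
    by rewrite mulr_ge0 // ltW // decay_gt0.
  move=> s sc; have := FK (a + h * l%:R :: s); rewrite big_cons /= sc.
  by rewrite mulrA (mulrC K); apply.
by rewrite -mulr_suml ler_wpM2r ?sum_decay_le // mulr_ge0 // exprn_ge0.
Qed.

(* The iterated Riemann sums of c+1 variables are integrals of step functions of
   the first one, so dominated convergence applies as soon as the sums over the
   other variables converge along convergent first coordinates: hence the
   continuous form of convergence assumed of [F_ n]. *)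
Lemma iter_rsum_cvg D (a h : nat -> R) (B : nat -> nat) :
  measurable D ->
  (forall n, 0 < h n <= 1) -> h n @[n --> \oo] --> (0 : R) ->
  (forall n l, (l < B n)%N ->
     `]a n + h n * l%:R, a n + h n * l.+1%:R] `<=` D) ->
  (forall t, D t -> \forall n \near \oo, a n < t <= a n + h n * (B n)%:R) ->
  forall c (F_ : nat -> seq R -> R) F (K : R), 0 <= K ->
  (forall n s, 0 <= F_ n s) ->
  (forall n s, size s = c -> F_ n s <= K * \prod_(x <- s) decay x) ->
  (forall (s_ : nat -> seq R) s, (forall n, size (s_ n) = c) -> size s = c ->
     (forall i, nth 0 (s_ n) i @[n --> \oo] --> nth 0 s i) ->
     F_ n (s_ n) @[n --> \oo] --> F s) ->
  exists v : R, [/\ iter_int D c (fun s => (F s)%:E) = v%:E,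
    iter_rsum (a n) (h n) (B n) c (F_ n) @[n --> \oo] --> v &
    ((0 < mu D)%E -> (forall s, 0 < F s) -> 0 < v)].
Proof.
move=> mD h01 h_0 subD covD; elim=> [|c IH] F_ F K K0 F_ge0 FK F_F /=.
  by exists (F [::]); split => //; apply: (F_F (fun=> [::])) => // i; exact: cvg_cst.
have h_gt0 n : 0 < h n by case/andP: (h01 n).
have h_ge0 n : 0 <= h n by exact: ltW.
have h_le1 n : h n <= 1 by case/andP: (h01 n).
have IHt (x_ : nat -> R) x : x_ n @[n --> \oo] --> x ->
   exists v : R, [/\ iter_int D c (fun s => (F (x :: s))%:E) = v%:E,
     iter_rsum (a n) (h n) (B n) c (fun s => F_ n (x_ n :: s)) @[n --> \oo] --> v &
     ((0 < mu D)%E -> (forall s, 0 < F (x :: s)) -> 0 < v)].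
  move=> x_x; apply: (IH (fun n s => F_ n (x_ n :: s)) (fun s => F (x :: s)) K K0).
  - by move=> n s; exact: F_ge0.
  - move=> n s sc; apply: le_trans (FK _ _ _) _; first by rewrite /= sc.
    rewrite big_cons ler_wpM2l // ler_piMl ?decay_le1 //.
    by apply: prodr_ge0 => y _; rewrite ltW ?decay_gt0.
  - move=> s_ s s_c sc s_s; apply: (F_F (fun n => x_ n :: s_ n)) => [n||].
    + by rewrite /= s_c.
    + by rewrite /= sc.
    + by case=> [|i] /=; [exact: x_x|exact: s_s].
pose Psi x : R := fine (iter_int D c (fun s => (F (x :: s))%:E)).
have PsiE x : iter_int D c (fun s => (F (x :: s))%:E) = (Psi x)%:E.
  by rewrite /Psi; have [v [-> _]] := IHt (fun=> x) x (cvg_cst x).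
have rcvg (x_ : nat -> R) x : x_ n @[n --> \oo] --> x ->
    iter_rsum (a n) (h n) (B n) c (fun s => F_ n (x_ n :: s)) @[n --> \oo] --> Psi x.
  by move=> /IHt [v [+ + _]]; rewrite PsiE => -[->].
pose w n (l : nat) := iter_rsum (a n) (h n) (B n) c
   (fun s => F_ n (a n + h n * l%:R :: s)).
have w_ge0 n l : 0 <= w n l by apply: iter_rsum_ge0 => // s; exact: F_ge0.
(* Half-open cells are disjoint; being open on the left, they stay inside the open half-line when a
   = 0. *)
pose I n (l : nat) : set R := `]a n + h n * l%:R, a n + h n * l.+1%:R]%classic.
have mI n l : measurable (I n l) by exact: measurable_itv.
pose f_ n t : R := \sum_(l < B n) w n l * \1_(I n l) t.
have mfl n l : measurable_fun D (fun t => w n l * \1_(I n l) t).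
  by apply: measurable_funM => //; exact: measurable_indic.
have mf_ n : measurable_fun D (fun t => (f_ n t)%:E).
  by apply/measurable_EFinP; apply: measurable_sum => l; exact: mfl.
have Iuniq n l l' t : t \in I n l -> t \in I n l' -> l = l'.
  rewrite !inE /I /= !in_itv /= => /andP[u1 u2] /andP[u3 u4].
  have u5 := lt_le_trans u1 u4; have u6 := lt_le_trans u3 u2.
  move: u5 u6; rewrite !ltrD2l !ltr_pM2l // !ltr_nat !ltnS => u5 u6.
  by apply/eqP; rewrite eqn_leq u5 u6.
have f_E n l t : (l < B n)%N -> t \in I n l -> f_ n t = w n l.
  move=> lB tl; rewrite /f_ (bigD1 (Ordinal lB)) //= indicE tl mulr1.
  rewrite big1 ?addr0 // => l' /eqP ne; rewrite indicE.
  case: (boolP (t \in I n l')) => [tl'|]; last by rewrite mulr0.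
  by case: ne; apply: val_inj; exact: Iuniq tl' tl.
have f_bound n t : `|f_ n t| <= (K * 4 ^+ c * 4) * (oneDsqr t)^-1.
  have K'0 : 0 <= K * 4 ^+ c * 4 by rewrite !mulr_ge0 // exprn_ge0.
  have [[l lB tl]|none] := pselect (exists2 l, (l < B n)%N & t \in I n l); last first.
    rewrite /f_ big1 ?normr0 ?mulr_ge0 ?invr_ge0 // => l _.
    rewrite indicE; case: (boolP (t \in I n l)) => [tl|]; last by rewrite mulr0.
    by case: none; exists l.
  rewrite (f_E n l) // ger0_norm //.
  apply: (@le_trans _ _ ((K * decay (a n + h n * l%:R)) * 4 ^+ c)).
    apply: iter_rsum_le => //; first by rewrite mulr_ge0 // ltW // decay_gt0.
    by move=> s sc; apply: le_trans (FK _ _ _) _; rewrite /= ?sc // big_cons mulrA.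
  rewrite -!mulrA ler_wpM2l // mulrC ler_wpM2l ?exprn_ge0 // decay_shift //.
  move: tl; rewrite inE /I /= in_itv /= -natr1 mulrDr mulr1 addrA => /andP[u1 u2].
  by have := h_le1 n; rewrite ler_norml; lra.
have f_cvg t : D t -> f_ n t @[n --> \oo] --> Psi t.
  (* The index of the cell of t: cells are closed on the right, hence the ceiling minus one. *)
  move=> Dt; pose ix n := `|Num.ceil ((t - a n) / h n)|.-1%N.
  have ixP n : a n < t <= a n + h n * (B n)%:R -> (ix n < B n)%N && (t \in I n (ix n)).
    move=> /andP[at_ tB]; set x := (t - a n) / h n.
    have x0 : 0 < x by rewrite divr_gt0 // subr_gt0.
    have cx0 : (0 < Num.ceil x)%R by rewrite ceil_gt0.
    have cE : (ix n).+1%:R = (Num.ceil x)%:~R :> R.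
      rewrite /ix -/x prednK ?absz_gt0 ?gt_eqF //.
      by rewrite natr_absz gtr0_norm.
    have x1 : x <= (ix n).+1%:R by rewrite cE ceil_ge.
    have x2 : (ix n)%:R < x.
      by have := ceilB1_lt x; rewrite intrB -cE -natr1; lra.
    have tE : t = a n + h n * x by rewrite /x mulrCA divff ?gt_eqF // mulr1; lra.
    apply/andP; split.
      rewrite -(ltr_nat R) (lt_le_trans x2) // -(ler_pM2l (h_gt0 n)).
      by move: tB; rewrite [in X in X -> _]tE lerD2l.
    rewrite inE /I /= in_itv /= [X in _ < X]tE [X in X <= _]tE.
    by rewrite ltrD2l lerD2l ltr_pM2l // ler_pM2l // x2 x1.
  (* The left end of the cell of t. The default t, taken when no cell contains it, makes the bounds
     of the squeeze hold for every n. *)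
  pose x_ n := if (ix n < B n)%N && (t \in I n (ix n)) then a n + h n * (ix n)%:R else t.
  have x_t : x_ n @[n --> \oo] --> t.
    apply: (@squeeze_cvgr _ _ _ _ (fun n => t - h n) (fun=> t)); last 2 first.
    - rewrite -[X in _ --> X]subr0; apply: cvgB => //; exact: cvg_cst.
    - exact: cvg_cst.
    apply: nearW => n; rewrite /x_; case: ifPn => [/andP[_]|_].
      rewrite inE /I /= in_itv /= -natr1 mulrDr mulr1 addrA => /andP[u1 u2].
      by apply/andP; split; lra.
    by rewrite lexx andbT lerBlDr lerDl.
  apply: cvg_trans (rcvg _ _ x_t); apply: near_eq_cvg.
  near=> n.
  have Hn : (ix n < B n)%N && (t \in I n (ix n)).
    by apply: ixP; near: n; exact: covD.
  by rewrite /x_ Hn; case/andP: Hn => u1 u2; rewrite (f_E n (ix n)).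
have f_int n : (\int[mu]_(t in D) (f_ n t)%:E = (iter_rsum (a n) (h n) (B n) c.+1 (F_ n))%:E)%E.
  rewrite /f_; under eq_integral do rewrite -sumEFin.
  rewrite ge0_integral_sum //; first last.
  - by move=> l x _; rewrite lee_fin mulr_ge0.
  - by move=> l; apply/measurable_EFinP; exact: mfl.
  rewrite /= -sumEFin; apply: eq_bigr => l _.
  transitivity ((w n l)%:E * mu (I n l `&` D))%E.
    apply: etrans (@integralZl_indic _ _ _ mu D mD (fun=> I n l) _ _ (mI n l)) _.
      by move=> wlt; have := w_ge0 n l; rewrite leNgt wlt.
    by congr (_ * _)%E; exact: (@integral_indic _ _ _ mu D mD _ (mI n l)).
  rewrite setIidl; last by exact: subD.
  rewrite /mu lebesgue_measure_itv /= lte_fin ltrD2l ltr_pM2l // ltr_nat ltnSn.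
  rewrite -EFinB -EFinM; congr (_%:E).
  by rewrite mulrC -natr1; congr (_ * _); rewrite mulrDr mulr1; ring.
have ig : mu.-integrable D (fun t => ((K * 4 ^+ c * 4) * (oneDsqr t)^-1)%:E).
  apply: (@integrableS _ _ _ mu setT) => //.
  under eq_fun do rewrite EFinM.
  by apply: integrableZl => //; exact: integrable_oneDsqrV.
have mPsi : measurable_fun D (fun t => (Psi t)%:E).
  apply: (@emeasurable_fun_cvg _ _ _ D (fun n t => (f_ n t)%:E)) => // t Dt.
  by apply: cvg_EFin; [exact: nearW|exact: f_cvg].
have f_Psi t : D t -> (f_ n t)%:E @[n --> \oo] --> (Psi t)%:E.
  by move=> Dt; apply: cvg_EFin; [exact: nearW|exact: f_cvg].
have [iPsi _ cvI] := @dominated_convergence _ _ R mu D mD _ _ _ mf_ mPsi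
  (aeW mu f_Psi) ig (aeW mu (fun t n _ => f_bound n t)).
have fin := @integrable_fin_num _ _ R mu D mD _ iPsi.
exists (fine (\int[mu]_(t in D) (Psi t)%:E)%E); split.
- by rewrite fineK //; apply: eq_integral => t _; exact: PsiE.
- move: cvI; under eq_fun do rewrite f_int.
  by rewrite -[X in _ --> X -> _]fineK // => /fine_cvgP [].
move=> D0 Fpos; have Psi0 t : 0 < Psi t.
  have [v [+ _ v0]] := IHt (fun=> t) t (cvg_cst t).
  by rewrite PsiE => -[->]; apply: v0 => // s; exact: Fpos.
have I0 : (0 <= \int[mu]_(t in D) (Psi t)%:E)%E.
  by apply: integral_ge0 => t _; rewrite lee_fin ltW.
(* If the integral were 0, the positive function [Psi] would vanish almost everywhere on D, so D
   would be negligible. *)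
rewrite -lte_fin fineK // lt_neqAle I0 andbT eq_sym; apply: contraTneq D0 => I00.
have : ae_eq mu D (fun t => (Psi t)%:E) (cst 0%E).
  apply/(ae_eq_integral_abs mu mD mPsi); apply: etrans I00.
  by apply: eq_integral => t _; rewrite gee0_abs // lee_fin ltW.
move=> ae0; have -> : mu D = 0%E; last by rewrite ltxx.
apply/(negligibleP mu mD); apply: negligibleS ae0 => t Dt /= /(_ Dt) [] /eqP.
by rewrite gt_eqF.
Unshelve. all: by end_near.
Qed.

End RiemannSums.

(** * Gaussian integrals *)

Section Quadratic.
Context {R : realType}.

Definition bform k (A : 'M[R]_k) (u v : 'I_k -> R) : R :=
  \sum_i \sum_j u i * A i j * v j.

Definition posdef k (A : 'M[R]_k) : Prop :=
  (forall i j, A i j = A j i) /\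
  forall v : 'I_k -> R, (exists i, v i != 0) -> 0 < bform A v v.

Lemma eq_bform k (A : 'M[R]_k) u u' v v' : u =1 u' -> v =1 v' ->
  bform A u v = bform A u' v'.
Proof.
by move=> uu vv; apply: eq_bigr => i _; apply: eq_bigr => j _; rewrite uu vv.
Qed.

Lemma posdef_ge0 k (A : 'M[R]_k) v : posdef A -> 0 <= bform A v v.
Proof.
move=> [_ pA]; have [e|e] := pselect (exists i, v i != 0); first exact/ltW/pA.
rewrite le_eqVlt; apply/orP; left; rewrite eq_sym; apply/eqP.
rewrite /bform big1 // => i _; rewrite big1 // => j _.
case: (eqVneq (v j) 0) => [->|vj]; first by rewrite mulr0.
by case: e; exists j.
Qed.

Definition schur k (A : 'M[R]_(1 + k)) : 'M[R]_k :=
  drsubmx A - (A 0 0)^-1 *: (dlsubmx A *m ursubmx A).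

Lemma det_schur k (A : 'M[R]_(1 + k)) : A 0 0 != 0 ->
  \det A = A 0 0 * \det (schur A).
Proof.
move=> d0; pose L : 'M[R]_(1 + k) := block_mx 1%:M 0 (- (A 0 0)^-1 *: dlsubmx A) 1%:M.
have dL : \det L = 1 by rewrite det_lblock !det1 mulr1.
have ul : ulsubmx A = (A 0 0)%:M.
  apply/matrixP => i j; rewrite !ord1 !mxE /= mulr1n.
  by congr (A _ _); apply: val_inj.
have <- : \det (L *m A) = \det A by rewrite det_mulmx dL mul1r.
rewrite -[in LHS](submxK A) mulmx_block !mul1mx !mul0mx !addr0 ul.
rewrite -!scalemxAl mul_mx_scalar scalerA.
have -> : - (A 0 0)^-1 * A 0 0 = -1 by rewrite mulNr mulVf.
rewrite scaleN1r addNr det_ublock det_scalar1; congr (_ * \det _).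
by rewrite scaleNr addrC.
Qed.

Definition ocons k (x : R) (v : 'I_k -> R) : 'I_k.+1 -> R :=
  fun i => if unlift ord0 i is Some j then v j else x.

(** Completing the square in coordinate 0: a Gaussian integral loses one variable while the
    determinant loses the factor A 0 0. *)
Lemma bform_ocons k (A : 'M[R]_(1 + k)) x v : (forall i j, A i j = A j i) ->
  A 0 0 != 0 ->
  bform A (ocons x v) (ocons x v) =
  A 0 0 * (x + (\sum_j A 0 (lift ord0 j) * v j) / A 0 0) ^+ 2 + bform (schur A) v v.
Proof.
move=> sA d0; set r := \sum_j _.
have rsh (i : 'I_k) : rshift 1 i = lift ord0 i by exact: val_inj.
have lsh : lshift k (0 : 'I_1) = 0 :> 'I_k.+1 by exact: val_inj.
have o0 : ocons x v ord0 = x by rewrite /ocons unlift_none.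
have ol j : ocons x v (lift ord0 j) = v j by rewrite /ocons liftK.
have -> : bform (schur A) v v = bform (drsubmx A) v v - r ^+ 2 / A 0 0.
  have -> : r ^+ 2 / A 0 0 =
      \sum_i \sum_j v i * ((A 0 0)^-1 * (A 0 (lift ord0 i) * A 0 (lift ord0 j))) * v j.
    rewrite expr2 {1}/r mulr_suml mulr_suml; apply: eq_bigr => i _.
    rewrite /r mulr_sumr mulr_suml; apply: eq_bigr => j _; ring.
  rewrite /bform -sumrB; apply: eq_bigr => i _; rewrite -sumrB; apply: eq_bigr => j _.
  rewrite /schur !mxE big_ord1 !mxE !rsh lsh (sA (lift ord0 i) 0); ring.
have -> : bform A (ocons x v) (ocons x v) =
    A 0 0 * x ^+ 2 + 2 * x * r + bform (drsubmx A) v v.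
  rewrite /bform big_ord_recl big_ord_recl o0.
  under eq_bigr do rewrite ol.
  have -> : \sum_(i < k) x * A ord0 (lift ord0 i) * v i = x * r.
    by rewrite /r mulr_sumr; apply: eq_bigr => i _; rewrite mulrA.
  under [X in _ + X]eq_bigr => i _.
    rewrite big_ord_recl o0 ol; under eq_bigr do rewrite ol; over.
  rewrite big_split /=.
  have -> : \sum_(i < k) v i * A (lift ord0 i) ord0 * x = x * r.
    by rewrite /r mulr_sumr; apply: eq_bigr => i _; rewrite sA; ring.
  have -> : \sum_(i < k) \sum_(j < k) v i * A (lift ord0 i) (lift ord0 j) * v j =
      \sum_i \sum_j v i * drsubmx A i j * v j.
    by apply: eq_bigr => i _; apply: eq_bigr => j _; rewrite !mxE !rsh.
  have -> : (ord0 : 'I_(1 + k)) = 0 by exact: val_inj.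
  ring.
by field.
Qed.

Lemma posdef_diag k (A : 'M[R]_(1 + k)) : posdef A -> 0 < A 0 0.
Proof.
move=> [_ pA]; have := pA (fun i => (i == 0)%:R).
rewrite /bform (bigD1 0) //= [X in _ + X]big1 ?addr0; last first.
  by move=> i i0; rewrite big1 // => j _; rewrite (negbTE i0) !mul0r.
rewrite (bigD1 0) //= big1 ?addr0; last first.
  by move=> i i0; rewrite (negbTE i0) !mulr0.
by rewrite ?eqxx mul1r mulr1; apply; exists 0; rewrite eqxx oner_neq0.
Qed.

Lemma posdef_schur k (A : 'M[R]_(1 + k)) : posdef A -> posdef (schur A).
Proof.
move=> pdA; have d0 := posdef_diag pdA; case: pdA => sA pA; split.
  move=> i j; rewrite /schur !mxE !big_ord1 !mxE sA; congr (_ - _ * _).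
  by rewrite mulrC; congr (_ * _); rewrite sA.
move=> v [i vi]; set r := \sum_j A 0 (lift ord0 j) * v j.
have := pA (ocons (- (r / A 0 0)) v).
rewrite bform_ocons ?gt_eqF // -/r addNr expr0n /= mulr0 add0r; apply.
by exists (lift ord0 i); rewrite /ocons liftK.
Qed.

Lemma posdef_det_gt0 k (A : 'M[R]_k) : posdef A -> 0 < \det A.
Proof.
elim: k A => [A _|k IH A pA]; first by rewrite det_mx00.
rewrite (@det_schur k A) ?gt_eqF ?posdef_diag // mulr_gt0 ?posdef_diag //.
exact/IH/posdef_schur.
Qed.

End Quadratic.

Section GaussianIntegral.
Context {R : realType}.
Let mu := @lebesgue_measure R.

(** The recursion of [iter_int] exposes the outermost integral; an explicit computation starts from
    the innermost one. *)
Lemma iter_int_rcons (D : set R) c g :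
  iter_int D c.+1 g = iter_int D c (fun s => \int[mu]_(t in D) g (rcons s t))%E.
Proof.
elim: c g => // c IH g.
rewrite [LHS]/=; apply: eq_integral => x _.
exact: (IH (fun s => g (x :: s))).
Qed.

Lemma integral_expR_quadratic (K d m e : R) : 0 <= K -> 0 < d ->
  (\int[mu]_t (K * expR (- (d * (t + m) ^+ 2 + e) / 2))%:E
    = (K * Num.sqrt (2 * pi / d) * expR (- e / 2))%:E)%E.
Proof.
(* The standard deviation of the normal density, of mean -m, that the integrand is a multiple of. *)
move=> K0 d0; pose s : R := (Num.sqrt d)^-1.
have s0 : s != 0 by rewrite invr_neq0 // gt_eqF // sqrtr_gt0.
have s2 : s ^+ 2 = d^-1 by rewrite exprVn sqr_sqrtr ?ltW.
have p0 := normal_peak_gt0 s0.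
have pE : (normal_peak s)^-1 = Num.sqrt (2 * pi / d).
  by rewrite /normal_peak invrK s2; congr Num.sqrt; field; rewrite gt_eqF.
under eq_integral => t _.
  rewrite (_ : K * _ = (K * expR (- e / 2) * Num.sqrt (2 * pi / d)) * normal_pdf (- m) s t); last first.
    rewrite normal_pdfE // -pE [RHS]mulrA divfK ?gt_eqF // -mulrA -expRD.
    congr (_ * expR _); rewrite /normal_fun s2; field; rewrite gt_eqF //.
  rewrite EFinM; over.
rewrite ge0_integralZl //.
- by rewrite integral_normal_pdf // mule1 mulrAC.
- by apply/measurable_EFinP; exact: measurable_normal_pdf.
- by move=> t _; rewrite lee_fin normal_pdf_ge0.
- by rewrite lee_fin !mulr_ge0 ?expR_ge0 // sqrtr_ge0.
Qed.

(** The list is read backwards so that coordinate 0, which [schur] eliminates, is the innermost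
    variable of integration. *)
Lemma iter_int_gauss k (A : 'M[R]_k) (K : R) : posdef A -> 0 <= K ->
  iter_int setT k (fun s =>
    (K * expR (- bform A (fun i => nth 0 (rev s) i) (fun i => nth 0 (rev s) i) / 2))%:E)
  = (K * Num.sqrt ((2 * pi) ^+ k / \det A))%:E.
Proof.
elim: k A K => [A K _ K0|k IH A K pA K0].
  by rewrite /= det_mx00 /bform big_ord0 oppr0 mul0r expR0 expr0 divr1 sqrtr1.
have d0 := posdef_diag pA; have [sA _] := pA.
have pS := posdef_schur pA; have dS := posdef_det_gt0 pS.
rewrite iter_int_rcons.
transitivity (iter_int setT k (fun s : seq R => (K * Num.sqrt (2 * pi / A 0 0) *
   expR (- bform (schur A) (fun i => nth 0 (rev s) i) (fun i => nth 0 (rev s) i) / 2))%:E)).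
  apply: eq_iter_int => s _; set v := fun i : 'I_k => nth 0 (rev s) i.
  rewrite -(integral_expR_quadratic ((\sum_j A 0 (lift ord0 j) * v j) / A 0 0)) //.
  apply: eq_integral => t _; congr ((_ * expR (- _ / 2))%:E).
  rewrite -(@bform_ocons _ _ A) ?gt_eqF //; apply: eq_bform => i;
    by rewrite rev_rcons /ocons; case: unliftP => [j ->|->].
rewrite IH ?mulr_ge0 ?sqrtr_ge0 // -mulrA -sqrtrM; last first.
  by rewrite divr_ge0 ?mulr_ge0 ?pi_ge0 // ltW.
congr ((_ * Num.sqrt _)%:E); rewrite det_schur ?gt_eqF // exprS; field.
by rewrite !gt_eqF.
Qed.

End GaussianIntegral.

(** * Convolutions on the lattice *)

Section Grid.
Context {R : realType} {k : nat}.
Implicit Types (f g : lat k -> R) (y v : lat k) (j : 'I_k) (js : seq 'I_k).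

Definition axis j (l : nat) : lat k := [ffun i => if i == j then l%:Z else 0].

Fixpoint grid (B : nat) js : seq (lat k) :=
  if js is j :: js' then [seq axis j l + v | l <- iota 0 B, v <- grid B js']
  else [:: 0].

Definition conv (s : seq (lat k)) (c : lat k -> R) f y : R :=
  \sum_(v <- s) c v * f (y - v).

Lemma mem_grid B js v : uniq js ->
  (v \in grid B js) =
  [forall i, if i \in js then (0 <= v i) && (v i < B%:Z) else v i == 0].
Proof.
elim: js v => [|j js IH] v /=.
  rewrite inE => _; apply/eqP/forallP => [-> i|v0]; first by rewrite ffunE.
  by apply/ffunP => i; rewrite ffunE; apply/eqP; exact: v0.
move=> /andP[jjs ujs]; apply/allpairsP/forallP.
  move=> [[l w] /= [lB]]; rewrite IH // => /forallP wg -> i.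
  rewrite !ffunE inE; have := wg i; case: (i =P j) => [->|_]; last by rewrite orFb add0r.
  rewrite (negbTE jjs) orTb => /eqP ->; rewrite addr0 ltz_nat.
  by move: lB; rewrite mem_iota.
move=> vg; have := vg j; rewrite inE eqxx /= => /andP[v0 vB].
exists (`|v j|%N, v - axis j `|v j|%N); rewrite /=; split.
- by rewrite mem_iota /= -ltz_nat gez0_abs.
- rewrite IH //; apply/forallP => i; rewrite !ffunE; have := vg i; rewrite inE.
  case: (i =P j) => [->|_]; last by rewrite orFb subr0.
  by rewrite orTb (negbTE jjs) gez0_abs // subrr.
- by rewrite addrC subrK.
Qed.

Lemma grid_uniq B js : uniq js -> uniq (grid B js).
Proof.
elim: js => // j js IH /= /andP[jjs ujs].
apply: allpairs_uniq; [exact: iota_uniq|exact: IH|].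
move=> [l v] [l' v'] /allpairsP[[a b] /= [_ bg [-> ->]]] /allpairsP[[a' b'] /= [_ bg' [-> ->]]].
move=> e; have b0 (w : lat k) : w \in grid B js -> w j = 0.
  by rewrite mem_grid // => /forallP /(_ j); rewrite (negbTE jjs) => /eqP.
have : a = a'.
  have /ffunP/(_ j) := e; rewrite !ffunE eqxx !b0 // !addr0.
  by case.
by move=> ea; move: e; rewrite ea => /addrI ->.
Qed.

Lemma conv_conv s c s' c' f y :
  conv s c (conv s' c' f) y = conv s' c' (conv s c f) y.
Proof.
rewrite /conv; under eq_bigr do rewrite mulr_sumr.
under [RHS]eq_bigr do rewrite mulr_sumr.
rewrite exchange_big /=; apply: eq_bigr => v _; apply: eq_bigr => w _.
by rewrite mulrCA; congr (_ * (_ * f _)); rewrite addrAC.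
Qed.

Lemma walk_conv q s c f y : walk q (conv s c f) y = conv s c (walk q f) y.
Proof.
rewrite /walk /conv; under eq_bigr do rewrite mulr_sumr.
under [RHS]eq_bigr do rewrite mulr_sumr.
rewrite exchange_big /=; apply: eq_bigr => v _; apply: eq_bigr => w _.
by rewrite mulrCA; congr (_ * (_ * f _)); rewrite addrAC.
Qed.

Lemma iter_walk_conv q n s c f y :
  iter n (walk q) (conv s c f) y = conv s c (iter n (walk q) f) y.
Proof.
elim: n y => //= n IH y; rewrite (eq_walk _ IH); exact: walk_conv.
Qed.

(** A step lowers each coordinate by 0 or 1, so n steps from y see only this window. Weights of
    infinite support can therefore be cut off at no cost. *)
Lemma iter_walk_local q n f g y :
  (forall x : lat k, (forall j, y j - n%:Z <= x j <= y j) -> f x = g x) ->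
  iter n (walk q) f y = iter n (walk q) g y.
Proof.
elim: n y => [|n IH] y fg /=.
  by apply: fg => j; rewrite subr0 lexx.
apply: eq_bigr => X _; congr (_ * _); apply: IH => x xy; apply: fg => j.
by have := xy j; rewrite !ffunE; case: (j \in X) => /=; lia.
Qed.

Definition point0 y : R := (y == 0)%:R.

(** A function cut to a finite set is a convolution with the unit mass, the form in which
    [conv_conv] can exchange it with another one. *)
Lemma conv_point0 s c y : uniq s -> conv s c point0 y = if y \in s then c y else 0.
Proof.
move=> us; rewrite /conv; case: ifPn => [ys|ys].
  rewrite (bigD1_seq y) //= /point0 subrr eqxx mulr1 big1 ?addr0 //.
  by move=> v vy; rewrite subr_eq0 eq_sym (negbTE vy) mulr0.
rewrite big1_seq // => v /andP[_ vs]; rewrite /point0 subr_eq0.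
by case: eqP => [e|_]; [rewrite e vs in ys|rewrite mulr0].
Qed.

Fixpoint lvec js (ls : seq nat) : lat k :=
  match js, ls with
  | j :: js', l :: ls' => axis j l + lvec js' ls'
  | _, _ => 0
  end.

Lemma lvecE js ls i : uniq js -> size ls = size js ->
  lvec js ls i = (nth 0%N ls (index i js))%:Z.
Proof.
elim: js ls => [|j js IH] [|l ls] //=; first by rewrite ffunE.
move=> /andP[jjs ujs] [sl]; rewrite !ffunE IH // (eq_sym j).
case: (i =P j) => [->|_]; last by rewrite add0r.
by rewrite memNindex // nth_default ?sl // addr0.
Qed.

Lemma sum_iota (B : nat) (F : nat -> R) : \sum_(l <- iota 0 B) F l = \sum_(l < B) F l.
Proof. by rewrite -(big_mkord xpredT F) /index_iota subn0. Qed.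

Lemma sum_grid_iter_rsum B js f (a h : R) (F : seq R -> R) :
  (forall ls, size ls = size js ->
     f (lvec js ls) = F [seq a + h * l%:R | l <- ls]) ->
  h ^+ size js * (\sum_(v <- grid B js) f v) = iter_rsum a h B (size js) F.
Proof.
elim: js f F => [|j js IH] f F fF /=.
  by rewrite big_seq1 mul1r (fF [::]).
rewrite big_allpairs_dep /= sum_iota.
rewrite exprS -mulrA mulr_sumr mulr_sumr; apply: eq_bigr => l _; congr (_ * _).
apply: (IH (fun v => f (axis j l + v)) (fun s => F (a + h * l%:R :: s))) => ls sl.
by rewrite (fF (nat_of_ord l :: ls)) //= sl.
Qed.

(** One coordinate at a time: with mesh 1/T, each sum is T times one of those bounded by
    [sum_decay_le]. *)
Lemma sum_grid_decay_le B js (T : R) (x : 'I_k -> R) : uniq js -> 1 <= T ->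
  \sum_(v <- grid B js) \prod_(j <- js) decay ((x j - (v j)%:~R) / T)
    <= (4 * T) ^+ size js.
Proof.
move=> + T1; have T0 : 0 < T by exact: lt_le_trans T1.
elim: js => [_|j js IH /= /andP[jjs ujs]].
  by rewrite /= big_seq1 big_nil.
rewrite big_allpairs_dep /= sum_iota.
have h1 : 0 < T^-1 <= 1 by rewrite invr_gt0 T0 invf_le1.
apply: (@le_trans _ _ (\sum_(l < B) decay ((x j - l%:R) / T) * (4 * T) ^+ size js)).
  apply: ler_sum => l _; apply: le_trans (ler_wpM2l (ltW (decay_gt0 _)) (IH ujs)).
  rewrite mulr_sumr le_eqVlt; apply/orP; left; apply/eqP.
  apply: eq_big_seq => v; rewrite mem_grid // => /forallP vg.
  rewrite big_cons !ffunE eqxx; have := vg j; rewrite (negbTE jjs) => /eqP ->.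
  rewrite addr0; congr (_ * _); apply: eq_big_seq => i ijs; rewrite !ffunE.
  by case: eqP => [e|_]; [rewrite e (negbTE jjs) in ijs|rewrite add0r].
rewrite -mulr_suml exprS ler_wpM2r ?exprn_ge0 ?mulr_ge0 ?(ltW T0) //.
have := sum_decay_le (- x j / T) B h1; rewrite -mulr_sumr mulrC ler_pdivrMr //.
apply: le_trans; apply: ler_sum => l _; rewrite /decay.
rewrite (_ : - x j / T + _ = - ((x j - l%:R) / T)) ?normrN //; field.
by rewrite gt_eqF.
Qed.

End Grid.

Section Products.
Context {R : realType} {k : nat}.
Implicit Types (f : 'I_k -> int -> R) (j : 'I_k) (y : lat k).

Definition prodf f y : R := \prod_j f j (y j).

Definition dif1 (g : int -> R) (x : int) : R := g x - g (x - 1).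

Lemma eq_prodf f f' : (forall j x, f j x = f' j x) -> prodf f =1 prodf f'.
Proof. by move=> ff y; apply: eq_bigr => j _; rewrite ff. Qed.

Lemma diff_prodf j f y :
  diff j (prodf f) y = prodf (fun i => if i == j then dif1 (f j) else f i) y.
Proof.
rewrite /diff /prodf (bigD1 j) //= [X in _ - X](bigD1 j) //= [RHS](bigD1 j) //=.
rewrite eqxx !ffunE inE eqxx /dif1 mulrBl; congr (_ * _ - _ * _).
  by apply: eq_bigr => i /negbTE ->.
by apply: eq_bigr => i ij; rewrite !ffunE inE (negbTE ij) subr0.
Qed.

Lemma diffs_prodf s f y : uniq s ->
  diffs s (prodf f) y = prodf (fun i => if i \in s then dif1 (f i) else f i) y.
Proof.
elim: s y => //= j s IH y /andP[js us].
rewrite (eq_diff j (fun z => IH z us)) diff_prodf; apply: eq_prodf => i x.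
by rewrite inE; case: eqP => [->|_] //=; rewrite (negbTE js).
Qed.

Lemma prodf_le f (M : R) y : (forall j x, `|f j x| <= M) -> `|prodf f y| <= M ^+ k.
Proof.
move=> fM; rewrite normr_prod -[k in leRHS]card_ord -prodr_const.
by apply: ler_prod => j _; rewrite normr_ge0 fM.
Qed.

(** Go from y' to y by unit moves in the coordinate directions, by induction on their number. *)
Lemma diff_lipschitz (u : lat k -> R) (L : R) y y' :
  (forall j z, `|diff j u z| <= L) ->
  `|u y - u y'| <= L * \sum_j `|(y j - y' j)%:~R|.
Proof.
move=> uL; have [N] := ubnP (\sum_j `|y j - y' j|)%N.
elim: N y y' => // N IH y y' yN.
have [/forallP e|] := boolP [forall j, y j == y' j].
  have -> : y = y' by apply/ffunP => j; apply/eqP.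
  by rewrite subrr normr0 big1 ?mulr0 // => j _; rewrite subrr normr0.
rewrite negb_forall => /existsP[j yj].
have red (z z' : lat k) : (forall i, i != j -> z i - z' i = y i - y' i) ->
    (`|z j - z' j|.+1 = `|y j - y' j|)%N ->
  (\sum_i `|z i - z' i| < N)%N /\
  \sum_i `|(y i - y' i)%:~R| = 1 + \sum_i `|(z i - z' i)%:~R| :> R.
  move=> zi zj; split.
    move: yN; rewrite ltnS; apply: leq_trans.
    rewrite (bigD1 j) //= [X in (_ < X)%N](bigD1 j) //= -zj addSn ltnS leq_add2l.
    by apply: leq_sum => i ij; rewrite zi.
  rewrite (bigD1 j) //= [X in _ = 1 + X](bigD1 j) //= addrA; congr (_ + _).
    by rewrite -!intr_norm -!natr_absz -zj -natr1 [LHS]addrC.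
  by apply: eq_bigr => i ij; rewrite zi.
have [lt|lt|eq] := ltgtP (y j) (y' j).
- have [||lN ->] := red y (y' - ind [set j]%SET).
  + by move=> i ij; rewrite !ffunE inE (negbTE ij) subr0.
  + by rewrite !ffunE inE eqxx /=; lia.
  have := IH _ _ lN; have := uL j y'; rewrite /diff mulrDr mulr1 !ler_norml; lra.
- have [||lN ->] := red (y - ind [set j]%SET) y'.
  + by move=> i ij; rewrite !ffunE inE (negbTE ij) subr0.
  + by rewrite !ffunE inE eqxx /=; lia.
  have := IH _ _ lN; have := uL j y; rewrite /diff mulrDr mulr1 !ler_norml; lra.
by rewrite eq eqxx in yj.
Qed.

End Products.

(** * Replacing geometric weights by point masses *)

Section GeometricReduction.
Context {R : realType} {k : nat} (q : {set 'I_k} -> R).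
Hypotheses (q_gt0 : forall X, 0 < q X) (q_sum : \sum_X q X = 1).

Lemma iter_walkZ n (c : R) f (y : lat k) :
  iter n (walk q) (fun x => c * f x) y = c * iter n (walk q) f y.
Proof.
elim: n y => //= n IH y; rewrite (eq_walk _ IH) /walk mulr_sumr.
by apply: eq_bigr => X _; rewrite mulrCA.
Qed.

Lemma iter_walkB n f g (y : lat k) :
  iter n (walk q) (fun x => f x - g x) y =
  iter n (walk q) f y - iter n (walk q) g y.
Proof.
elim: n y => //= n IH y; rewrite (eq_walk _ IH) /walk -sumrB.
by apply: eq_bigr => X _; rewrite mulrBr.
Qed.

(** If the factors in S are differences, the product is an iterated difference along S of a bounded
    product. The second bound is about one difference more and accounts for the k + 1 of
    [diffs_walk_le]. *)
Lemma walk_prodf_le (S : {set 'I_k}) : exists2 C : R, 0 <= C &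
  forall (f F : 'I_k -> int -> R) (M : R) n,
  (0 < n)%N -> 
  (forall j x, f j x = if j \in S then dif1 (F j) x else F j x) ->
  (forall j x, `|F j x| <= M) -> forall y,
  `|iter n (walk q) (prodf f) y| <= M ^+ k * (C / Num.sqrt n%:R) ^+ #|S| /\
  forall i, `|diff i (iter n (walk q) (prodf f)) y|
     <= M ^+ k * (C / Num.sqrt n%:R) ^+ #|S|.+1.
Proof.
have [C C0 CP] := diffs_walk_le q_gt0 q_sum; exists C => // f F M n n0 fF FM y.
have fE : prodf f =1 diffs (enum S) (prodf F).
  move=> x; rewrite diffs_prodf ?enum_uniq //; apply: eq_prodf => j z.
  by rewrite fF mem_enum; case: (j \in S).
have sE : size (enum S) = #|S| by rewrite -cardE.
have sS : (#|S| <= k)%N by rewrite (leq_trans (max_card _)) // card_ord.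
have wE x : iter n (walk q) (prodf f) x = diffs (enum S) (iter n (walk q) (prodf F)) x.
  by rewrite -iter_walk_diffs; exact: eq_iter_walk.
split=> [|i].
  rewrite wE -sE; apply: CP => [||z] //; first by rewrite sE leqW.
  exact: prodf_le.
rewrite (eq_diff i wE) -sE; apply: (CP (i :: enum S)) => [||z] //=.
  by rewrite sE.
exact: prodf_le.
Qed.

Definition nneg (G : nat -> R) (x : int) : R := if x is Posz n then G n else 0.

(** At z = 1 this is the indicator of the nonnegative integers, so one formula covers both S and
    C. *)
Definition geo (z : R) : int -> R := nneg (fun n => z ^+ n).

Definition point1 (x : int) : R := (x == 0)%:R.

Lemma dif1_nneg G x :
  dif1 (nneg G) x = nneg (fun n => if n is m.+1 then G n - G m else G 0%N) x.
Proof.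
rewrite /dif1; case: x => [[|m]|m].
- by rewrite (_ : 0%:Z - 1 = Negz 0) //= subr0.
- by rewrite (_ : m.+1%:Z - 1 = m) //; lia.
- by rewrite (_ : Negz m - 1 = Negz m.+1) ?subr0 //; lia.
Qed.

Lemma dif1Z (c : R) (g : int -> R) x : dif1 (fun x => c * g x) x = c * dif1 g x.
Proof. by rewrite /dif1 mulrBr. Qed.

(* The geometric weights g satisfy (1 - T)^2 E = delta / (1 - z) - g for a bounded
   E, T being the unit shift: each replacement gains a factor n^(-1/2). *)
Lemma geo_reduction (S : {set 'I_k}) (zeta : 'I_k -> R) :
  (forall j, j \in S -> 0 < zeta j < 1) ->
  exists2 C : R, 0 <= C & forall (g : 'I_k -> int -> R) n,
  (forall j x, `|g j x| <= 1) -> (0 < n)%N -> forall y,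
  `|iter n (walk q) (prodf (fun j => if j \in S then geo (zeta j) else g j)) y
    - (\prod_(j in S) (1 - zeta j)^-1) *
      iter n (walk q) (prodf (fun j => if j \in S then point1 else g j)) y|
  <= C / (Num.sqrt n%:R) ^+ #|S|.+1.
Proof.
move=> zS; have [C C0 CP] := walk_prodf_le S.
pose kap j : R := (1 - zeta j)^-1.
have kap1 j : j \in S -> 1 <= kap j.
  move=> /zS /andP[z0 z1]; rewrite /kap -[leLHS]invr1 lef_pV2 ?posrE //; lra.
have kapE j : j \in S -> kap j * zeta j = kap j - 1.
  move=> /zS /andP[z0 z1]; rewrite /kap; field; apply: lt0r_neq0; lra.
(* The square makes room for [kap j * zeta j * F j], in which a factor of size [kap j] occurs
   twice. *)
pose M : R := (1 + \sum_(j in S) kap j) ^+ 2.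
have sum0 : 0 <= \sum_(j in S) kap j.
  by apply: sumr_ge0 => j /kap1; apply: le_trans.
have M1 : 1 <= M by apply: exprn_ege1; rewrite lerDl.
have M0 : 0 <= M by exact: le_trans M1.
have kapM j : j \in S -> kap j ^+ 2 <= M.
  move=> jS; have k1 := kap1 _ jS; apply: lerXn2r; rewrite ?nnegrE; [lra|lra|].
  rewrite (bigD1 j) //= [_ + _ in leRHS]addrCA lerDl addr_ge0 //.
  by apply: sumr_ge0 => i /andP[/kap1 k1' _]; apply: le_trans k1'.
exists (k%:R * (M ^+ k * C ^+ #|S|.+1)).
  by apply: mulr_ge0 => //; apply: mulr_ge0; apply: exprn_ge0.
move=> g n g1 n0 y.
(* The discrete primitive of the geometric weight: the sum of zeta^i for i <= n. *)
pose F j := nneg (fun n => kap j * (1 - zeta j ^+ n.+1)).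
pose Q := nneg (fun=> 1).
have Fb j x : j \in S -> `|F j x| <= kap j.
  move=> jS; have k1 := kap1 _ jS; have /andP[z0 z1] := zS _ jS.
  case: x => m /=; last by rewrite normr0; lra.
  have zx0 : 0 <= zeta j ^+ m.+1 by rewrite exprn_ge0 // ltW.
  have zx1 : zeta j ^+ m.+1 <= 1 by rewrite exprn_ile1 // ltW.
  rewrite normrM !ger0_norm; [|lra|lra].
  by rewrite ler_piMr; lra.
have geoF j x : j \in S -> geo (zeta j) x = dif1 (F j) x.
  move=> jS; have kE := kapE _ jS; rewrite dif1_nneg.
  case: x => [[|m]|m] //=; first by rewrite expr1 expr0; lra.
  have -> : kap j * (1 - zeta j ^+ m.+2) - kap j * (1 - zeta j ^+ m.+1) =
     (kap j - kap j * zeta j) * zeta j ^+ m.+1 by rewrite [zeta j ^+ m.+2]exprS; ring.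
  by rewrite kE; ring.
have pointE (c : R) x : c * point1 x = dif1 (fun x => c * Q x) x.
  by rewrite dif1Z dif1_nneg; case: x => [[|m]|m] //=; rewrite subrr.
have gapE j x : j \in S ->
    kap j * point1 x - geo (zeta j) x = dif1 (fun x => kap j * zeta j * geo (zeta j) x) x.
  move=> jS; have kE := kapE _ jS; rewrite dif1Z dif1_nneg kE.
  case: x => [[|m]|m] //=; rewrite ?expr0 ?mulr1 ?mulr0 ?subr0 // sub0r.
  have -> : (kap j - 1) * (zeta j ^+ m.+1 - zeta j ^+ m) =
     - zeta j ^+ m.+1 + (kap j * zeta j - (kap j - 1)) * zeta j ^+ m.
    by rewrite [zeta j ^+ m.+1]exprS; ring.
  by rewrite kE; ring.
(* Hybrid products: among the coordinates of S, those in s already carry their point mass, the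
   others still their geometric weight. Each replacement changes one factor. *)
pose phi (s : seq 'I_k) j x :=
  if j \in S then (if j \in s then kap j * point1 x else geo (zeta j) x) else g j x.
have key (s : seq 'I_k) : uniq s -> {subset s <= S} ->
  `|iter n (walk q) (prodf (phi [::])) y - iter n (walk q) (prodf (phi s)) y|
   <= (size s)%:R * (M ^+ k * (C / Num.sqrt n%:R) ^+ #|S|.+1).
  elim: s => [_ _|j s IH /= /andP[js us] sS]; first by rewrite subrr normr0 mul0r.
  have jS : j \in S by apply: sS; rewrite inE eqxx.
  have {}IH := IH us (fun i is_ => sS i (@mem_behead _ (j :: s) i is_)).
  pose h i x := if i == j then kap j * zeta j * geo (zeta j) x else phi s i x.
  pose H i x : R := if i == j then kap j * zeta j * F j x
    else if i \in S then (if i \in s then kap i * Q x else F i x) else g i x.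
  (* By [gapE] the change of the factor j is a difference of a multiple of [geo], which is itself a
     difference: this is the extra one that gains n^(-1/2). *)
  have step : iter n (walk q) (prodf (phi (j :: s))) y - iter n (walk q) (prodf (phi s)) y
     = diff j (iter n (walk q) (prodf h)) y.
    rewrite -iter_walkB -iter_walk_diff; apply: eq_iter_walk => x.
    rewrite diff_prodf /prodf (bigD1 j) //= [X in _ - X](bigD1 j) //= [RHS](bigD1 j) //=.
    rewrite eqxx /phi jS inE eqxx /= (negbTE js).
    rewrite (eq_bigr (fun i => phi s i (x i))); last first.
      by move=> i ij; rewrite /phi inE (negbTE ij).
    rewrite -mulrBl gapE // [in RHS](eq_bigr (fun i => phi s i (x i))); last first.
      by move=> i ij; rewrite (negbTE ij) /h (negbTE ij).
    by congr (_ * _); rewrite /dif1 /h eqxx.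
  have [||_ /(_ j)] := CP h H M n n0 _ _ y.
  - move=> i x; rewrite /h /H /phi; case: (i =P j) => [->|_].
      by rewrite jS dif1Z geoF.
    by case: ifP => // iS; case: ifP => _ //; rewrite ?pointE ?geoF.
  - move=> i x; rewrite /H; case: (i =P j) => [_|_].
      have k1 := kap1 _ jS; have /andP[z0 z1] := zS _ jS.
      apply: le_trans (kapM _ jS); rewrite normrM expr2 kapE // ler_pM //.
        by rewrite ger0_norm; lra.
      exact: Fb.
    case: ifP => [iS|_]; last exact: le_trans M1.
    have k1 := kap1 _ iS; apply: le_trans (kapM _ iS).
    apply: (@le_trans _ _ (kap i)); last by rewrite expr2 ler_peMr //; lra.
    case: ifP => _; last exact: Fb.
    rewrite normrM ger0_norm; last lra.
    by case: x => m /=; rewrite ?normr1 ?normr0; lra.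
  rewrite -step -natr1 mulrDl mul1r; move: IH.
  set a := iter _ _ (prodf (phi [::])) _; set b := iter _ _ _ _; set c := iter _ _ _ _.
  by rewrite !ler_norml; lra.
have eS : {subset enum S <= S} by move=> j; rewrite mem_enum.
have := key (enum S) (enum_uniq _) eS; rewrite -cardE.
have -> : iter n (walk q) (prodf (phi [::])) y =
  iter n (walk q) (prodf (fun j => if j \in S then geo (zeta j) else g j)) y.
  by apply: eq_iter_walk; apply: eq_prodf => j x; rewrite /phi in_nil; case: ifP.
have -> : iter n (walk q) (prodf (phi (enum S))) y = (\prod_(j in S) (1 - zeta j)^-1) *
      iter n (walk q) (prodf (fun j => if j \in S then point1 else g j)) y.
  rewrite -iter_walkZ; apply: eq_iter_walk => x.
  rewrite /prodf [X in _ = X * _]big_mkcond -big_split /=; apply: eq_bigr => j _.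
  by rewrite /phi mem_enum; case: (j \in S); rewrite ?mul1r.
move=> h; apply: le_trans h _.
rewrite expr_div_n !mulrA ler_wpM2r ?invr_ge0 ?exprn_ge0 ?sqrtr_ge0 //.
rewrite ler_wpM2r ?exprn_ge0 // ler_wpM2r ?(exprn_ge0 _ M0) //.
by rewrite ler_nat (leq_trans (max_card _)) // card_ord.
Qed.

End GeometricReduction.

(** * Tilting *)

Section WinProbability.
Context {R : realType} {k : nat}.
Implicit Types (y : lat k).

(** Independence of the voters: splitting off the vote of voter 0 peels one step of the walk. *)
Lemma sum_ffun_iter (T : finType) (p : T -> R) (e : T -> lat k) n
    (g : lat k -> R) y :
  \sum_(f : {ffun 'I_n -> T}) (\prod_v p (f v)) * g (y - \sum_v e (f v)) =
  iter n (fun g y => \sum_t p t * g (y - e t)) g y.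
Proof.
elim: n y => [|n IH] y.
  have f0 : {ffun 'I_0 -> T} by apply: finfun => -[].
  rewrite (bigD1 f0) //= [X in _ + X]big1 ?addr0; last first.
    by move=> f; rewrite (_ : f = f0) ?eqxx //; apply/ffunP => -[].
  by rewrite !big_ord0 mul1r subr0.
pose glue (tf : T * {ffun 'I_n -> T}) : {ffun 'I_n.+1 -> T} :=
  [ffun i => if unlift ord0 i is Some j then tf.2 j else tf.1].
have glue0 tf : glue tf ord0 = tf.1 by rewrite ffunE unlift_none.
have glueS tf i : glue tf (lift ord0 i) = tf.2 i by rewrite ffunE liftK.
rewrite (reindex glue) /=; last first.
  exists (fun f => (f ord0, [ffun i => f (lift ord0 i)])) => [[t f] _|f _].
    rewrite glue0; congr pair; apply/ffunP => i; rewrite ffunE; exact: glueS.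
  by apply/ffunP => i; rewrite ffunE; case: unliftP => [j ->|->] /=; rewrite ?ffunE.
rewrite -(pair_bigA _ (fun t f =>
  (\prod_v p (glue (t, f) v)) * g (y - \sum_v e (glue (t, f) v)))) /=.
apply: eq_bigr => t _; rewrite -IH mulr_sumr; apply: eq_bigr => f _.
rewrite !big_ord_recl !glue0 /= -mulrA; congr (_ * (_ * g _)).
  by apply: eq_bigr => i _; rewrite glueS.
by rewrite opprD addrA; congr (_ - _); apply: eq_bigr => i _; rewrite glueS.
Qed.

Variable p : {ffun 'S_k.+1 -> R}.

Lemma ranking_walk (g : lat k -> R) y :
  \sum_r p r * g (y - ind (above_m r)) = walk (pX p) g y.
Proof.
rewrite (partition_big (@above_m k) xpredT) //=; apply: eq_bigr => X _.
by rewrite /pX mulr_suml; apply: eq_bigr => r /eqP ->.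
Qed.

Lemma not_above (r : 'S_k.+1) j :
  ranked_above r ord_max (adv j) = (j \notin above_m r).
Proof.
rewrite inE /ranked_above -leqNgt [RHS]leq_eqVlt.
case: eqP => [/val_inj /perm_inj /(congr1 val) /= e|] //.
by have := ltn_ord j; rewrite -e ltnn.
Qed.

(** Count instead the N voters who rank j above m: the condition becomes N < beta_j n, and
    strictness turns it into N <= ceil(beta_j n) - 1. *)
Lemma alpha_winnerE (alpha : 'I_k -> R) n (f : {ffun 'I_n -> 'S_k.+1}) :
  alpha_winner alpha f =
  [forall j, 0 <= ([ffun j => Num.ceil ((1 - alpha j) * n%:R) - 1 : int]
     - \sum_v ind (above_m (f v)) : lat k) j].
Proof.
apply: eq_forallb => j; rewrite !ffunE sum_ffunE.
set N := (\sum_v _ : int).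
have -> : #|[set v : 'I_n | ranked_above (f v) ord_max (adv j)]|%:R = n%:R - N%:~R :> R.
  have -> : n%:R = \sum_(v < n) (1 : R) by rewrite sumr_const card_ord.
  rewrite /N rmorph_sum -sumrB -sum1_card natr_sum big_mkcond /=.
  apply: eq_bigr => v _; rewrite ffunE.
  have -> : (v \in [set v : 'I_n | ranked_above (f v) ord_max (adv j)]) = (j \notin above_m (f v)).
    by rewrite -not_above; apply/idP/idP; rewrite in_setE.
  by case: (j \in _); rewrite ?subrr ?subr0.
have -> : (alpha j * n%:R < n%:R - N%:~R) = (N%:~R < (1 - alpha j) * n%:R).
  by rewrite ltrBrDl -ltrBrDr mulrBl mul1r.
rewrite -ceil_gt_int; move: (Num.ceil _) => z; apply/idP/idP; lia.
Qed.

Lemma win_prob_walk (alpha : 'I_k -> R) n :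
  win_prob p alpha n = iter n (walk (pX p)) (prodf (fun _ => nneg (fun=> 1)))
    [ffun j => Num.ceil ((1 - alpha j) * n%:R) - 1].
Proof.
set c : lat k := finfun _; set g := prodf _.
have <- : iter n (fun g y => \sum_r p r * g (y - ind (above_m r))) g c = iter n (walk (pX p)) g c.
  by move: c; elim: n => //= n IH c; rewrite -ranking_walk; apply: eq_bigr => r _; rewrite IH.
rewrite -sum_ffun_iter /win_prob big_mkcond /=; apply: eq_bigr => f _.
rewrite alpha_winnerE -/c; case: ifPn => [/forallP h|].
  rewrite /g /prodf [X in _ = _ * X]big1 ?mulr1 // => j _.
  by have := h j; case: (_ - _ : lat k) => z /=; case: (_ j).
rewrite negb_forall => /existsP[j hj].
rewrite /g /prodf (bigD1 j) //=; move: hj; set z := (_ - _ : lat k) j.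
by case: z => // m _; rewrite mul0r mulr0.
Qed.

(** A step X multiplies the exponential weight by the product of zeta over X, which the law absorbs;
    w is any normalisation, given back as [w ^+ n]. *)
Lemma walk_tilt (zeta : 'I_k -> R) (w : R) n (f : lat k -> R) y :
  (forall j, zeta j != 0) -> w != 0 ->
  iter n (walk (pX p)) (fun z => (\prod_j zeta j ^ (- z j)) * f z) y =
  w ^+ n * (\prod_j zeta j ^ (- y j)) *
    iter n (walk (fun X => pX p X * (\prod_(j in X) zeta j) / w)) f y.
Proof.
move=> z0 w0; elim: n y => [|n IH] y; first by rewrite expr0 mul1r.
rewrite iterS (eq_walk _ IH) [in RHS]iterS /walk mulr_sumr; apply: eq_bigr => X _.
have -> : \prod_j zeta j ^ (- (y - ind X) j) =
    (\prod_j zeta j ^ (- y j)) * \prod_(j in X) zeta j.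
  rewrite [X in _ = _ * X]big_mkcond -big_split /=; apply: eq_bigr => j _.
  rewrite !ffunE opprD opprK expfzDr //; congr (_ * _).
  by case: (j \in X); rewrite ?expr1z ?expr0z.
by rewrite exprS; field.
Qed.

Lemma win_prob_tilted (zeta : 'I_k -> R) (w : R) (alpha : 'I_k -> R) n :
  (forall j, zeta j != 0) -> w != 0 ->
  win_prob p alpha n =
  w ^+ n / \prod_j zeta j ^ (Num.ceil ((1 - alpha j) * n%:R) - 1) *
  iter n (walk (fun X => pX p X * (\prod_(j in X) zeta j) / w))
    (prodf (fun j => geo (zeta j)))
    [ffun j => Num.ceil ((1 - alpha j) * n%:R) - 1].
Proof.
move=> z0 w0; rewrite win_prob_walk.
rewrite (@eq_iter_walk _ _ _ _ _
  (fun z => (\prod_j zeta j ^ (- z j)) * prodf (fun j => geo (zeta j)) z)).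
  rewrite (walk_tilt _ _ _ z0 w0) //; congr (_ * _ * _).
  by rewrite -prodfV; apply: eq_bigr => j _; rewrite ffunE invr_expz.
move=> z; rewrite /prodf -big_split /=; apply: eq_bigr => j _.
case: (z j) => m /=; last by rewrite mulr0.
by rewrite -invr_expz mulVf // expf_neq0.
Qed.

End WinProbability.

(** * The Gaussian kernel *)

Section ExpTaylor.
Context {R : realType}.
Implicit Types s r : R.

Lemma le_expR s : s <= expR s.
Proof. by have := expR_ge1Dx s; lra. Qed.

Lemma expRB1_norm_le s : `|expR s - 1| <= `|s| * expR `|s|.
Proof.
have h1 := expR_ge1Dx s; have h2 := expR_ge1Dx (- s).
have e0 := expR_gt0 s; have ee : expR s * expR (- s) = 1 by exact: expRxMexpNx_1.
have [s0|s0] := leP 0 s.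
  by rewrite (ger0_norm s0) ger0_norm; [nra|lra].
rewrite (ltr0_norm s0) ltr0_norm; last by rewrite subr_lt0 expR_lt1.
have := expR_ge1Dx (- s); nra.
Qed.

Lemma expR_taylor1_ge0 s : 0 <= expR s - 1 - s.
Proof. by have := expR_ge1Dx s; lra. Qed.

Lemma expR_taylor1 s : `|expR s - 1 - s| <= s ^+ 2 * expR `|s|.
Proof.
have h2 := expR_ge1Dx (- s); have e0 := expR_gt0 s.
have ee : expR s * expR (- s) = 1 by exact: expRxMexpNx_1.
rewrite ger0_norm ?expR_taylor1_ge0 //.
have h3 : expR s - 1 - s <= s * (expR s - 1) by nra.
apply: (le_trans h3); apply: (le_trans (ler_norm _)).
by rewrite normrM -(real_normK (num_real s)) expr2 -mulrA ler_wpM2l // expRB1_norm_le.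
Qed.

(** Mean value theorem: the derivative is the first-order remainder, bounded by [expR_taylor1]. *)
Lemma expR_taylor2 s : `|expR s - 1 - s - s ^+ 2 / 2| <= `|s| ^+ 3 * expR `|s|.
Proof.
pose f (x : R) := expR x - 1 - x - x ^+ 2 / 2.
have df (x : R) : is_derive x 1 f (expR x - 1 - x).
  rewrite /f; apply: is_derive_eq; rewrite /GRing.scale /=; lra.
have f0 : f 0 = 0 by rewrite /f expR0 expr0n /=; lra.
have cf : continuous f.
  by move=> x; apply/differentiable_continuous/derivable1_diffP; exact: ex_derive.
have bnd c : `|c| <= `|s| -> `|(expR c - 1 - c) * s| <= `|s| ^+ 3 * expR `|s|.
  move=> cs; rewrite normrM mulrC (exprS _ 2) -mulrA ler_wpM2l //.
  apply: (le_trans (expR_taylor1 c)); apply: ler_pM; rewrite ?expR_ge0 ?sqr_ge0 //.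
    by rewrite -(real_normK (num_real c)) lerXn2r ?nnegrE.
  by rewrite ler_expR.
rewrite -/(f s); have [s0|s0] := leP 0 s.
  have [c] := MVT_segment s0 (fun x _ => df x) (continuous_subspaceT cf).
  rewrite in_itv /= f0 !subr0 => /andP[c0 cs] ->; apply: bnd.
  by rewrite !ger0_norm.
have [c] := MVT_segment (ltW s0) (fun x _ => df x) (continuous_subspaceT cf).
rewrite in_itv /= f0 !sub0r => /andP[c0 cs] /eqP; rewrite eqr_oppLR mulrN opprK => /eqP ->.
by apply: bnd; rewrite !ler0_norm ?(ltW s0) //; lra.
Qed.

(** Since 1 + r <= exp (1 + r), everything goes into the exponent; with a = m + K, the square of r/2
    - a gives a r - r^2/4 <= a^2. *)
Lemma exp_neg_sqr_le (m : nat) (K r : R) : 0 <= r -> 0 <= K ->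
  (1 + r) ^+ m * expR (K * (1 + r) - r ^+ 2 / 4)
   <= expR ((m%:R + K) + (m%:R + K) ^+ 2).
Proof.
move=> r0 K0; apply: (@le_trans _ _ (expR (m%:R * (1 + r)) * expR (K * (1 + r) - r ^+ 2 / 4))).
  rewrite ler_wpM2r ?expR_ge0 // expRM_natl lerXn2r ?nnegrE ?expR_ge0 ?addr_ge0 //.
  exact: le_expR.
rewrite -expRD ler_expR.
have := sqr_ge0 (r / 2 - (m%:R + K)); lra.
Qed.

Lemma sqrt_ratio (t : R) : 0 < t ->
  Num.sqrt t / Num.sqrt (t + 1) = expR (- (ln (1 + t^-1) / 2)).
Proof.
move=> t0; have t1 : 0 < t + 1 by rewrite ltr_wpDr.
have i0 : 0 < 1 + t^-1 by rewrite ltr_wpDr ?invr_ge0 ?ltW.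
have -> : 1 + t^-1 = (t + 1) / t by field; rewrite gt_eqF.
rewrite -sqrtrV ?ltW // -sqrtrM ?ltW //.
have -> : t * (t + 1)^-1 = expR (- (ln ((t + 1) / t) / 2)) ^+ 2.
  rewrite -expRM_natl mulrN mulrCA mulfV ?mulr1 // expRN lnK ?posrE ?divr_gt0 //.
  by rewrite invf_div.
by rewrite sqrtr_sqr ger0_norm // expR_ge0.
Qed.

Lemma ln1V_bounds (t : R) : 1 <= t -> t^-1 - t^-1 ^+ 2 <= ln (1 + t^-1) <= t^-1.
Proof.
move=> t1; have t0 : 0 < t by lra.
have u0 : 0 < t^-1 by rewrite invr_gt0.
apply/andP; split; last by apply: le_ln1Dx; lra.
(* The lower bound is ln (1 + x) <= x applied to the inverse of 1 + 1/t. *)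
have := @le_ln1Dx R (- (t^-1 / (1 + t^-1))).
have e : 1 + - (t^-1 / (1 + t^-1)) = (1 + t^-1)^-1 by field; rewrite !gt_eqF //; lra.
rewrite e lnV ?posrE; last lra.
have h : -1 < - (t^-1 / (1 + t^-1)).
  by rewrite ltrN2 ltr_pdivrMr; lra.
move=> /(_ h); rewrite lerN2; apply: le_trans.
rewrite ler_pdivlMr; last lra.
have := mulr_gt0 u0 (mulr_gt0 u0 u0); nra.
Qed.

End ExpTaylor.

Section HeatStep.
Context {R : realType} {T : finType} (q : T -> R).
Hypotheses (q_ge0 : forall x, 0 <= q x) (q_sum : \sum_x q x = 1).

(** The factor by which the kernel changes from time t to t + 1 at a fixed displacement, a being
    half its squared length in units of sqrt t. *)
Lemma gauss_factor (k : nat) (t a : R) : 1 <= t -> 0 <= a ->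
  `|(Num.sqrt t / Num.sqrt (t + 1)) ^+ k * expR (a / (t + 1))
     - (1 + (a / t - k%:R / (2 * t)))|
  <= (t ^+ 2)^-1 * ((a + k%:R) ^+ 2 * expR (a / 2 + k%:R) + (a + k%:R)).
Proof.
move=> t1 a0; have t0 : 0 < t by lra.
have /andP[l1 l2] := ln1V_bounds t1.
rewrite sqrt_ratio // -expRM_natl -expRD.
have k0 : 0 <= k%:R :> R by exact: ler0n.
have -> : k%:R / (2 * t) = k%:R / 2 * t^-1 by field; rewrite gt_eqF.
have -> : (t ^+ 2)^-1 = t^-1 ^+ 2 by rewrite exprVn.
set lam := ln _ in l1 l2 *.
have b0 : 0 <= a / (t + 1) by rewrite divr_ge0 //; lra.
have bE : a / t - a / (t + 1) = a / (t + 1) * t^-1.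
  by field; rewrite !gt_eqF //; lra.
have b2 : a / (t + 1) <= a / 2 by rewrite ler_wpM2l // lef_pV2 ?posrE; lra.
move: bE b0 b2 l1 l2; set b := a / (t + 1); have : 0 < t^-1 <= 1 by rewrite invr_gt0 t0 invf_le1.
set u := t^-1; move: (k%:R : R) k0 lam u b => {k t t1 t0} k k0 lam u b.
move=> /andP[u0 u1] bE b0 b2 l1 l2.
have l0 : 0 <= lam by nra.
have bu : b <= a * u by rewrite -subr_ge0 bE mulr_ge0 // ltW.
set s := _ + b.
have sE : s = b - k / 2 * lam by rewrite /s; lra.
have kl0 : 0 <= k / 2 * lam by rewrite mulr_ge0 // divr_ge0.
have kl1 : k / 2 * lam <= k * u by nra.
have s1 : `|s| <= (a + k) * u by rewrite sE ler_norml mulrDl; lra.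
have s2 : `|s| <= a / 2 + k by rewrite sE ler_norml; nra.
have h1 : s ^+ 2 * expR `|s| <= u ^+ 2 * ((a + k) ^+ 2 * expR (a / 2 + k)).
  rewrite mulrA -exprMn; apply: ler_pM; rewrite ?sqr_ge0 ?expR_ge0 ?ler_expR //.
  by rewrite -(real_normK (num_real s)) lerXn2r ?nnegrE ?(mulrC u) // (le_trans _ s1).
have h2 : `|s - (a * u - k / 2 * u)| <= u ^+ 2 * (a + k).
  have -> : s - (a * u - k / 2 * u) = k / 2 * (u - lam) - b * u.
    by rewrite sE -bE; ring.
  have h3 : 0 <= k / 2 * (u - lam) by rewrite mulr_ge0 ?divr_ge0 //; lra.
  have h4 : k / 2 * (u - lam) <= k / 2 * u ^+ 2 by rewrite ler_wpM2l ?divr_ge0 //; lra.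
  have h5 : 0 <= b * u by rewrite mulr_ge0 // ltW.
  have h6 : b * u <= a * u ^+ 2 by rewrite expr2 mulrA ler_wpM2r // ltW.
  have h7 : 0 <= k * u ^+ 2 by rewrite mulr_ge0 ?sqr_ge0.
  by rewrite ler_norml; lra.
have := expR_taylor1 s; rewrite mulrDr => h0.
apply: (le_trans _ (lerD (le_trans h0 h1) h2)).
apply: le_trans _ (ler_normD _ _); rewrite le_eqVlt; apply/orP; left; apply/eqP.
congr `|_|; ring.
Qed.

(** The mean factor by which one step changes the kernel at time t: l is the cross term and al the
    square of the step. Mean 0, second moment t r^2 and trace k produce the same main term as in
    [gauss_factor]. *)
Lemma walk_factor (k t r kap : R) (l al : T -> R) : 1 <= t -> 0 <= r -> 0 <= kap ->
  \sum_x q x * l x = 0 -> \sum_x q x * l x ^+ 2 = t * r ^+ 2 ->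
  \sum_x q x * al x = k ->
  (forall x, `|l x| <= kap * r * Num.sqrt t) ->
  (forall x, 0 <= al x <= kap) ->
  `|\sum_x q x * expR (l x / t - al x / (2 * t))
     - (1 + (r ^+ 2 / 2 / t - k / (2 * t)))|
  <= (Num.sqrt t ^+ 3)^-1 *
     ((kap * (1 + r)) ^+ 3 * expR (kap * (1 + r)) + kap ^+ 2 * (1 + r)).
Proof.
move=> t1 r0 kap0 sl sl2 sal lb alb; have t0 : 0 < t by lra.
set S := Num.sqrt t in lb *.
have S0 : 0 < S by rewrite sqrtr_gt0.
have tE : t = S ^+ 2 by rewrite sqr_sqrtr // ltW.
have S1 : 1 <= S by rewrite -sqrtr1 ler_wsqrtr.
set i := S^-1; have i0 : 0 < i by rewrite invr_gt0.
have i1 : i <= 1 by rewrite invf_le1.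
have iE : t^-1 = i ^+ 2 by rewrite tE exprVn.
have i3 : (S ^+ 3)^-1 = i ^+ 3 by rewrite exprVn.
pose s x := l x / t - al x / (2 * t).
have ltE x : l x / t = l x * i * i by rewrite iE; ring.
have atE x : al x / (2 * t) = al x * i ^+ 2 / 2 by rewrite invfM iE; ring.
have li x : `|l x * i| <= kap * r.
  by rewrite normrM (gtr0_norm i0) ler_pdivrMr.
have sb x : `|s x| <= i * (kap * (1 + r)).
  rewrite /s ltE atE; have /andP[a0 a1] := alb x; have := li x.
  rewrite ler_norml => /andP[h1 h2].
  have h3 : 0 <= al x * i by rewrite mulr_ge0 // ltW.
  have h4 : al x * i <= kap by rewrite (le_trans _ a1) // ler_piMr.
  have -> : l x * i * i - al x * i ^+ 2 / 2 = i * (l x * i - al x * i / 2) by ring.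
  rewrite normrM (gtr0_norm i0) ler_wpM2l ?(ltW i0) // mulrDr mulr1 ler_norml; lra.
have E : \sum_x q x * (1 + s x + s x ^+ 2 / 2) =
   1 + (r ^+ 2 / 2 / t - k / (2 * t)) +
   \sum_x q x * (al x ^+ 2 * i ^+ 4 / 8 - (l x * i) * al x * i ^+ 3 / 2).
  have -> : \sum_x q x * (1 + s x + s x ^+ 2 / 2) =
      \sum_x q x + i ^+ 2 * (\sum_x q x * l x) - i ^+ 2 / 2 * (\sum_x q x * al x)
      + i ^+ 4 / 2 * (\sum_x q x * l x ^+ 2) +
      \sum_x q x * (al x ^+ 2 * i ^+ 4 / 8 - (l x * i) * al x * i ^+ 3 / 2).
    rewrite !mulr_sumr -big_split /= -sumrB -!big_split /=; apply: eq_bigr => x _.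
    by rewrite /s ltE atE; field.
  rewrite q_sum sl sl2 sal mulr0 addr0.
  have -> : i ^+ 4 / 2 * (t * r ^+ 2) = r ^+ 2 / 2 / t.
    have -> : i ^+ 4 = t^-1 * t^-1 by rewrite iE; ring.
    by field; rewrite gt_eqF.
  have -> : i ^+ 2 / 2 * k = k / (2 * t) by rewrite -iE; field; rewrite gt_eqF.
  by ring.
set m := 1 + (_ - _) in E *.
have h1 : `|\sum_x q x * expR (s x) - \sum_x q x * (1 + s x + s x ^+ 2 / 2)|
    <= i ^+ 3 * ((kap * (1 + r)) ^+ 3 * expR (kap * (1 + r))).
  rewrite -sumrB; apply: (le_trans (ler_norm_sum _ _ _)).
  rewrite -[leRHS](mean_const q_sum); apply: ler_sum => x _.
  rewrite -mulrBr normrM (ger0_norm (q_ge0 x)) ler_wpM2l //.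
  have -> : expR (s x) - (1 + s x + s x ^+ 2 / 2) = expR (s x) - 1 - s x - s x ^+ 2 / 2 by ring.
  apply: (le_trans (expR_taylor2 _)); rewrite mulrA -exprMn.
  have p0 : 0 <= kap * (1 + r) by rewrite mulr_ge0 // addr_ge0.
  apply: ler_pM; rewrite ?exprn_ge0 ?expR_ge0 //.
    by rewrite lerXn2r ?nnegrE // mulr_ge0 // ltW.
  by rewrite ler_expR (le_trans (sb x)) // ler_piMl.
have h2 : `|\sum_x q x * (1 + s x + s x ^+ 2 / 2) - m| <= i ^+ 3 * (kap ^+ 2 * (1 + r)).
  rewrite E addrAC subrr add0r; apply: (le_trans (ler_norm_sum _ _ _)).
  rewrite -[leRHS](mean_const q_sum); apply: ler_sum => x _.
  rewrite normrM (ger0_norm (q_ge0 x)) ler_wpM2l //.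
  have /andP[a0 a1] := alb x.
  have -> : al x ^+ 2 * i ^+ 4 / 8 - l x * i * al x * i ^+ 3 / 2 =
     i ^+ 3 * (al x * (al x * i / 8 - l x * i / 2)) by ring.
  rewrite normrM (ger0_norm (exprn_ge0 3 (ltW i0))) ler_wpM2l ?exprn_ge0 ?(ltW i0) //.
  rewrite normrM (ger0_norm a0) expr2 -[leRHS]mulrA ler_pM //.
  have := li x; rewrite !ler_norml => /andP[g1 g2].
  have g3 : 0 <= al x * i by rewrite mulr_ge0 // ltW.
  have g4 : al x * i <= kap by rewrite (le_trans _ a1) // ler_piMr.
  by rewrite mulrDr mulr1; lra.
rewrite i3 mulrDr; apply: le_trans _ (lerD h1 h2).
apply: le_trans _ (ler_normD _ _); rewrite le_eqVlt; apply/orP; left; apply/eqP.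
by congr `|_|; ring.
Qed.

(* The first two moments of the step cancel the terms of order 1/t on both sides,
   and the Gaussian factor absorbs every power of 1 + r, [r] being the distance to
   the mean in units of sqrt t. *)
Lemma heat_step_scalar (k : nat) (kap : R) : 0 <= kap -> exists2 C : R, 0 <= C &
  forall (t r : R) (l al : T -> R), 1 <= t -> 0 <= r ->
  \sum_x q x * l x = 0 -> \sum_x q x * l x ^+ 2 = t * r ^+ 2 ->
  \sum_x q x * al x = k%:R ->
  (forall x, `|l x| <= kap * r * Num.sqrt t) ->
  (forall x, 0 <= al x <= kap) ->
  expR (- (r ^+ 2 / 2)) *
  `|(Num.sqrt t / Num.sqrt (t + 1)) ^+ k * expR (r ^+ 2 / 2 / (t + 1))
    - \sum_x q x * expR (l x / t - al x / (2 * t))|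
  <= C / Num.sqrt t ^+ 3 / (1 + r) ^+ (2 * k).
Proof.
(* The errors carry (1 + r)^4 exp (r^2/4) exp (kap (1 + r)), and the decay claimed asks for (1 +
   r)^(2 k) more; exp (-r^2/2) leaves exp (-r^2/4) to absorb them. *)
move=> kap0; pose N : R := (4 + 2 * k)%:R + kap.
pose C1 : R := (1 + k%:R) ^+ 2 * expR k%:R + (1 + k%:R) + kap ^+ 3 + kap ^+ 2.
have k0 : 0 <= k%:R :> R by exact: ler0n.
have C10 : 0 <= C1.
  by rewrite /C1 !addr_ge0 ?mulr_ge0 ?sqr_ge0 ?expR_ge0 ?exprn_ge0.
exists (C1 * expR (N + N ^+ 2)) => [|t r l al t1 r0 sl sl2 sal lb alb].
  by rewrite mulr_ge0 ?expR_ge0.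
have t0 : 0 < t by lra.
have r2 : 0 <= r ^+ 2 / 2 by rewrite divr_ge0 ?sqr_ge0.
have D1 := gauss_factor k t1 r2.
have D2 := walk_factor t1 r0 kap0 sl sl2 sal lb alb.
have S0 : 0 < Num.sqrt t by rewrite sqrtr_gt0.
have S1 : 1 <= Num.sqrt t by rewrite -sqrtr1 ler_wsqrtr.
set S := Num.sqrt t in D1 D2 lb S0 S1 *.
have tS : (t ^+ 2)^-1 <= (S ^+ 3)^-1.
  rewrite lef_pV2 ?posrE ?exprn_gt0 // -(sqr_sqrtr (ltW t0)) -exprM.
  by rewrite ler_weXn2l.
set rho := 1 + r; have rho1 : 1 <= rho by rewrite /rho; lra.
have rho0 : 0 <= rho by lra.
set e4 := expR (r ^+ 2 / 4); set ek := expR (kap * rho).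
have e41 : 1 <= e4 by rewrite -expR0 ler_expR divr_ge0 ?sqr_ge0.
have ek1 : 1 <= ek by rewrite -expR0 ler_expR mulr_ge0.
have ak : r ^+ 2 / 2 + k%:R <= (1 + k%:R) * rho ^+ 2.
  have h1 : 0 <= k%:R * r by rewrite mulr_ge0.
  have h2 : 0 <= k%:R * r ^+ 2 by rewrite mulr_ge0 ?sqr_ge0.
  have h3 := sqr_ge0 r.
  have -> : (1 + k%:R) * rho ^+ 2 =
     1 + 2 * r + r ^+ 2 + k%:R + 2 * (k%:R * r) + k%:R * r ^+ 2 by rewrite /rho; ring.
  lra.
have ak0 : 0 <= r ^+ 2 / 2 + k%:R by rewrite addr_ge0.
have rho24 : rho ^+ 2 <= rho ^+ 4 by rewrite ler_weXn2l.
have B1 : (r ^+ 2 / 2 + k%:R) ^+ 2 * expR (r ^+ 2 / 2 / 2 + k%:R) + (r ^+ 2 / 2 + k%:R)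
    <= ((1 + k%:R) ^+ 2 * expR k%:R + (1 + k%:R)) * (rho ^+ 4 * e4).
  rewrite [leRHS]mulrDl; apply: lerD.
    rewrite (_ : r ^+ 2 / 2 / 2 = r ^+ 2 / 4); last by field.
    rewrite expRD -/e4 [leRHS]mulrACA [X in _ * X]mulrC; apply: ler_pM;
      rewrite ?sqr_ge0 ?mulr_ge0 ?expR_ge0 ?(le_trans _ e41) //.
    have -> : rho ^+ 4 = (rho ^+ 2) ^+ 2 by rewrite -exprM.
    rewrite -exprMn.
    by rewrite lerXn2r ?nnegrE ?mulr_ge0 ?exprn_ge0 ?addr_ge0.
  apply: (le_trans ak); rewrite ler_wpM2l ?addr_ge0 // (le_trans rho24) //.
  by rewrite ler_peMr // exprn_ge0.
have B2 : (kap * rho) ^+ 3 * ek + kap ^+ 2 * rho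
    <= (kap ^+ 3 + kap ^+ 2) * (rho ^+ 4 * ek).
  rewrite [leRHS]mulrDl; apply: lerD.
    rewrite exprMn -mulrA ler_wpM2l ?exprn_ge0 // ler_wpM2r ?(le_trans _ ek1) //.
    by rewrite ler_weXn2l.
  rewrite ler_wpM2l ?exprn_ge0 // (@le_trans _ _ (rho ^+ 4)) //.
    by rewrite -[leLHS]expr1 ler_weXn2l.
  by rewrite ler_peMr // exprn_ge0.
have D : `|(S / Num.sqrt (t + 1)) ^+ k * expR (r ^+ 2 / 2 / (t + 1))
    - \sum_x q x * expR (l x / t - al x / (2 * t))| <= (S ^+ 3)^-1 * (C1 * (rho ^+ 4 * (e4 * ek))).
  have p4 : 0 <= rho ^+ 4 by rewrite exprn_ge0.
  have S3 : 0 <= (S ^+ 3)^-1 by rewrite invr_ge0 exprn_ge0 // ltW.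
  have D1' := le_trans D1 (ler_pM _ _ tS B1).
  have {}D1' := D1' _ _.
  set m := 1 + _ in D1 D2 D1'.
  have F1 : ((1 + k%:R) ^+ 2 * expR k%:R + (1 + k%:R)) * (rho ^+ 4 * e4)
       <= ((1 + k%:R) ^+ 2 * expR k%:R + (1 + k%:R)) * (rho ^+ 4 * (e4 * ek)).
    rewrite ler_wpM2l ?addr_ge0 ?mulr_ge0 ?sqr_ge0 ?expR_ge0 //.
    by rewrite ler_wpM2l // ler_peMr // (le_trans _ e41).
  have F2 : (kap ^+ 3 + kap ^+ 2) * (rho ^+ 4 * ek)
       <= (kap ^+ 3 + kap ^+ 2) * (rho ^+ 4 * (e4 * ek)).
    rewrite ler_wpM2l ?addr_ge0 ?exprn_ge0 //.
    by rewrite ler_wpM2l // ler_peMl // (le_trans _ ek1).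
  have -> : (S ^+ 3)^-1 * (C1 * (rho ^+ 4 * (e4 * ek))) =
     (S ^+ 3)^-1 * (((1 + k%:R) ^+ 2 * expR k%:R + (1 + k%:R)) * (rho ^+ 4 * (e4 * ek)))
     + (S ^+ 3)^-1 * ((kap ^+ 3 + kap ^+ 2) * (rho ^+ 4 * (e4 * ek))).
    by rewrite /C1; ring.
  apply: le_trans _ (lerD (le_trans (D1' _ _) (ler_wpM2l S3 F1))
                          (le_trans D2 (le_trans (ler_wpM2l S3 B2) (ler_wpM2l S3 F2)))).
  - by apply: (le_trans (ler_distD m _ _)); rewrite [X in _ + X <= _]distrC.
  - by rewrite invr_ge0 exprn_ge0 // ltW.
  - by rewrite addr_ge0 // mulr_ge0 ?sqr_ge0 ?expR_ge0.
apply: (le_trans (ler_wpM2l (expR_ge0 _) D)).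
have := @exp_neg_sqr_le R (4 + 2 * k) kap r r0 kap0; rewrite -/N -/rho => key.
rewrite ler_pdivlMr ?exprn_gt0 ?(lt_le_trans _ rho1) //.
have -> : expR (- (r ^+ 2 / 2)) * ((S ^+ 3)^-1 * (C1 * (rho ^+ 4 * (e4 * ek)))) * rho ^+ (2 * k)
  = (S ^+ 3)^-1 * (C1 * (rho ^+ (4 + 2 * k) * expR (kap * rho - r ^+ 2 / 4))).
  have -> : expR (kap * rho - r ^+ 2 / 4) = expR (- (r ^+ 2 / 2)) * (e4 * ek).
    by rewrite -!expRD; congr expR; field.
  by rewrite exprD; ring.
rewrite mulrC ler_wpM2r ?invr_ge0 ?exprn_ge0 ?(ltW S0) //.
by rewrite ler_wpM2l.
Qed.

End HeatStep.

(** * Covariance and precision matrix of the step *)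

Section Covariance.
Context {R : realType} {k : nat} (q : {set 'I_k} -> R).
Hypotheses (q_gt0 : forall X, 0 < q X) (q_sum : \sum_X q X = 1).

Let q_ge0 X : 0 <= q X. Proof. exact: ltW. Qed.

Definition wmean (j : 'I_k) : R := \sum_X q X * (j \in X)%:R.

Definition dev (X : {set 'I_k}) (j : 'I_k) : R := (j \in X)%:R - wmean j.

Definition wcov : 'M[R]_k := \matrix_(i, j) \sum_X q X * (dev X i * dev X j).

Definition wprec : 'M[R]_k := invmx wcov.

Lemma dev_mean j : \sum_X q X * dev X j = 0.
Proof.
rewrite /dev; under eq_bigr do rewrite mulrBr.
by rewrite sumrB mean_const // subrr.
Qed.

Lemma dev_le1 X j : `|dev X j| <= 1.
Proof.
have m0 : 0 <= wmean j by apply: sumr_ge0 => Y _; rewrite mulr_ge0.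
have m1 : wmean j <= 1.
  rewrite -q_sum; apply: ler_sum => Y _; rewrite ler_piMr //.
  by case: (_ \in _).
by rewrite /dev; case: (_ \in _) => /=; rewrite ler_norml; lra.
Qed.

Lemma wcov_sym i j : wcov i j = wcov j i.
Proof. by rewrite !mxE; apply: eq_bigr => X _; rewrite (mulrC (dev X i)). Qed.

Lemma wcov_bform v : bform wcov v v = \sum_X q X * (\sum_j v j * dev X j) ^+ 2.
Proof.
transitivity (\sum_i \sum_j \sum_X q X * ((v i * dev X i) * (v j * dev X j))).
  apply: eq_bigr => i _; apply: eq_bigr => j _; rewrite mxE mulr_sumr mulr_suml.
  by apply: eq_bigr => X _; ring.
under eq_bigr do rewrite exchange_big /=.
rewrite exchange_big /=; apply: eq_bigr => X _; rewrite expr2 mulr_suml mulr_sumr.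
by apply: eq_bigr => i _; rewrite mulr_sumr mulr_sumr.
Qed.

(* A form vanishing on all deviations vanishes on the difference between {i} and
   the empty set, which is the i-th basis vector. *)
Lemma posdef_wcov : posdef wcov.
Proof.
split; first exact: wcov_sym.
move=> v [i vi]; rewrite wcov_bform lt_neqAle; apply/andP; split; last first.
  by apply: sumr_ge0 => X _; rewrite mulr_ge0 ?sqr_ge0.
rewrite eq_sym psumr_eq0; last by move=> X _; rewrite mulr_ge0 ?sqr_ge0.
apply: contra vi => /allP all0.
have z X : \sum_j v j * dev X j = 0.
  have := all0 X (mem_index_enum X).
  by rewrite mulf_eq0 gt_eqF //= sqrf_eq0 => /eqP.
have : \sum_j v j * dev [set i]%SET j - \sum_j v j * dev finset.set0 j = 0.
  by rewrite !z subrr.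
rewrite -sumrB (bigD1 i) //= big1 ?addr0.
  rewrite /dev !inE eqxx /= => h; apply/eqP.
  by rewrite -[LHS]subr0 -[X in _ - X]h; ring.
by move=> j ij; rewrite /dev !inE (negbTE ij) /=; ring.
Qed.

Lemma wcov_unit : wcov \in unitmx.
Proof. by rewrite unitmxE unitfE gt_eqF // posdef_det_gt0 //; exact: posdef_wcov. Qed.

Lemma wprec_sym i j : wprec i j = wprec j i.
Proof.
have e : wcov^T = wcov by apply/matrixP => a b; rewrite mxE wcov_sym.
by rewrite /wprec -[in LHS]e -trmx_inv mxE.
Qed.

Lemma wprec_wcov i l : \sum_j wprec i j * wcov j l = (i == l)%:R.
Proof.
by have /matrixP /(_ i l) := mulVmx wcov_unit; rewrite !mxE; apply.
Qed.

Let grad (w : 'I_k -> R) j := \sum_i w i * wprec i j.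

Lemma grad_wcov w l : \sum_j grad w j * wcov j l = w l.
Proof.
under eq_bigr do rewrite mulr_suml.
rewrite exchange_big /= (bigD1 l) //= [X in _ + X]big1 ?addr0.
  by under eq_bigr do rewrite -mulrA; rewrite -mulr_sumr wprec_wcov eqxx mulr1.
move=> i il; under eq_bigr do rewrite -mulrA.
by rewrite -mulr_sumr wprec_wcov (negbTE il) mulr0.
Qed.

Lemma bform_grad w v : bform wprec w v = \sum_j grad w j * v j.
Proof.
rewrite /bform exchange_big /=; apply: eq_bigr => j _.
by rewrite mulr_suml.
Qed.

Lemma bform_dev_mean w : \sum_X q X * bform wprec w (dev X) = 0.
Proof.
under eq_bigr do rewrite bform_grad mulr_sumr.
rewrite exchange_big /= big1 // => j _.
under eq_bigr do rewrite mulrCA.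
by rewrite -mulr_sumr dev_mean mulr0.
Qed.

Lemma bform_dev_var w : \sum_X q X * bform wprec w (dev X) ^+ 2 = bform wprec w w.
Proof.
under eq_bigr do rewrite bform_grad.
rewrite -wcov_bform bform_grad /bform exchange_big /=; apply: eq_bigr => j _.
by rewrite -mulr_suml grad_wcov mulrC.
Qed.

(** The trace of the precision times the covariance, that is, of the identity. *)
Lemma bform_dev_trace : \sum_X q X * bform wprec (dev X) (dev X) = k%:R.
Proof.
transitivity (\sum_i \sum_j wprec i j * wcov j i).
  under eq_bigr do rewrite mulr_sumr; rewrite exchange_big /=.
  apply: eq_bigr => i _; under eq_bigr do rewrite mulr_sumr; rewrite exchange_big /=.
  apply: eq_bigr => j _; rewrite mxE mulr_sumr; apply: eq_bigr => X _; ring.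
under eq_bigr do rewrite wprec_wcov eqxx.
by rewrite sumr_const card_ord.
Qed.

(** w i is the covariance of [dev _ i], bounded by 1, with a linear form in the deviations whose
    variance is [bform wprec w w]; the Cauchy-Schwarz inequality concludes. *)
Lemma sqr_le_bform w i : w i ^+ 2 <= bform wprec w w.
Proof.
have -> : w i = \sum_X q X * (dev X i * \sum_j grad w j * dev X j).
  rewrite -[LHS](grad_wcov w i).
  under [RHS]eq_bigr do rewrite mulr_sumr mulr_sumr; rewrite exchange_big /=.
  apply: eq_bigr => j _; rewrite mxE mulr_sumr; apply: eq_bigr => X _; ring.
apply: (le_trans (sqr_mean_le q_ge0 q_sum _)).
rewrite -bform_dev_var; apply: ler_sum => X _; rewrite bform_grad ler_wpM2l //.
rewrite exprMn ler_piMl ?sqr_ge0 // -(real_normK (num_real (dev X i))).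
by rewrite exprn_ile1 // dev_le1.
Qed.

Lemma posdef_wprec : posdef wprec.
Proof.
split; first exact: wprec_sym.
move=> v [i vi]; apply: lt_le_trans (sqr_le_bform v i).
by rewrite exprn_even_gt0.
Qed.

Lemma bformB w v : bform wprec (fun j => w j - v j) (fun j => w j - v j) =
  bform wprec w w - 2 * bform wprec w v + bform wprec v v.
Proof.
have e : bform wprec v w = bform wprec w v.
  rewrite /bform exchange_big /=; apply: eq_bigr => i _; apply: eq_bigr => j _.
  by rewrite wprec_sym; ring.
have -> : 2 * bform wprec w v = bform wprec w v + bform wprec v w by rewrite e; ring.
rewrite /bform -big_split -sumrB -big_split /=; apply: eq_bigr => i _.
rewrite -big_split -sumrB -big_split /=; apply: eq_bigr => j _; ring.
Qed.

Lemma dev_bounds : exists2 kap : R, 0 <= kap & forall X,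
  0 <= bform wprec (dev X) (dev X) <= kap /\
  forall w, `|bform wprec w (dev X)| <= kap * Num.sqrt (bform wprec w w).
Proof.
pose K1 : R := \sum_i \sum_j `|wprec i j|.
(* A single term of the variance in [bform_dev_var] is at most the whole, so the linear form at X is
   at most (q X)^(-1/2) standard deviations. *)
pose K2 : R := \sum_X (Num.sqrt (q X))^-1.
have K10 : 0 <= K1 by apply: sumr_ge0 => i _; apply: sumr_ge0 => j _.
have K20 : 0 <= K2 by apply: sumr_ge0 => X _; rewrite invr_ge0 sqrtr_ge0.
exists (K1 + K2) => [|X]; first exact: addr_ge0.
split=> [|w].
  rewrite (posdef_ge0 _ posdef_wprec) /=.
  apply: (le_trans (ler_norm _)); apply: (le_trans (ler_norm_sum _ _ _)).
  apply: (@le_trans _ _ K1); last by rewrite lerDl.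
  apply: ler_sum => i _; apply: (le_trans (ler_norm_sum _ _ _)).
  apply: ler_sum => j _; rewrite !normrM -mulrA mulrCA ler_piMr //.
  by rewrite mulr_ile1 ?dev_le1.
have b0 := posdef_ge0 w posdef_wprec.
apply: (@le_trans _ _ ((Num.sqrt (q X))^-1 * Num.sqrt (bform wprec w w))); last first.
  rewrite ler_wpM2r ?sqrtr_ge0 // /K2 (bigD1 X) //= addrCA lerDl addr_ge0 //.
  by apply: sumr_ge0 => Y _; rewrite invr_ge0 sqrtr_ge0.
rewrite mulrC ler_pdivlMr ?sqrtr_gt0 // -sqrtr_sqr -sqrtrM ?sqr_ge0 // ler_sqrt //.
rewrite -{1}bform_dev_var (bigD1 X) //= mulrC lerDl.
by apply: sumr_ge0 => Y _; rewrite mulr_ge0 ?sqr_ge0.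
Qed.

End Covariance.

Section Kernel.
Context {R : realType} {k : nat} (q : {set 'I_k} -> R).
Hypotheses (q_gt0 : forall X, 0 < q X) (q_sum : \sum_X q X = 1).
Implicit Types (y : lat k) (t : R).

Definition centred t y (j : 'I_k) : R := (y j)%:~R - t * wmean q j.

Definition kernel (c0 : R) t y : R :=
  c0 / Num.sqrt t ^+ k *
  expR (- bform (wprec q) (centred t y) (centred t y) / (2 * t)).

(** Trades a radial decay for a product over the coordinates; the exponent 2 k in [heat_step_scalar]
    is chosen for this. *)
Lemma prod_decay_ge (x : 'I_k -> R) (r : R) : (forall j, `|x j| <= r) -> 0 <= r ->
  ((1 + r) ^+ (2 * k))^-1 <= \prod_j decay (x j).
Proof.
move=> xr r0; rewrite exprM -exprVn -[X in _ ^+ X]card_ord -prodr_const.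
apply: ler_prod => j _; rewrite invr_ge0 exprn_ge0 ?addr_ge0 //=.
by rewrite lef_pV2 ?posrE ?exprn_gt0 ?ltr_wpDr // lerXn2r ?nnegrE ?addr_ge0 // lerD2l.
Qed.

Let radius t (w : 'I_k -> R) : R := Num.sqrt (bform (wprec q) w w / t).

Lemma radius_sqr t w : 0 < t -> radius t w ^+ 2 = bform (wprec q) w w / t.
Proof.
move=> t0; rewrite sqr_sqrtr // divr_ge0 ?(ltW t0) // posdef_ge0 //.
exact: posdef_wprec.
Qed.

Lemma coord_le_radius t w j : 0 < t -> `|w j / Num.sqrt t| <= radius t w.
Proof.
move=> t0; rewrite normrM normfV (ger0_norm (sqrtr_ge0 _)) -sqrtr_sqr -sqrtrV ?(ltW t0) //.
rewrite -sqrtrM ?sqr_ge0 // ler_sqrt; last first.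
  by rewrite divr_ge0 ?(ltW t0) // posdef_ge0 //; exact: posdef_wprec.
by rewrite ler_wpM2r ?invr_ge0 ?(ltW t0) // sqr_le_bform.
Qed.

Lemma kernel_step (c0 : R) : 0 <= c0 -> exists2 C : R, 0 <= C & forall t y, 1 <= t ->
  `|kernel c0 (t + 1) y - walk q (kernel c0 t) y|
  <= C / Num.sqrt t ^+ (k + 3) * \prod_j decay (centred (t + 1) y j / Num.sqrt t).
Proof.
move=> c00; have [kap kap0 kapP] := dev_bounds q_gt0 q_sum.
have [C C0 CP] := heat_step_scalar (fun X => ltW (q_gt0 X)) q_sum k kap0.
exists (c0 * C) => [|t y t1]; first exact: mulr_ge0.
have t0 : 0 < t by lra.
have S0 : 0 < Num.sqrt t by rewrite sqrtr_gt0.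
have S10 : 0 < Num.sqrt (t + 1) by rewrite sqrtr_gt0; lra.
set w := centred (t + 1) y; set r := radius t w.
have r0 : 0 <= r by exact: sqrtr_ge0.
have rE : r ^+ 2 = bform (wprec q) w w / t by exact: radius_sqr.
(* The mean moves by [wmean] in one unit of time, so passing from time t + 1 at y to time t at y - X
   changes the displacement by the deviation of X alone. *)
have wE X j : centred t (y - ind X) j = w j - dev q X j.
  by rewrite /w /centred /dev !ffunE rmorphB /=; ring.
pose l X := bform (wprec q) w (dev q X).
pose al X := bform (wprec q) (dev q X) (dev q X).
have {CP} := CP t r l al t1 r0 (bform_dev_mean q_sum w) _ (bform_dev_trace q_gt0).
rewrite bform_dev_var // rE (mulrCA t) divff ?gt_eqF // mulr1.
have lb X : `|l X| <= kap * r * Num.sqrt t.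
  have [_ /(_ w)] := kapP X; rewrite -mulrA /r /radius -sqrtrM ?divfK ?gt_eqF //.
  by rewrite divr_ge0 ?(ltW t0) // posdef_ge0 //; exact: posdef_wprec.
move=> /(_ erefl lb (fun X => (kapP X).1)) key.
have e1 : kernel c0 (t + 1) y - walk q (kernel c0 t) y =
  c0 / Num.sqrt t ^+ k * (expR (- (r ^+ 2 / 2)) *
   ((Num.sqrt t / Num.sqrt (t + 1)) ^+ k * expR (r ^+ 2 / 2 / (t + 1)) -
     \sum_X q X * expR (l X / t - al X / (2 * t)))).
  have BCA (e a b s : R) : e * (a * b - s) = a * (e * b) - e * s by ring.
  rewrite BCA -expRD mulrBr; congr (_ - _).
    rewrite /kernel -/w rE mulrA; congr (_ * expR _).
      by rewrite expr_div_n; field; rewrite !expf_neq0 ?gt_eqF.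
    by field; rewrite !gt_eqF //; lra.
  rewrite /walk mulr_sumr mulr_sumr; apply: eq_bigr => X _.
  have CA (c e u v : R) : c * (e * (u * v)) = u * (c * (e * v)) by ring.
  rewrite [RHS]CA -expRD /kernel; congr (_ * _).
  rewrite (eq_bform _ (wE X) (wE X)) bformB //.
  by congr (_ * expR _); rewrite rE /l /al; field; rewrite gt_eqF.
rewrite e1 normrM (ger0_norm (_ : 0 <= _ / _)); last first.
  by rewrite divr_ge0 ?exprn_ge0 // ltW.
rewrite normrM (ger0_norm (expR_ge0 _)) rE.
apply: (le_trans (ler_wpM2l _ key)); first by rewrite divr_ge0 ?exprn_ge0 // ltW.
have pd : ((1 + r) ^+ (2 * k))^-1 <= \prod_j decay (w j / Num.sqrt t).
  by apply: prod_decay_ge => // j; exact: coord_le_radius.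
rewrite mulrA; apply: le_trans (ler_wpM2l _ pd).
  rewrite le_eqVlt; apply/orP; left; apply/eqP; rewrite exprD; field.
  by rewrite !expf_neq0 ?gt_eqF //; lra.
by rewrite divr_ge0 ?mulr_ge0 ?exprn_ge0 // ltW.
Qed.

Lemma kernel_ge0 (c0 : R) t y : 0 <= c0 -> 0 <= kernel c0 t y.
Proof. by move=> c00; rewrite mulr_ge0 ?expR_ge0 // divr_ge0 ?exprn_ge0. Qed.

(** The factor 1 + sum is there for the smoothing estimate, where the kernel is multiplied by the
    distance to its centre. *)
Lemma gauss_decay_le : exists2 C : R, 0 <= C & forall t (w : 'I_k -> R), 0 < t ->
  expR (- bform (wprec q) w w / (2 * t)) * (1 + \sum_j `|w j / Num.sqrt t|)
  <= C * \prod_j decay (w j / Num.sqrt t).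
Proof.
pose N : R := (1 + 2 * k)%:R + 0.
have k0 : 0 <= k%:R :> R by exact: ler0n.
exists ((1 + k%:R) * expR (N + N ^+ 2)) => [|t w t0].
  by rewrite mulr_ge0 ?expR_ge0 ?addr_ge0.
set r := radius t w; have r0 : 0 <= r by exact: sqrtr_ge0.
have rE : r ^+ 2 = bform (wprec q) w w / t by exact: radius_sqr.
have wr j : `|w j / Num.sqrt t| <= r by exact: coord_le_radius.
have sw : 1 + \sum_j `|w j / Num.sqrt t| <= (1 + k%:R) * (1 + r).
  have : \sum_j `|w j / Num.sqrt t| <= k%:R * r.
    have -> : k%:R * r = \sum_(j < k) r by rewrite sumr_const card_ord mulr_natl.
    exact: ler_sum.
  lra.
have := @exp_neg_sqr_le R (1 + 2 * k) 0 r r0 (lexx 0); rewrite -/N mul0r sub0r => key.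
have pd := prod_decay_ge wr r0.
apply: le_trans (ler_wpM2l _ pd); last by rewrite mulr_ge0 ?expR_ge0 ?addr_ge0.
rewrite ler_pdivlMr ?exprn_gt0 ?ltr_wpDr //.
have e : expR (- bform (wprec q) w w / (2 * t)) <= expR (- (r ^+ 2 / 4)).
  rewrite ler_expR rE -subr_ge0.
  have -> : - (bform (wprec q) w w / t / 4) - - bform (wprec q) w w / (2 * t) = r ^+ 2 / 4.
    by rewrite rE; field; rewrite gt_eqF.
  by rewrite divr_ge0 ?sqr_ge0.
apply: (@le_trans _ _ (expR (- (r ^+ 2 / 4)) * ((1 + k%:R) * (1 + r)) * (1 + r) ^+ (2 * k))).
  rewrite ler_wpM2r ?exprn_ge0 ?addr_ge0 // ler_pM ?expR_ge0 ?addr_ge0 //.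
  exact: sumr_ge0.
have -> : expR (- (r ^+ 2 / 4)) * ((1 + k%:R) * (1 + r)) * (1 + r) ^+ (2 * k) =
   (1 + k%:R) * ((1 + r) ^+ (1 + 2 * k) * expR (- (r ^+ 2 / 4))).
  by rewrite exprD expr1; ring.
by rewrite ler_wpM2l ?addr_ge0.
Qed.

End Kernel.

(** * Mean and covariance of the tilted law *)

Section RankingWeights.
Context {R : realType} {k : nat} (p : {ffun 'S_k.+1 -> R}).
Hypothesis p_gt0 : forall r, 0 < p r.

Lemma adv_neq_max (j : 'I_k) : adv j != ord_max.
Proof. by rewrite -val_eqE /= ltn_eqF // ltn_ord. Qed.

Lemma adv_inj : injective (@adv k).
Proof. by move=> i j /(congr1 val) /= /val_inj. Qed.

(** Rank the adversaries in X first, then candidate m, then the others. *)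
Lemma exists_ranking (X : {set 'I_k}) : exists r : 'S_k.+1, above_m r = X.
Proof.
pose s1 := [seq adv j | j <- enum X]; pose s2 := [seq adv j | j <- enum (~: X)%SET].
pose s := s1 ++ ord_max :: s2.
have nmax (t : seq 'I_k) : ord_max \notin [seq adv j | j <- t].
  by apply/mapP => -[j _ e]; have := adv_neq_max j; rewrite -e eqxx.
have disj : ~~ has (mem s1) s2.
  apply/hasPn => x /mapP [j]; rewrite mem_enum inE => jX ->.
  by rewrite /= (mem_map adv_inj) mem_enum.
have us : uniq s.
  by rewrite cat_uniq /= negb_or disj !nmax !(map_inj_uniq adv_inj) !enum_uniq.
have ss a : a \in s.
  rewrite mem_cat inE; have [a' ->|->] := unliftP ord_max a; last by rewrite eqxx orbT.
  have -> : lift ord_max a' = adv a' by apply: ord_inj; rewrite lift_max.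
  by rewrite !(mem_map adv_inj) !mem_enum inE; case: (a' \in X); rewrite ?orbT.
have sz : size s = k.+1.
  by rewrite -(card_uniqP us) -[RHS]card_ord; apply: eq_card => a; rewrite ss.
have ix a : (index a s < k.+1)%N by rewrite -[X in (_ < X)%N]sz index_mem.
have rinj : injective (fun a => Ordinal (ix a)).
  move=> a b [] /(congr1 (nth ord_max s)); rewrite !nth_index //.
exists (perm rinj); apply/setP => j; rewrite inE /ranked_above !permE /=.
rewrite /s !index_cat (negbTE (nmax _)) /= eqxx addn0 (mem_map adv_inj) mem_enum.
case: (boolP (j \in X)) => jX; first by rewrite index_mem (mem_map adv_inj) mem_enum.
by apply/negbTE; rewrite -leqNgt leq_addr.
Qed.

Lemma pX_gt0 X : 0 < pX p X.
Proof.
have [r rX] := exists_ranking X.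
rewrite /pX (bigD1 r) /= ?rX //; apply: ltr_pwDl => //.
by apply: sumr_ge0 => r' _; exact: ltW.
Qed.

Let wt (y : 'rV[R]_k) X : R := pX p X * \prod_(j in X) expR (y 0 j).

Let wt_gt0 y X : 0 < wt y X.
Proof. by rewrite mulr_gt0 ?pX_gt0 // prodr_gt0 // => j _; exact: expR_gt0. Qed.

Let sum_wt_gt0 (f : {set 'I_k} -> R) : (forall X, 0 < f X) -> 0 < \sum_X f X.
Proof.
move=> f0; rewrite (bigD1 finset.set0) //=; apply: ltr_pwDl => //.
by apply: sumr_ge0 => X _; exact: ltW.
Qed.

Let wt_line y j X (h : R) :
  wt (h *: delta_mx 0 j + y) X = wt y X * expR (h * (j \in X)%:R).
Proof.
rewrite /wt -mulrA; congr (_ * _).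
have -> : expR (h * (j \in X)%:R) = \prod_(i in X) expR (h * (i == j)%:R).
  case: (boolP (j \in X)) => jX.
    rewrite (bigD1 j) //= eqxx mulr1 big1 ?mulr1 // => i /andP[_ /negbTE ->].
    by rewrite mulr0 expR0.
  rewrite mulr0 expR0 big1 // => i iX; case: eqP => [e|_]; last by rewrite mulr0 expR0.
  by rewrite -e iX in jX.
rewrite -big_split /=; apply: eq_bigr => i _.
by rewrite !mxE eqxx /= addrC expRD.
Qed.

(** Along a coordinate line the polynomial is an exponential sum in one real variable ([wt_line]),
    so one-variable calculus gives the derivatives of K. *)
Lemma derive_line (f : 'rV[R]_k -> R) a v :
  derive f a v = derive (fun h : R => f (h *: v + a)) (0 : R) 1.
Proof.
rewrite /derive.
have -> : (fun h : R => h^-1 *: ((f \o shift a) (h *: v) - f a)) =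
  (fun h : R => h^-1 *: (((fun h : R => f (h *: v + a)) \o shift (0 : R)) (h *: (1 : R))
     - f (0 *: v + a))) => //.
by apply/funext => h /=; rewrite addr0 scale0r add0r [h *: 1]mulr1.
Qed.

Let is_derive_exp_sum (s : seq {set 'I_k}) (c b : {set 'I_k} -> R) (h : R) :
  is_derive h 1 (fun h => \sum_(X <- s) c X * expR (h * b X))
    (\sum_(X <- s) c X * b X * expR (h * b X)).
Proof.
elim: s => [|X s IH].
  under eq_fun do rewrite big_nil; rewrite big_nil; exact: is_derive_cst.
under eq_fun do rewrite big_cons; rewrite big_cons.
apply: is_deriveD => //.
have e : is_derive h 1 (fun h : R => expR (h * b X)) (b X * expR (h * b X)).
  have i : is_derive h 1 (fun h : R => h * b X) (b X).
    by apply: is_derive_eq; rewrite /GRing.scale /= mulr0 mulr1 add0r.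
  by apply: is_derive_eq (is_derive1_comp (is_derive_expR _) i) _; rewrite mulrC.
apply: is_derive_eq (is_deriveZ (c X) e) _.
by rewrite /GRing.scale /= mulrA.
Qed.

Let is_derive_line y j (h : R) : is_derive h 1
  (fun h => Kfun p (h *: delta_mx 0 j + y))
  ((\sum_X wt (h *: delta_mx 0 j + y) X * (j \in X)%:R)
    / \sum_X wt (h *: delta_mx 0 j + y) X).
Proof.
have -> : (fun h => Kfun p (h *: delta_mx 0 j + y)) =
   @ln R \o (fun h => \sum_X wt y X * expR (h * (j \in X)%:R)).
  apply/funext => h' /=; rewrite /Kfun /Ppoly; congr ln.
  by apply: eq_bigr => X _; rewrite -wt_line.
have d := is_derive_exp_sum (index_enum _) (wt y) (fun X => (j \in X)%:R) h.
have s0 : 0 < \sum_X wt y X * expR (h * (j \in X)%:R).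
  by apply: sum_wt_gt0 => X; rewrite mulr_gt0 ?expR_gt0.
apply: is_derive_eq (is_derive1_comp (is_derive1_ln s0) d) _.
rewrite mulrC; congr (_ / _).
  by apply: eq_bigr => X _; rewrite wt_line mulrAC.
by apply: eq_bigr => X _; rewrite wt_line.
Qed.

Lemma derive_Kfun y j : derive (Kfun p) y (delta_mx 0 j) =
  (\sum_X wt y X * (j \in X)%:R) / \sum_X wt y X.
Proof.
rewrite derive_line; have d := is_derive_line y j 0.
by rewrite (@derive_val _ _ _ _ _ _ _ d) scale0r add0r.
Qed.

Variable tau : 'rV[R]_k.

Definition tilted (X : {set 'I_k}) : R :=
  pX p X * (\prod_(j in X) expR (tau 0 j)) / Ppoly p (fun j => expR (tau 0 j)).

Lemma Ppoly_gt0 : 0 < Ppoly p (fun j => expR (tau 0 j)).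
Proof. by apply: sum_wt_gt0 => X; exact: wt_gt0. Qed.

Lemma tilted_gt0 X : 0 < tilted X.
Proof. by rewrite divr_gt0 ?Ppoly_gt0 //; exact: wt_gt0. Qed.

Lemma tilted_sum : \sum_X tilted X = 1.
Proof. by rewrite -mulr_suml divff // gt_eqF // Ppoly_gt0. Qed.

Lemma critical_mean (b : 'I_k -> R) :
  (forall t : 'rV[R]_k, - Kfun p t + \sum_j b j * t 0 j
      <= - Kfun p tau + \sum_j b j * tau 0 j) ->
  forall j, wmean tilted j = b j.
Proof.
move=> tmax j; pose f (h : R) := - Kfun p (h *: delta_mx 0 j + tau) + h * b j.
have df (h : R) : is_derive h 1 f (- ((\sum_X wt (h *: delta_mx 0 j + tau) X * (j \in X)%:R)
    / \sum_X wt (h *: delta_mx 0 j + tau) X) + b j).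
  apply: is_deriveD; first by apply: is_deriveN; exact: is_derive_line.
  by apply: is_derive_eq; rewrite /GRing.scale /= mulr0 mulr1 add0r.
have fmax h : f h <= f 0.
  rewrite /f mul0r addr0 scale0r add0r.
  have := tmax (h *: delta_mx 0 j + tau).
  have -> : \sum_i b i * (h *: delta_mx 0 j + tau) 0 i = h * b j + \sum_i b i * tau 0 i.
    rewrite (bigD1 j) //= [in RHS](bigD1 j) //= !mxE !eqxx /=.
    rewrite (eq_bigr (fun i => b i * tau 0 i)).
      by rewrite mulr1; ring.
    by move=> i ij; rewrite !mxE (negbTE ij) andbF mulr0 add0r.
  by lra.
have m := @derive1_at_max _ f (-1) 1 0 _ (fun t _ => @ex_derive _ _ _ _ _ _ _ (df t)) _ (fun t _ => fmax t).
have : is_derive (0 : R) 1 f 0 by apply: m; rewrite ?in_itv /=; lra.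
move=> [_]; have [_ ->] := df 0; rewrite scale0r add0r => h.
have -> : wmean tilted j = (\sum_X wt tau X * (j \in X)%:R) / \sum_X wt tau X.
  by rewrite /wmean mulr_suml; apply: eq_bigr => X _; rewrite /tilted mulrAC.
by lra.
Qed.

Lemma hessian_Kfun : hessian (Kfun p) tau = wcov tilted.
Proof.
apply/matrixP => i j; rewrite !mxE.
under eq_fun do rewrite derive_Kfun.
rewrite derive_line.
pose D h : R := \sum_X wt tau X * expR (h * (i \in X)%:R).
pose N h : R := \sum_X (wt tau X * (j \in X)%:R) * expR (h * (i \in X)%:R).
have -> : (fun h : R => (\sum_X wt (h *: delta_mx 0 i + tau) X * (j \in X)%:R)
    / \sum_X wt (h *: delta_mx 0 i + tau) X) = N * (fun h => (D h)^-1).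
  apply/funext => h; congr (_ / _); apply: eq_bigr => X _; rewrite wt_line //.
  by rewrite mulrAC.
have dN := is_derive_exp_sum (index_enum _) (fun X => wt tau X * (j \in X)%:R)
  (fun X => (i \in X)%:R) 0.
have dD := is_derive_exp_sum (index_enum _) (wt tau) (fun X => (i \in X)%:R) 0.
have D0 h : D h != 0.
  by rewrite gt_eqF //; apply: sum_wt_gt0 => X; rewrite mulr_gt0 ?expR_gt0.
have gN : derivable N 0 1 by case: dN.
have gD : derivable D 0 1 by case: dD.
have gV : derivable (fun h => (D h)^-1) 0 1 by exact: (derivableV (D0 0) gD).
rewrite (deriveM gN gV) (deriveV (D0 0) gD).
rewrite (@derive_val _ _ _ _ _ _ _ dN) (@derive_val _ _ _ _ _ _ _ dD).
pose P0 := Ppoly p (fun j => expR (tau 0 j)).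
have P00 : P0 != 0 by rewrite gt_eqF // Ppoly_gt0.
have wE X : wt tau X = P0 * tilted X by rewrite /tilted mulrC divfK.
have DE : D 0 = P0.
  by rewrite /D; apply: eq_bigr => X _; rewrite mul0r expR0 mulr1.
have NE : N 0 = P0 * wmean tilted j.
  rewrite /N /wmean mulr_sumr; apply: eq_bigr => X _.
  by rewrite mul0r expR0 mulr1 wE mulrA.
have E1 : \sum_X wt tau X * (i \in X)%:R * expR (0 * (i \in X)%:R) = P0 * wmean tilted i.
  rewrite /wmean mulr_sumr; apply: eq_bigr => X _.
  by rewrite mul0r expR0 mulr1 wE mulrA.
have E2 : \sum_X wt tau X * (j \in X)%:R * (i \in X)%:R * expR (0 * (i \in X)%:R)
   = P0 * \sum_X tilted X * ((i \in X)%:R * (j \in X)%:R).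
  rewrite mulr_sumr; apply: eq_bigr => X _.
  by rewrite mul0r expR0 mulr1 wE; ring.
have E3 : \sum_X tilted X * (dev tilted X i * dev tilted X j) =
   \sum_X tilted X * ((i \in X)%:R * (j \in X)%:R) - wmean tilted i * wmean tilted j.
  transitivity (\sum_X (tilted X * ((i \in X)%:R * (j \in X)%:R)
     - wmean tilted j * (tilted X * (i \in X)%:R) - wmean tilted i * (tilted X * dev tilted X j))).
    by apply: eq_bigr => X _; rewrite /dev; ring.
  rewrite !sumrB -!mulr_sumr dev_mean ?tilted_sum // mulr0 subr0.
  by rewrite -/(wmean tilted i); ring.
rewrite E1 E2 E3 DE NE /GRing.scale /=; field.
exact: P00.
Qed.

End RankingWeights.

(** * The local limit theorem *)

Section GaussianSums.
Context {R : realType} {k : nat} (q : {set 'I_k} -> R).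
Hypotheses (q_gt0 : forall X, 0 < q X) (q_sum : \sum_X q X = 1).

Lemma bformN (A : 'M[R]_k) v : bform A (fun j => - v j) (fun j => - v j) = bform A v v.
Proof.
by apply: eq_bigr => i _; apply: eq_bigr => j _; rewrite mulNr mulNr mulrN opprK.
Qed.

Lemma bformZ (A : 'M[R]_k) (c : R) v :
  bform A (fun j => v j * c) (fun j => v j * c) = c ^+ 2 * bform A v v.
Proof.
rewrite mulr_sumr; apply: eq_bigr => i _; rewrite mulr_sumr.
by apply: eq_bigr => j _; ring.
Qed.

Lemma cvg_bform (A : 'M[R]_k) (v_ : nat -> 'I_k -> R) v :
  (forall j, v_ n j @[n --> \oo] --> v j) ->
  bform A (v_ n) (v_ n) @[n --> \oo] --> bform A v v.
Proof.
move=> vv; rewrite /bform.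
have cvs (F_ : 'I_k -> nat -> R) (F : 'I_k -> R) :
    (forall i, F_ i n @[n --> \oo] --> F i) ->
    \sum_i F_ i n @[n --> \oo] --> \sum_i F i.
  move=> FF; apply: (@cvg_big _ _ +%R 0 xpredT) => //; exact: add_continuous.
apply: (cvs) => i; apply: (cvs) => j.
by apply: cvgM => //; apply: cvgM => //; exact: cvg_cst.
Qed.

Lemma prod_decay_index (js : seq 'I_k) (s : seq R) : uniq js -> size s = size js ->
  \prod_(j <- js) decay (nth 0 s (index j js)) = \prod_(x <- s) decay x.
Proof.
case: js => [|j0 js] // ujs ss; first by rewrite (size0nil ss) !big_nil.
rewrite (big_nth j0) [RHS](big_nth 0) ss; apply: eq_big_nat => i /andP[_ ijs].
by rewrite index_uniq.
Qed.

Lemma decay_sub_le (e x : R) : `|e| <= 2 -> decay (e - x) <= 9 * decay x.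
Proof.
move=> e2; rewrite /decay.
have n1 := normr_ge0 x; have n2 := normr_ge0 (e - x).
have tx : 1 + `|x| <= 3 * (1 + `|e - x|).
  have := ler_normB e (e - x); rewrite subKr; lra.
rewrite ler_pdivlMr ?exprn_gt0 ?ltr_wpDr // mulrC ler_pdivrMr ?exprn_gt0 ?ltr_wpDr //.
rewrite (_ : 9 * _ = (3 * (1 + `|e - x|)) ^+ 2); last by ring.
by rewrite lerXn2r ?nnegrE //; lra.
Qed.

(** eps is the rounding offset of the centre, in scaled coordinates: at most one unit for the end
    point and one for the centre of the kernel. It disappears in the limit, and the bound 2 keeps
    the domination uniform. *)
Lemma grid_gauss_cvg (D : set R) (js : seq 'I_k) (a h : nat -> R) (B : nat -> nat)
    (eps : nat -> 'I_k -> R) :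
  measurable D -> uniq js ->
  (forall n, 0 < h n <= 1) -> h n @[n --> \oo] --> (0 : R) ->
  (forall n l, (l < B n)%N ->
     `]a n + h n * l%:R, a n + h n * l.+1%:R] `<=` D) ->
  (forall t, D t -> \forall n \near \oo, a n < t <= a n + h n * (B n)%:R) ->
  (forall n j, `|eps n j| <= 2) ->
  (forall j, eps n j @[n --> \oo] --> (0 : R)) ->
  exists v : R, [/\
    iter_int D (size js) (fun s => (expR (- bform (wprec q)
      (fun j => nth 0 s (index j js)) (fun j => nth 0 s (index j js)) / 2))%:E) = v%:E,
    h n ^+ size js * (\sum_(v <- grid (B n) js)
      let z := fun j => eps n j - (if j \in js then a n + h n * (v j)%:~R else 0) in
      expR (- bform (wprec q) z z / 2)) @[n --> \oo] --> v &
    (0 < lebesgue_measure D)%E -> 0 < v].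
Proof.
move=> mD ujs h01 h0 subD covD eps2 eps0.
have [C C0 CP] := gauss_decay_le q_gt0 q_sum.
pose A := wprec q.
pose z n (s : seq R) j := eps n j - nth 0 s (index j js).
pose F_ n s := expR (- bform A (z n s) (z n s) / 2).
pose F (s : seq R) := expR (- bform A
  (fun j => nth 0 s (index j js)) (fun j => nth 0 s (index j js)) / 2).
have FK n s : size s = size js -> F_ n s <= (C * 9 ^+ size js) * \prod_(x <- s) decay x.
  move=> ss; have := CP 1 (z n s) ltr01; rewrite mulr1 sqrtr1 => le1.
  apply: (@le_trans _ _ (C * \prod_j decay (z n s j))).
    rewrite (eq_bigr (fun j => decay (z n s j / 1))); last by move=> j _; rewrite divr1.
    apply: le_trans le1; rewrite ler_peMr ?expR_ge0 // lerDl.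
    by apply: sumr_ge0.
  rewrite -mulrA ler_wpM2l //.
  apply: (@le_trans _ _ (\prod_(j <- js) decay (z n s j))).
    rewrite -big_enum (bigID (fun j => j \in js)) /= -[leRHS]mulr1.
    rewrite big_enum_cond /= big_uniq //=.
    apply: ler_pM.
    - by apply: prodr_ge0 => j _; rewrite ltW // decay_gt0.
    - by apply: prodr_ge0 => j _; rewrite ltW // decay_gt0.
    - by [].
    by apply: prodr_ile1 => j _; rewrite decay_le1 ltW // decay_gt0.
  have -> : 9 ^+ size js = \prod_(j <- js) (9 : R).
    by elim: (js) => [|j l IH]; rewrite ?big_nil //= big_cons exprS IH.
  rewrite -(prod_decay_index ujs ss) -big_split /=.
  apply: ler_prod => j _; rewrite ltW ?decay_gt0 //=.
  exact: decay_sub_le.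
have FF (s_ : nat -> seq R) s : (forall n, size (s_ n) = size js) -> size s = size js ->
     (forall i, nth 0 (s_ n) i @[n --> \oo] --> nth 0 s i) ->
     F_ n (s_ n) @[n --> \oo] --> F s.
  move=> _ _ ss; rewrite /F -bformN; apply: continuous_cvg; first exact: continuous_expR.
  apply: cvgM; last exact: cvg_cst.
  apply: cvgN; apply: cvg_bform => j; rewrite -[X in _ --> X]sub0r.
  by apply: cvgB => //; exact: ss.
have [v [E cv pos]] := @iter_rsum_cvg R D a h B mD h01 h0 subD covD (size js) F_ F
   (C * 9 ^+ size js) (mulr_ge0 C0 (exprn_ge0 _ (ler0n _ _)))
   (fun n s => expR_ge0 _) FK FF.
exists v; split => //; last by move=> D0; apply: pos => // s; exact: expR_gt0.
apply: cvg_trans cv; apply: near_eq_cvg; apply: nearW => n.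
symmetry; apply: sum_grid_iter_rsum => ls sl; congr expR.
have zE j : eps n j - (if j \in js then a n + h n * (lvec js ls j)%:~R else 0) =
   z n [seq a n + h n * l%:R | l <- ls] j.
  rewrite /z lvecE //; case: ifPn => [jjs|jjs].
    by rewrite (nth_map 0%N) // sl index_mem.
  by rewrite memNindex // nth_default // size_map sl.
by rewrite (eq_bform _ zE zE).
Qed.

End GaussianSums.

(** * Averaging the starting point against the kernel *)

Section Smoothing.
Context {R : realType} {k : nat} (q : {set 'I_k} -> R).
Hypotheses (q_gt0 : forall X, 0 < q X) (q_sum : \sum_X q X = 1).
Variable S : {set 'I_k}.
Implicit Types (y v w : lat k).

Definition one_on (_ : lat k) : R := 1.

Definition box_ind (B : nat) (x : int) : R := ((0 <= x) && (x < B%:Z))%:R.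

Lemma grid_point0 B y :
  conv (grid B (enum (~: S)%SET)) one_on point0 y =
  prodf (fun j => if j \in S then point1 else box_ind B) y.
Proof.
have e : conv (grid B (enum (~: S)%SET)) one_on point0 y =
   if y \in grid B (enum (~: S)%SET) then 1 else 0.
  by rewrite conv_point0 // grid_uniq ?enum_uniq.
rewrite e mem_grid ?enum_uniq // /prodf.
case: ifPn => [/forallP h|].
  rewrite big1 // => j _; have := h j; rewrite mem_enum inE /point1 /box_ind.
  by case: (j \in S) => /= ->.
rewrite negb_forall => /existsP[j hj]; rewrite (bigD1 j) //=.
move: hj; rewrite mem_enum inE /point1 /box_ind.
by case: (j \in S) => /= /negbTE ->; rewrite mul0r.
Qed.

(** The probability that y - S_n, with S_n the walk after n steps, vanishes on the coordinates of S
    and lies in [0, B) on the others. *)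
Definition walk_grid (B n : nat) : lat k -> R :=
  iter n (walk q) (conv (grid B (enum (~: S)%SET)) one_on point0).

(** Each point mass is the difference of a half-line indicator, which makes #|S| differences; a
    change of starting point is one more. *)
Lemma walk_grid_lipschitz : exists2 C : R, 0 <= C & forall B n y y', (0 < n)%N ->
  `|walk_grid B n y - walk_grid B n y'|
    <= C / Num.sqrt n%:R ^+ #|S|.+1 * \sum_j `|(y j - y' j)%:~R|.
Proof.
have [C C0 CP] := walk_prodf_le q_gt0 q_sum S.
exists (C ^+ #|S|.+1) => [|B n y y' n0]; first exact: exprn_ge0.
pose f (j : 'I_k) : int -> R := if j \in S then point1 else box_ind B.
pose F (j : 'I_k) : int -> R := if j \in S then nneg (fun=> 1) else box_ind B.
have fF j x : f j x = if j \in S then dif1 (F j) x else F j x.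
  rewrite /f /F; case: (j \in S) => //.
  by rewrite dif1_nneg /point1; case: x => [[|m]|m] //=; rewrite subrr.
have F1 j x : `|F j x| <= 1.
  rewrite /F; case: (j \in S).
    by case: x => m /=; rewrite ?normr1 ?normr0 ?ler01.
  by rewrite /box_ind; case: (_ && _); rewrite ?normr1 ?normr0 ?ler01.
apply: diff_lipschitz => j z.
have e : walk_grid B n =1 iter n (walk q) (prodf f).
  move=> x; apply: eq_iter_walk => x'; rewrite grid_point0.
  by apply: eq_prodf => i u; rewrite /f; case: ifP.
rewrite (eq_diff j e); have [_ /(_ j)] := CP f F 1 n n0 fF F1 z.
by rewrite expr1n mul1r expr_div_n.
Qed.

Variable c0 : R.
Hypothesis c0_ge0 : 0 <= c0.

Let card_S : (#|S| + #|(~: S)%SET|)%N = k.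
Proof. by rewrite cardsC card_ord. Qed.

(** Summing the pointwise error over the grid gives back a factor sqrt t for each coordinate outside
    S, so the exponent k + 3 drops to #|S| + 3. *)
Lemma grid_kernel_step : exists2 C : R, 0 <= C & forall B t y, 1 <= t ->
  `|conv (grid B (enum (~: S)%SET)) one_on (kernel q c0 (t + 1)) y -
    walk q (conv (grid B (enum (~: S)%SET)) one_on (kernel q c0 t)) y|
  <= C / Num.sqrt t ^+ (#|S| + 3).
Proof.
have [C C0 CP] := kernel_step q_gt0 q_sum c0_ge0.
exists (C * 4 ^+ #|(~: S)%SET|) => [|B t y t1]; first by rewrite mulr_ge0 ?exprn_ge0.
have t0 : 0 < t by lra.
have r0 : 0 < Num.sqrt t by rewrite sqrtr_gt0.
have r1 : 1 <= Num.sqrt t by rewrite -sqrtr1 ler_wsqrtr.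
rewrite walk_conv /conv -sumrB.
apply: (le_trans (ler_norm_sum _ _ _)).
pose x j : R := (y j)%:~R - (t + 1) * wmean q j.
have le1 v : `|one_on v * kernel q c0 (t + 1) (y - v) - one_on v * walk q (kernel q c0 t) (y - v)|
  <= C / Num.sqrt t ^+ (k + 3) *
     \prod_(j <- enum (~: S)%SET) decay ((x j - (v j)%:~R) / Num.sqrt t).
  rewrite /one_on !mul1r; apply: (le_trans (CP _ _ t1)).
  rewrite ler_wpM2l ?divr_ge0 ?exprn_ge0 ?sqrtr_ge0 // big_enum /=.
  rewrite [leLHS](bigID (fun j => j \in (~: S)%SET)) /= -[leRHS]mulr1.
  apply: ler_pM.
  - by apply: prodr_ge0 => j _; rewrite ltW // decay_gt0.
  - by apply: prodr_ge0 => j _; rewrite ltW // decay_gt0.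
  - rewrite le_eqVlt; apply/orP; left; apply/eqP; apply: eq_bigr => j _.
    by congr (decay (_ / _)); rewrite /centred /x !ffunE rmorphB /=; ring.
  by apply: prodr_ile1 => j _; rewrite decay_le1 ltW // decay_gt0.
apply: (@le_trans _ _ (C / Num.sqrt t ^+ (k + 3) * (4 * Num.sqrt t) ^+ #|(~: S)%SET|)).
  apply: (le_trans (ler_sum _ (fun v _ => le1 v))); rewrite -mulr_sumr.
  rewrite ler_wpM2l ?divr_ge0 ?exprn_ge0 ?sqrtr_ge0 //.
  have := sum_grid_decay_le B x (enum_uniq (mem (~: S)%SET)) r1.
  by rewrite -cardE.
rewrite le_eqVlt; apply/orP; left; apply/eqP.
have -> : Num.sqrt t ^+ (k + 3) = Num.sqrt t ^+ (#|S| + 3) * Num.sqrt t ^+ #|(~: S)%SET| :> R.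
  by rewrite -exprD addnAC card_S.
rewrite exprMn; field.
by rewrite !expf_neq0 // gt_eqF.
Qed.

(** The later steps average and do not amplify an error, and the error of a step decreases with
    time, so each is at most the first. *)
Lemma kernel_telescope : exists2 C : R, 0 <= C & forall B n t y, 1 <= t ->
  `|iter n (walk q) (conv (grid B (enum (~: S)%SET)) one_on (kernel q c0 t)) y -
    conv (grid B (enum (~: S)%SET)) one_on (kernel q c0 (t + n%:R)) y|
  <= n%:R * (C / Num.sqrt t ^+ (#|S| + 3)).
Proof.
have [C C0 CP] := grid_kernel_step; exists C => // B n t y t1.
elim: n y => [|n IH] y; first by rewrite addr0 subrr normr0 mul0r.
set f := conv _ one_on (kernel q c0 t).
pose g := conv (grid B (enum (~: S)%SET)) one_on (kernel q c0 (t + n%:R)).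
have tn : 1 <= t + n%:R by rewrite (le_trans t1) // lerDl.
have h1 : `|iter n.+1 (walk q) f y - walk q g y| <= n%:R * (C / Num.sqrt t ^+ (#|S| + 3)).
  rewrite /= /walk -sumrB; apply: (le_trans (ler_norm_sum _ _ _)).
  rewrite -[leRHS](mean_const q_sum); apply: ler_sum => X _.
  by rewrite -mulrBr normrM (gtr0_norm (q_gt0 X)) ler_wpM2l ?(ltW (q_gt0 X)).
have h2 := CP B _ y tn; rewrite -/g -addrA natr1 in h2.
have h3 : C / Num.sqrt (t + n%:R) ^+ (#|S| + 3) <= C / Num.sqrt t ^+ (#|S| + 3).
  have t0 : 0 < t by lra.
  rewrite ler_wpM2l // lef_pV2 ?posrE ?exprn_gt0 ?sqrtr_gt0 //; last by lra.
  by rewrite lerXn2r ?nnegrE ?sqrtr_ge0 // ler_wsqrtr // lerDl.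
have h4 := le_trans h2 h3.
rewrite -natr1 mulrDl mul1r.
apply: (le_trans (ler_distD (walk q g y) _ _)); apply: lerD => //.
by rewrite natr1 distrC.
Qed.

(** A cube centred near g in all coordinates, listed in reverse order to match the order of
    integration in [iter_int_gauss]. *)
Definition box (L : nat) (g : lat k) : seq (lat k) :=
  [seq [ffun j => g j + L%:Z] - v | v <- grid (L + L) (rev (enum 'I_k))].

Let rev_uniq_enum : uniq (rev (enum 'I_k)).
Proof. by rewrite rev_uniq enum_uniq. Qed.

Lemma box_uniq L g : uniq (box L g).
Proof.
rewrite map_inj_uniq ?grid_uniq // => v w /addrI /eqP.
by rewrite eqr_opp => /eqP.
Qed.

Lemma mem_box L g w :
  (w \in box L g) = [forall j, (g j - L%:Z < w j) && (w j <= g j + L%:Z)].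
Proof.
have -> : (w \in box L g) = ([ffun j => g j + L%:Z] - w \in grid (L + L) (rev (enum 'I_k))).
  apply/mapP/idP => [[v vg ->]|h].
    by rewrite opprB addrC subrK.
  by exists ([ffun j => g j + L%:Z] - w); rewrite // opprB addrC subrK.
rewrite mem_grid //; apply: eq_forallb => j.
rewrite ifT ?mem_rev ?mem_enum // !ffunE PoszD; move: (g j) (w j) => a b.
by apply/andP/andP => -[h1 h2]; split; lia.
Qed.

(* Averaging the starting point against the kernel is the same as applying the
   walk to the kernel; the box contains every point that n steps can reach, so the
   truncation costs nothing. *)
Lemma smoothing : exists2 C : R, 0 <= C & forall n t (y g : lat k), (0 < n)%N -> 1 <= t ->
  (forall j, -1 <= y j <= n.+1%:Z) ->
  (forall j, g j = Num.floor (t * wmean q j)) ->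
  `|(\sum_(w <- box (n + n).+2 g) kernel q c0 t w) * walk_grid n.+1 n y -
    iter n (walk q) (conv (grid n.+1 (enum (~: S)%SET)) one_on (kernel q c0 t)) (y + g)|
  <= C * (Num.sqrt t / Num.sqrt n%:R ^+ #|S|.+1).
Proof.
have [C1 C10 lip] := walk_grid_lipschitz.
have [C2 C20 gd] := gauss_decay_le q_gt0 q_sum.
exists (C1 * (1 + k%:R) * (c0 * C2 * 4 ^+ k)) => [|n t y g n0 t1 yb gE].
  by rewrite !mulr_ge0 ?exprn_ge0 ?addr_ge0.
have t0 : 0 < t by lra.
have r0 : 0 < Num.sqrt t by rewrite sqrtr_gt0.
have r1 : 1 <= Num.sqrt t by rewrite -sqrtr1 ler_wsqrtr.
(* The walk and the grid each subtract at most n and -1 <= y <= n + 1, so the points reached lie,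
   relative to g, between -2 n - 1 and n + 1. *)
set L := (n + n).+2; set J := grid n.+1 _; set G := kernel q c0 t.
have -> : iter n (walk q) (conv J one_on G) (y + g) =
    conv (box L g) G (walk_grid n.+1 n) (y + g).
  rewrite /walk_grid -iter_walk_conv; apply: iter_walk_local => x xb.
  rewrite -/J conv_conv; apply: eq_big_seq => v vJ; congr (_ * _).
  rewrite conv_point0 ?box_uniq // mem_box ifT //.
  apply/forallP => j; have := xb j; have := yb j.
  move: vJ; rewrite mem_grid ?enum_uniq // => /forallP /(_ j).
  rewrite !ffunE /L; move: (g j) (y j) (x j) (v j) => a b d e.
  case: (j \in _) => [/andP[v0 v1]|/eqP ->] /andP[y0 y1] /andP[x0 x1];
    by apply/andP; split; lia.
rewrite mulr_suml /conv -sumrB.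
apply: (le_trans (ler_norm_sum _ _ _)).
pose W (w : lat k) : R := \prod_j decay (centred q t w j / Num.sqrt t).
have le1 w : `|G w * walk_grid n.+1 n y - G w * walk_grid n.+1 n (y + g - w)| <=
    C1 / Num.sqrt n%:R ^+ #|S|.+1 * ((1 + k%:R) * Num.sqrt t * (c0 / Num.sqrt t ^+ k * C2)) * W w.
  rewrite -mulrBr normrM ger0_norm ?kernel_ge0 //.
  apply: (le_trans (ler_wpM2l (kernel_ge0 q t w c0_ge0) (lip n.+1 n y (y + g - w) n0))).
  rewrite mulrCA -[leRHS]mulrA ler_wpM2l ?divr_ge0 ?exprn_ge0 ?sqrtr_ge0 //.
  (* The two starting points differ by w - g, and g is the mean of the kernel up to a rounding error
     below 1. *)
  have sb : \sum_j `|(y j - (y + g - w) j)%:~R| <=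
     (1 + k%:R) * (Num.sqrt t * (1 + \sum_j `|centred q t w j / Num.sqrt t|)) :> R.
    have le2 j : `|(y j - (y + g - w) j)%:~R| <= 1 + Num.sqrt t * `|centred q t w j / Num.sqrt t| :> R.
      rewrite normrM normfV (gtr0_norm r0) mulrCA divff ?gt_eqF // mulr1.
      have -> : (y j - (y + g - w) j)%:~R = centred q t w j + (t * wmean q j - (g j)%:~R) :> R.
        by rewrite !ffunE /centred !(rmorphB, rmorphD) /=; ring.
      apply: (le_trans (ler_normD _ _)); rewrite [leRHS]addrC lerD2l.
      have := floor_itv (t * wmean q j); rewrite -gE intrD => /andP[u1].
      rewrite [1%:~R]mulr1z => u2; rewrite ler_norml; lra.
    apply: (le_trans (ler_sum _ (fun j _ => le2 j))).
    rewrite big_split /= sumr_const card_ord -mulr_sumr.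
    have s0 : 0 <= \sum_j `|centred q t w j / Num.sqrt t| by apply: sumr_ge0.
    set s := \sum_j _ in s0 *; have k0 : 0 <= k%:R :> R by exact: ler0n.
    have : 0 <= k%:R * (Num.sqrt t * s) by rewrite !mulr_ge0 // ltW.
    have : k%:R <= k%:R * Num.sqrt t by rewrite ler_peMr.
    by rewrite !mulrDl !mulrDr !mul1r !mulr1; lra.
  apply: (le_trans (ler_wpM2l (kernel_ge0 q t w c0_ge0) sb)).
  have gw := gd t (centred q t w) t0; rewrite -/(W w) in gw.
  rewrite /kernel; set e := expR _ in gw *; set s := 1 + \sum_j _ in gw *.
  have -> : c0 / Num.sqrt t ^+ k * e * ((1 + k%:R) * (Num.sqrt t * s)) =
    (1 + k%:R) * Num.sqrt t * (c0 / Num.sqrt t ^+ k) * (e * s) by ring.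
  have -> : (1 + k%:R) * Num.sqrt t * (c0 / Num.sqrt t ^+ k * C2) * W w =
    (1 + k%:R) * Num.sqrt t * (c0 / Num.sqrt t ^+ k) * (C2 * W w) by ring.
  by rewrite ler_wpM2l // !mulr_ge0 ?addr_ge0 ?invr_ge0 ?exprn_ge0 ?(ltW r0).
apply: (le_trans (ler_sum _ (fun w _ => le1 w))); rewrite -mulr_sumr.
have sW : \sum_(w <- box L g) W w <= (4 * Num.sqrt t) ^+ k.
  rewrite big_map.
  have := sum_grid_decay_le (L + L) (fun j => (g j + L%:Z)%:~R - t * wmean q j) rev_uniq_enum r1.
  rewrite size_rev size_enum_ord; apply: le_trans; apply: ler_sum => v _.
  have pr : perm_eq (rev (enum 'I_k)) (enum 'I_k) by rewrite perm_rev.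
  rewrite (perm_big _ pr) /= big_enum /=.
  rewrite /W le_eqVlt; apply/orP; left; apply/eqP; apply: eq_bigr => j _.
  by congr (decay (_ / _)); rewrite /centred !ffunE !rmorphB /=; ring.
apply: (le_trans (ler_wpM2l _ sW)).
  by rewrite !mulr_ge0 ?invr_ge0 ?exprn_ge0 ?addr_ge0 ?sqrtr_ge0.
rewrite le_eqVlt; apply/orP; left; apply/eqP; rewrite exprMn; field.
by rewrite !expf_neq0 // gt_eqF // sqrtr_gt0 ltr0n.
Qed.

End Smoothing.

Section LocalLimit.
Context {R : realType} {k : nat} (q : {set 'I_k} -> R).
Hypotheses (q_gt0 : forall X, 0 < q X) (q_sum : \sum_X q X = 1).

Lemma kernel_scaled (c0 t : R) w : 0 < t ->
  let z := fun j => centred q t w j / Num.sqrt t in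
  kernel q c0 t w = c0 / Num.sqrt t ^+ k * expR (- bform (wprec q) z z / 2).
Proof.
move=> t0 z; rewrite /kernel /z bformZ exprVn sqr_sqrtr ?(ltW t0) //.
by congr (_ * expR _); field; rewrite gt_eqF.
Qed.

Lemma index_rev_enum (j : 'I_k) : index j (rev (enum 'I_k)) = (k - j.+1)%N.
Proof.
have h : (k - j.+1 < k)%N by rewrite ltn_subrL /= (leq_ltn_trans (leq0n _) (ltn_ord j)).
rewrite -[in LHS](_ : nth j (rev (enum 'I_k)) (k - j.+1) = j).
  by rewrite index_uniq ?size_rev ?size_enum_ord // rev_uniq enum_uniq.
rewrite nth_rev size_enum_ord // (_ : (k - (k - j.+1).+1)%N = j); first exact: nth_ord_enum.
by have := ltn_ord j; lia.
Qed.

Definition gauss_const : R := (Num.sqrt ((2 * pi) ^+ k * \det (wcov q)))^-1.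

Lemma gauss_const_gt0 : 0 < gauss_const.
Proof.
rewrite invr_gt0 sqrtr_gt0 mulr_gt0 ?exprn_gt0 ?mulr_gt0 ?pi_gt0 //.
by apply: posdef_det_gt0; exact: posdef_wcov.
Qed.

Lemma iter_int_wprec : iter_int setT k (fun s => (expR (- bform (wprec q)
    (fun j => nth 0 s (index j (rev (enum 'I_k))))
    (fun j => nth 0 s (index j (rev (enum 'I_k)))) / 2))%:E) = (gauss_const^-1)%:E.
Proof.
rewrite /gauss_const invrK -[\det _]invrK -det_inv -[Num.sqrt _]mul1r.
rewrite -(iter_int_gauss (posdef_wprec q_gt0 q_sum) ler01).
apply: eq_iter_int => s ss; rewrite mul1r; congr ((expR (- _ / 2))%:E).
by apply: eq_bform => j; rewrite index_rev_enum nth_rev ss.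
Qed.

Section Sequences.
Variable S : {set 'I_k}.
Let s := #|S|.
(* The smoothing time is T = N^((s+3)/(s+4)) for N = m+1 steps: it is o(N), so that
   the smoothing error N^(s/2) T^(1/2) / N^((s+1)/2) vanishes, and it is large enough
   for the accumulated kernel error N^(s/2) N / T^((s+3)/2) to vanish too. Both are
   O(1/r) for r = N^(1/p), and all the powers above are integral powers of r. *)
Let p := (2 * (s + 4))%N.
Let r (m : nat) : R := m.+1%:R `^ (p%:R)^-1.

Let p_gt0 : (0 < p)%N. Proof. by rewrite /p muln_gt0 addn_gt0 orbT. Qed.

Let r_ge0 m : 0 <= r m. Proof. exact: powR_ge0. Qed.

Let rp m : r m ^+ p = m.+1%:R.
Proof.
rewrite -powR_mulrn // -powRrM mulVf ?pnatr_eq0 -?lt0n //.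
by rewrite powRr1.
Qed.

Let r_ge1 m : 1 <= r m.
Proof.
rewrite leNgt; apply/negP => r1.
have : r m ^+ p < 1 by rewrite exprn_ilt1 // -lt0n.
by rewrite rp ltNge ler1n.
Qed.

Let r_gt0 m : 0 < r m. Proof. exact: lt_le_trans (r_ge1 m). Qed.

Let r_large (A : R) : \forall m \near \oo, A <= r m.
Proof.
have := @nbhs_infty_ger R (`|A| ^+ p); apply: filterS => m h.
rewrite (le_trans (ler_norm A)) // -(@ler_pXn2r _ p) ?nnegrE //.
by rewrite rp (le_trans h) // ler_nat.
Qed.

Let rV_cvg0 : (r m)^-1 @[m --> \oo] --> (0 : R).
Proof.
apply/cvgr0Pnorm_le => e e0; have := r_large e^-1; apply: filterS => m h.
by rewrite ger0_norm ?invr_ge0 // -[e]invrK lef_pV2 ?posrE ?invr_gt0.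
Qed.

Let small_cvg0 (u : nat -> R) (K : R) : (forall m, `|u m| <= K / r m) ->
  u m @[m --> \oo] --> (0 : R).
Proof.
move=> uK; apply: norm_cvg0; apply: (@squeeze_cvgr _ _ _ _ (fun=> 0) (fun m => K * (r m)^-1)).
- by apply: nearW => m; rewrite normr_ge0 uK.
- exact: cvg_cst.
- by rewrite -[X in _ --> X](mulr0 K); apply: cvgM => //; exact: cvg_cst.
Qed.

Let sqrt_n m : Num.sqrt m.+1%:R = r m ^+ (s + 4).
Proof. by rewrite -rp /p mulnC exprM sqrtr_sqr ger0_norm // exprn_ge0. Qed.

Let T m : R := r m ^+ (2 * (s + 3)).

Let T_ge1 m : 1 <= T m. Proof. exact: exprn_ege1. Qed.

Let T_gt0 m : 0 < T m. Proof. exact: lt_le_trans (T_ge1 m). Qed.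

Let sqrt_T m : Num.sqrt (T m) = r m ^+ (s + 3).
Proof. by rewrite /T mulnC exprM sqrtr_sqr ger0_norm // exprn_ge0. Qed.

Let r_le_sqrt_T m : r m <= Num.sqrt (T m).
Proof. by rewrite sqrt_T -[leLHS]expr1 ler_weXn2l // addnC. Qed.

Let T_le_n m : T m <= m.+1%:R.
Proof. by rewrite -rp /T /p ler_weXn2l // leq_mul2l leq_add2l. Qed.

Let g m : lat k := [ffun j => Num.floor (T m * wmean q j)].

Let gE m j : g m j = Num.floor (T m * wmean q j). Proof. by rewrite ffunE. Qed.

Let g_near m j : -1 <= (g m j)%:~R - T m * wmean q j <= 0.
Proof.
have := floor_itv (T m * wmean q j); rewrite -gE intrD => /andP[u1].
by rewrite [1%:~R]mulr1z => u2; lra.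
Qed.

Let L m := (m.+1 + m.+1).+2.

(** A Riemann sum of mesh T^(-1/2) over the whole space; the value of the Gaussian integral is the
    inverse of [gauss_const]. *)
Lemma mass_cvg1 :
  \sum_(w <- box (L m) (g m)) kernel q gauss_const (T m) w @[m --> \oo] --> (1 : R).
Proof.
set js := rev (enum 'I_k).
have js_uniq : uniq js by rewrite rev_uniq enum_uniq.
pose h m := (Num.sqrt (T m))^-1; pose a m := - (L m)%:R * h m.
pose eps m (j : 'I_k) := ((g m j)%:~R - T m * wmean q j) * h m.
have sT0 m : 0 < Num.sqrt (T m) by rewrite sqrtr_gt0.
have h0 m : 0 < h m by rewrite invr_gt0.
have h1 m : h m <= 1 by rewrite invf_le1 // (le_trans (r_ge1 m)).
have hr m : h m <= (r m)^-1 by rewrite lef_pV2 ?posrE.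
have epsr m j : `|eps m j| <= h m.
  rewrite normrM (gtr0_norm (h0 m)) ler_piMl ?(ltW (h0 m)) //.
  by have := g_near m j; rewrite ler_norml; lra.
have [] := @grid_gauss_cvg R k q q_gt0 q_sum setT js a h (fun m => (L m + L m)%N) eps.
- exact: measurableT.
- by [].
- by move=> m; rewrite h0 h1.
- by apply: (small_cvg0 (K := 1)) => m; rewrite gtr0_norm // mul1r.
- by [].
- move=> t _; have := r_large (`|t| + 1); apply: filterS => m rt.
  have aE : a m + h m * (L m + L m)%:R = (L m)%:R * h m.
    by rewrite /a natrD; ring.
  rewrite aE /a.
  (* The box has half-width at least N = r^(2 (s + 4)), while sqrt T = r^(s + 3), so in scaled
     coordinates it fills the space. *)
  have big : r m <= (L m)%:R * h m.
    rewrite /h ler_pdivlMr // sqrt_T -exprS.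
    have : r m ^+ (s + 3).+1 <= r m ^+ p.
      by rewrite ler_weXn2l // /p; lia.
    rewrite rp => /le_trans; apply; rewrite ler_nat /L; lia.
  by have := ler_norm t; have := lerNnormlW (le_refl `|t|); rewrite mulNr; lra.
- move=> m j; apply: (le_trans (epsr m j)); have := h1 m; lra.
- move=> j; apply: (small_cvg0 (K := 1)) => m.
  by rewrite mul1r (le_trans (epsr m j)).
move=> v []; rewrite size_rev size_enum_ord iter_int_wprec => -[<-] cv _.
rewrite -(divff (lt0r_neq0 gauss_const_gt0)).
have : gauss_const * (h m ^+ k * \sum_(v <- grid (L m + L m) js)
      expR (- bform (wprec q)
        (fun j => eps m j - (if j \in js then a m + h m * (v j)%:~R else 0))
        (fun j => eps m j - (if j \in js then a m + h m * (v j)%:~R else 0)) / 2))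
    @[m --> \oo] --> gauss_const / gauss_const.
  by apply: cvgM => //; exact: cvg_cst.
apply: cvg_trans; apply: near_eq_cvg; apply: nearW => m.
rewrite /box big_map mulrA mulr_sumr; apply: eq_bigr => w _.
rewrite kernel_scaled // -exprVn -/(h m); congr (_ * expR (- _ / 2)).
apply: eq_bform => j; rewrite mem_rev mem_enum /eps /a /centred !ffunE !rmorphB rmorphD /=; ring.
Qed.

Variable y : nat -> lat k.
Hypothesis y_near : forall n j, `|(y n j)%:~R - n%:R * wmean q j| <= 1.

Let js := enum (~: S)%SET.

Let t m := T m + m.+1%:R.

Let t_gt0 m : 0 < t m. Proof. by rewrite addr_gt0. Qed.

Let r_le_sqrt_t m : r m <= Num.sqrt (t m).
Proof.
apply: (le_trans (r_le_sqrt_T m)); rewrite ler_wsqrtr // lerDl; exact: ler0n.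
Qed.

Let card_S : (s + #|(~: S)%SET|)%N = k.
Proof. by rewrite cardsC card_ord. Qed.

(** Of the k factors t^(-1/2) of the kernel, #|~: S| serve as mesh of the Riemann sum; the
    normalisation compensates the s others. *)
Lemma grid_kernel_cvg : exists I : R, [/\
  iter_int [set x : R | 0 < x] #|(~: S)%SET| (fun u => (expR (- bform (wprec q)
    (fun j => nth 0 u (index j js)) (fun j => nth 0 u (index j js)) / 2))%:E) = I%:E,
  0 < I &
  Num.sqrt (t m) ^+ s * conv (grid m.+2 js) one_on (kernel q gauss_const (t m)) (y m.+1 + g m)
    @[m --> \oo] --> gauss_const * I].
Proof.
pose h m := (Num.sqrt (t m))^-1; pose a (m : nat) : R := 0.
pose eps m (j : 'I_k) := ((y m.+1 j + g m j)%:~R - t m * wmean q j) * h m.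
have st0 m : 0 < Num.sqrt (t m) by rewrite sqrtr_gt0.
have h0 m : 0 < h m by rewrite invr_gt0.
have h1 m : h m <= 1 by rewrite invf_le1 // (le_trans (r_ge1 m)).
have hr m : h m <= (r m)^-1 by rewrite lef_pV2 ?posrE.
have epsr m j : `|eps m j| <= 2 * h m.
  rewrite normrM (gtr0_norm (h0 m)) ler_wpM2r ?(ltW (h0 m)) //.
  have := g_near m j; have := y_near m.+1 j; rewrite intrD /t mulrDl !ler_norml; lra.
have [] := @grid_gauss_cvg R k q q_gt0 q_sum [set x : R | 0 < x] js a h (fun m => m.+2) eps.
- by rewrite -set_itvoy; exact: measurable_itv.
- exact: enum_uniq.
- by move=> m; rewrite h0 h1.
- by apply: (small_cvg0 (K := 1)) => m; rewrite gtr0_norm // mul1r.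
- move=> m l _ x /=; rewrite in_itv /= add0r => /andP[+ _]; apply: le_lt_trans.
  by rewrite mulr_ge0 // ltW.
- move=> x /= x0; have := r_large (2 * x); apply: filterS => m rx.
  rewrite /a x0 add0r /= mulrC /h ler_pdivlMr //.
  (* As t <= 2 N, the N + 1 points of each axis extend in scaled coordinates beyond sqrt N / 2 >= r
     / 2, hence beyond x. *)
  have s2 : Num.sqrt (t m) <= 2 * Num.sqrt m.+1%:R.
    rewrite -[2 in leRHS]ger0_norm // -sqrtr_sqr -sqrtrM ?sqr_ge0 // ler_wsqrtr //.
    by have := T_le_n m; have : 0 <= m.+1%:R :> R := ler0n _ _; rewrite /t; lra.
  have rs : r m <= Num.sqrt m.+1%:R by rewrite sqrt_n -[leLHS]expr1 ler_weXn2l // addnC.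
  have sm : Num.sqrt m.+1%:R ^+ 2 = m.+1%:R :> R by rewrite sqr_sqrtr.
  have -> : m.+2%:R = m.+1%:R + 1 :> R by rewrite natr1.
  rewrite -[in leRHS]sm; have := r_gt0 m; move: (Num.sqrt (t m)) (Num.sqrt m.+1%:R) (r m) s2 rs rx.
  by move=> a1 a2 a3 *; nra.
- by move=> m j; apply: (le_trans (epsr m j)); have := h1 m; lra.
- move=> j; apply: (small_cvg0 (K := 2)) => m.
  by rewrite (le_trans (epsr m j)) // ler_wpM2l.
move=> I []; rewrite -cardE => E cv I0; exists I; split => //.
  apply: I0; rewrite -set_itvoy lebesgue_measure_itv /= ltry; exact: ltry.
have : gauss_const * (h m ^+ #|(~: S)%SET| * \sum_(v <- grid m.+2 js)
      expR (- bform (wprec q)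
        (fun j => eps m j - (if j \in js then a m + h m * (v j)%:~R else 0))
        (fun j => eps m j - (if j \in js then a m + h m * (v j)%:~R else 0)) / 2))
    @[m --> \oo] --> gauss_const * I.
  by apply: cvgM => //; exact: cvg_cst.
apply: cvg_trans; apply: near_eq_cvg; apply: nearW => m.
rewrite /conv mulrA !mulr_sumr; apply: eq_big_seq => v.
rewrite mem_grid ?enum_uniq // => /forallP vg.
rewrite /one_on mul1r kernel_scaled // mulrA; congr (_ * expR (- _ / 2)).
  rewrite -[in RHS]card_S exprD /h exprVn; field.
  by rewrite !expf_neq0 // gt_eqF.
apply: eq_bform => j; rewrite /eps /a /centred !ffunE !(rmorphB, rmorphD) /= -/(h m);
  have := vg j; case: (j \in js) => [_|/eqP ->]; rewrite ?rmorph0; ring.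
Qed.

Theorem local_limit : exists I : R, [/\
  iter_int [set x : R | 0 < x] #|(~: S)%SET| (fun u => (expR (- bform (wprec q)
    (fun j => nth 0 u (index j js)) (fun j => nth 0 u (index j js)) / 2))%:E) = I%:E,
  0 < I &
  Num.sqrt n%:R ^+ s * walk_grid q S n.+1 n (y n) @[n --> \oo] --> gauss_const * I].
Proof.
have [I [E I0 cv]] := grid_kernel_cvg; exists I; split => //.
rewrite -cvg_shiftS /=.
have [C1 C10 P1] := smoothing q_gt0 q_sum S (ltW gauss_const_gt0).
have [C2 C20 P2] := kernel_telescope q_gt0 q_sum S (ltW gauss_const_gt0).
pose mass m := \sum_(w <- box (L m) (g m)) kernel q gauss_const (T m) w.
pose U m := walk_grid q S m.+2 m.+1 (y m.+1).
pose JK m := conv (grid m.+2 js) one_on (kernel q gauss_const (t m)) (y m.+1 + g m).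
have wm j : 0 <= wmean q j <= 1.
  have d1 := dev_le1 q_gt0 q_sum finset.set0 j; have d2 := dev_le1 q_gt0 q_sum [set: 'I_k]%SET j.
  move: d1 d2; rewrite /dev !inE /= !ler_norml; lra.
have yb m j : -1 <= y m.+1 j <= m.+2%:Z.
  have := y_near m.+1 j; rewrite ler_norml => /andP[u1 u2]; have /andP[w0 w1] := wm j.
  have m0 : 0 <= m.+1%:R :> R by exact: ler0n.
  have b1 : 0 <= m.+1%:R * wmean q j by rewrite mulr_ge0.
  have b2 : m.+1%:R * wmean q j <= m.+1%:R by rewrite ler_piMr.
  have e : (m.+2%:Z)%:~R = m.+1%:R + 1 :> R by rewrite natr1.
  apply/andP; split; rewrite -(ler_int R) ?e; last lra.
  by rewrite mulrNz mulr1z; lra.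
have err m : `|Num.sqrt m.+1%:R ^+ s * (mass m * U m) - Num.sqrt m.+1%:R ^+ s * JK m|
    <= (C1 + C2) / r m.
  rewrite -mulrBr normrM ger0_norm ?exprn_ge0 ?sqrtr_ge0 //.
  have h1 := P1 m.+1 (T m) (y m.+1) (g m) isT (T_ge1 m) (yb m) (gE m).
  have h2 := P2 m.+2 m.+1 (T m) (y m.+1 + g m) (T_ge1 m).
  have h3 := le_trans (ler_distD _ _ _) (lerD h1 h2).
  apply: (le_trans (ler_wpM2l _ h3)); first by rewrite exprn_ge0 // sqrtr_ge0.
  rewrite mulrDr mulrDl; apply: lerD.
    rewrite le_eqVlt; apply/orP; left; apply/eqP; rewrite sqrt_n sqrt_T -/s.
    have -> : r m ^+ (s + 4) = r m * r m ^+ (s + 3) by rewrite -exprS addnS.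
    rewrite exprS; field.
    by rewrite !expf_neq0 ?mulf_neq0 ?expf_neq0 // gt_eqF.
  rewrite le_eqVlt; apply/orP; left; apply/eqP; rewrite sqrt_n sqrt_T -/s -rp -!exprM.
  (* (s + 3)^2 = (s + 4) s + p + 1: one power of r is left over, and it is the rate of
     convergence. *)
  have -> : r m ^+ ((s + 3) * (s + 3)) = r m ^+ ((s + 4) * s) * r m ^+ p * r m.
    by rewrite -exprD -exprSr; congr (_ ^+ _); rewrite /p; lia.
  field.
  by rewrite !expf_neq0 // gt_eqF.
(* T / N = r^(-2), so normalising with N instead of t = T + N does not change the limit. *)
have ratio : (Num.sqrt (t m) / Num.sqrt m.+1%:R) @[m --> \oo] --> (1 : R).
  have e m : Num.sqrt (t m) / Num.sqrt m.+1%:R = Num.sqrt (1 + (r m)^-1 * (r m)^-1).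
    rewrite -sqrtrV ?ler0n // -sqrtrM ?(ltW (t_gt0 m)) //; congr Num.sqrt.
    rewrite /t mulrDl divff ?pnatr_eq0 // addrC; congr (_ + _).
    rewrite -rp /T.
    have -> : p = (2 * (s + 3) + 2)%N by rewrite /p; lia.
    rewrite exprD expr2; field.
    by rewrite !expf_neq0 // gt_eqF.
  have c1 : Num.sqrt (1 + (r m)^-1 * (r m)^-1) @[m --> \oo] --> Num.sqrt (1 + 0 * 0 : R).
    apply: continuous_cvg; first exact: sqrt_continuous.
    by apply: cvgD; [exact: cvg_cst|apply: cvgM].
  rewrite mulr0 addr0 sqrtr1 in c1.
  by apply: cvg_trans c1; apply: near_eq_cvg; apply: nearW => m; rewrite e.
have JKc : Num.sqrt m.+1%:R ^+ s * JK m @[m --> \oo] --> gauss_const * I.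
  have rV : (Num.sqrt (t m) / Num.sqrt m.+1%:R)^-1 @[m --> \oo] --> (1^-1 : R).
    by apply: cvgV => //; exact: oner_neq0.
  have rX : (Num.sqrt (t m) / Num.sqrt m.+1%:R)^-1 ^+ s @[m --> \oo] --> (1^-1 ^+ s : R).
    elim: (s) => [|i IH]; first exact: cvg_cst.
    under eq_fun do rewrite exprS; rewrite exprS; exact: cvgM.
  rewrite -[gauss_const * I]mul1r -[in X in X * _](expr1n _ s) -[X in X ^+ s]invr1.
  apply: cvg_trans (cvgM rX cv).
  apply: near_eq_cvg; apply: nearW => m /=; rewrite mulrA -/(JK m); congr (_ * _).
  rewrite -exprMn; congr (_ ^+ _); field.
  by rewrite !gt_eqF // sqrtr_gt0.
have MU : Num.sqrt m.+1%:R ^+ s * (mass m * U m) @[m --> \oo] --> gauss_const * I.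
  have d0 := small_cvg0 err; rewrite -[gauss_const * I]add0r.
  apply: cvg_trans (cvgD d0 JKc).
  by apply: near_eq_cvg; apply: nearW => m /=; rewrite subrK.
(* The estimates concern the mass times [U]; dividing by the mass, which tends to 1, isolates the
   walk. *)
have mV : (mass m)^-1 @[m --> \oo] --> (1^-1 : R).
  by apply: cvgV; [exact: oner_neq0|exact: mass_cvg1].
rewrite -[gauss_const * I]mul1r -[X in X * _]invr1.
apply: cvg_trans (cvgM mV MU); apply: near_eq_cvg.
have mN : \forall m \near \oo, mass m != 0.
  have /cvgr_gt := mass_cvg1 => /(_ 0 ltr01); apply: filterS => m; exact: lt0r_neq0.
by apply: filterS mN => m m0 /=; rewrite [LHS]mulrCA mulKf.
Qed.

End Sequences.

End LocalLimit.

(** * Asymptotics of the winning probability *)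

Section Reductions.
Context {R : realType}.

Lemma iter_int_posE c (g : seq R -> \bar R) :
  iter_int_pos c g = iter_int [set x : R | 0 < x] c g.
Proof.
rewrite /iter_int_pos; elim: c g => //= c IH g.
by apply: eq_integral => x _; rewrite IH.
Qed.

(** Restricting the matrix to C amounts to extending the vector by 0, here through the default value
    of [nth]. *)
Lemma qform_submx_set k (A : 'M[R]_k) (C : {set 'I_k}) u : size u = #|C| ->
  let v := fun j => nth 0 u (index j (enum C)) in
  qform (submx_set A C) u = bform A v v.
Proof.
move=> su v; have vE (a : 'I_#|C|) : nth 0 u a = v (enum_val a).
  by rewrite /v index_uniq -?cardE ?enum_uniq.
have v0 j : j \notin C -> v j = 0.
  by move=> jC; rewrite /v nth_default // su cardE memNindex // mem_enum.
rewrite /qform /bform [RHS](bigID (mem C)) /= [X in _ = _ + X]big1 ?addr0; last first.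
  by move=> i iC; apply: big1 => j _; rewrite v0 // !mul0r.
rewrite [RHS]big_enum_val; apply: eq_bigr => a _.
rewrite [RHS](bigID (mem C)) /= [X in _ = _ + X]big1 ?addr0; last first.
  by move=> i iC; rewrite (v0 i) // mulr0.
by rewrite [RHS]big_enum_val; apply: eq_bigr => b _; rewrite mxE !vE.
Qed.

(** A nonzero limit turns the convergence of v W into an equivalence for W; the factor c may have
    any size since the error is relative. *)
Lemma equiv_scaled (c v W : nat -> R) (l : R) : l != 0 ->
  (forall n, (0 < n)%N -> v n != 0) -> v n * W n @[n --> \oo] --> l ->
  (fun n => c n * W n) ~_\oo (fun n => c n / v n * l).
Proof.
move=> l0 v0 vW; apply/eqaddoP => e e0.
have el : 0 < e * `|l| by rewrite mulr_gt0 // normr_gt0.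
near=> n; have vn : v n != 0 by apply: v0; near: n; exact: nbhs_infty_gt.
rewrite [X in `|X|](_ : _ = c n / v n * (v n * W n - l)); last first.
  by transitivity (c n * W n - c n / v n * l) => //; field.
rewrite !normrM [e * _]mulrCA ler_wpM2l // distrC.
near: n.
have /cvgrPdist_le H := vW; exact: H.
Unshelve. all: by end_near. Qed.

End Reductions.

Section CeilPoint.
Context {R : realType} {k : nat}.

Definition ceil_point (b : 'I_k -> R) (n : nat) : lat k :=
  [ffun j => Num.ceil (b j * n%:R) - 1].

Lemma ceil_point_near (b : 'I_k -> R) n j :
  `|(ceil_point b n j)%:~R - n%:R * b j| <= 1.
Proof.
rewrite ffunE intrB [1%:~R]mulr1z [_ * b j]mulrC.
have := ceil_ge (b j * n%:R); have := ceilB1_lt (b j * n%:R).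
by rewrite intrB [1%:~R]mulr1z ler_norml; lra.
Qed.

Lemma ceil_point_lt (b : 'I_k -> R) n j : b j < 1 -> ceil_point b n j < n%:Z.
Proof.
move=> b1; rewrite ffunE ltrBlDr ltzD1 ceil_le_int.
by rewrite -[leRHS]mul1r ler_wpM2r // ltW.
Qed.

End CeilPoint.

Section TiltedLimit.
Context {R : realType} {k : nat} (q : {set 'I_k} -> R) (zeta b : 'I_k -> R).
Hypotheses (q_gt0 : forall X, 0 < q X) (q_sum : \sum_X q X = 1).
Hypothesis q_mean : forall j, wmean q j = b j.
Hypothesis b_lt1 : forall j, b j < 1.
Hypotheses (zeta_gt0 : forall j, 0 < zeta j) (zeta_le1 : forall j, zeta j <= 1).

Let S := [set j : 'I_k | zeta j < 1]%SET.
Let js := enum (~: S)%SET.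

Lemma tilted_sum_cvg : exists I : R, [/\
  iter_int [set x : R | 0 < x] #|(~: S)%SET| (fun u => (expR (- bform (wprec q)
    (fun j => nth 0 u (index j js)) (fun j => nth 0 u (index j js)) / 2))%:E) = I%:E,
  0 < I &
  Num.sqrt n%:R ^+ #|S| *
    iter n (walk q) (prodf (fun j => geo (zeta j))) (ceil_point b n) @[n --> \oo]
  --> \prod_(j in S) (1 - zeta j)^-1 * (gauss_const q * I)].
Proof.
have near_b n j : `|(ceil_point b n j)%:~R - n%:R * wmean q j| <= 1.
  by rewrite q_mean ceil_point_near.
have [I [E I0 cv]] := local_limit q_gt0 q_sum S near_b; exists I; split => //.
have zS j : j \in S -> 0 < zeta j < 1 by rewrite inE zeta_gt0.
have [K K0 red] := geo_reduction q_gt0 q_sum zS.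
pose W n := iter n (walk q) (prodf (fun j => geo (zeta j))) (ceil_point b n).
pose kap := \prod_(j in S) (1 - zeta j)^-1.
pose G n := walk_grid q S n.+1 n (ceil_point b n).
have WG n : (0 < n)%N -> `|W n - kap * G n| <= K / Num.sqrt n%:R ^+ #|S|.+1.
  move=> n0; have bb (j : 'I_k) x : `|box_ind n.+1 x : R| <= 1.
    by rewrite /box_ind; case: (_ && _); rewrite ?normr1 ?normr0.
  have := red (fun=> box_ind n.+1) n bb n0 (ceil_point b n).
  congr (`|_ - _| <= _).
    (* Where zeta is 1 the weight is the indicator of a half-line; the end point being below n,
       cutting it at n is not seen by the walk. *)
    apply: iter_walk_local => x xb; apply: eq_bigr => j _.
    case: ifPn => //; rewrite inE -leNgt => z1.
    have -> : zeta j = 1 by apply/eqP; rewrite eq_le zeta_le1.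
    have /andP[_ xy] := xb j; have := le_lt_trans xy (ceil_point_lt n (b_lt1 j)).
    rewrite /box_ind /geo; case: (x j) => [i|i] //=; rewrite expr1n ltz_nat => /ltnW i_n.
    by rewrite ltz_nat ltnS i_n.
  by congr (_ * _); apply: eq_iter_walk => x; rewrite grid_point0.
have sV : (Num.sqrt n%:R)^-1 @[n --> \oo] --> (0 : R).
  apply/cvgr0Pnorm_le => e e0; near=> n.
  have en : e^-1 ^+ 2 <= n%:R by near: n; exact: nbhs_infty_ger.
  have n0 : 0 < n%:R :> R by apply: lt_le_trans en; rewrite exprn_gt0 // invr_gt0.
  rewrite ger0_norm ?invr_ge0 ?sqrtr_ge0 // -[e]invrK lef_pV2 ?posrE ?invr_gt0 ?sqrtr_gt0 //.
  by rewrite -[leLHS]ger0_norm ?invr_ge0 ?(ltW e0) // -sqrtr_sqr ler_wsqrtr.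
have d0 : Num.sqrt n%:R ^+ #|S| * (W n - kap * G n) @[n --> \oo] --> (0 : R).
  apply: norm_cvg0; apply: (@squeeze_cvgr _ _ _ _ (fun=> 0) (fun n => K * (Num.sqrt n%:R)^-1)).
  - near=> n; have n0 : (0 < n)%N by near: n; exact: nbhs_infty_gt.
    rewrite normr_ge0 /= normrM ger0_norm ?exprn_ge0 ?sqrtr_ge0 //.
    apply: (le_trans (ler_wpM2l _ (WG n n0))); first by rewrite exprn_ge0 ?sqrtr_ge0.
    have s0 : Num.sqrt n%:R != 0 :> R by rewrite gt_eqF // sqrtr_gt0 ltr0n.
    rewrite exprS le_eqVlt; apply/orP; left; apply/eqP; field.
    by rewrite s0 expf_neq0.
  - exact: cvg_cst.
  - by rewrite -[X in _ --> X](mulr0 K); apply: cvgM => //; exact: cvg_cst.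
rewrite -[X in _ --> X]add0r -/kap.
apply: cvg_trans (cvgD d0 (cvgM (cvg_cst kap) cv)).
apply: near_eq_cvg; apply: nearW => n; rewrite fctE /= -/(W n) -/(G n); ring.
Unshelve. all: by end_near. Qed.

End TiltedLimit.

Theorem theorem6 (R : realType) (k : nat) (hk : (1 <= k)%N)
  (p : {ffun 'S_k.+1 -> R})
  (hp_pos : forall r, 0 < p r)
  (hp_sum : \sum_r p r = 1)
  (alpha : 'I_k -> R)
  (halpha : forall j, 0 < alpha j < 1)
  (tau : 'rV[R]_k)
  (htau : forall t : 'rV[R]_k,
      - Kfun p t + \sum_j (1 - alpha j) * t 0 j
      <= - Kfun p tau + \sum_j (1 - alpha j) * tau 0 j)
  (hSC : forall j, expR (tau 0 j) < 1 \/ expR (tau 0 j) = 1) :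
  let beta := fun j => 1 - alpha j in
  let zeta := fun j => expR (tau 0 j) in
  let S := [set j : 'I_k | zeta j < 1]%SET in
  let C := [set j : 'I_k | zeta j == 1]%SET in
  let H := hessian (Kfun p) tau in
  let M := submx_set (invmx H) C in
  let I := fine (iter_int_pos #|C| (fun u => (expR (- qform M u / 2))%:E)) in
  (fun n => win_prob p alpha n) ~_\oo
  (fun n : nat =>
     Ppoly p zeta ^+ n
     / \prod_(j in S) ((1 - zeta j) * zeta j ^ (Num.ceil (beta j * n%:R) - 1))
     * (1 / Num.sqrt ((2 * pi) ^+ k * n%:R ^+ #|S| * \det H))
     * I).
Proof.
move=> beta zeta S C H M I.
have zeta_gt0 j : 0 < zeta j by exact: expR_gt0.
have zeta_le1 j : zeta j <= 1 by rewrite /zeta; case: (hSC j) => [/ltW|->].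
have CE : C = (~: S)%SET.
  by apply/setP => j; rewrite !inE eq_le zeta_le1 -leNgt.
have q_gt0 X := tilted_gt0 hp_pos tau X.
have q_sum := tilted_sum hp_pos tau.
have q_mean := critical_mean hp_pos htau.
have beta_lt1 j : beta j < 1 by rewrite /beta; have := halpha j; lra.
have HE : H = wcov (tilted p tau) by exact: hessian_Kfun.
have [J [JE J0 cv]] := tilted_sum_cvg q_gt0 q_sum q_mean beta_lt1 zeta_gt0 zeta_le1.
(* The iterated integral is the real number J, so [fine] loses nothing. *)
have IJ : I = J.
  rewrite /I iter_int_posE (_ : iter_int _ _ _ = J%:E) // -JE -/S.
  rewrite /M /wprec -HE -CE.
  by apply: eq_iter_int => u su; rewrite qform_submx_set.
pose w := Ppoly p zeta; have w0 : 0 < w by exact: Ppoly_gt0.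
pose y n := ceil_point beta n.
pose D n := \prod_(j in S) zeta j ^ (y n j).
pose kap := \prod_(j in S) (1 - zeta j)^-1.
have l0 : kap * (gauss_const (tilted p tau) * J) != 0.
  rewrite gt_eqF // mulr_gt0 ?mulr_gt0 ?gauss_const_gt0 //.
  by apply: prodr_gt0 => j; rewrite inE invr_gt0 subr_gt0.
have s0 n : (0 < n)%N -> Num.sqrt n%:R ^+ #|S| != 0 :> R.
  by move=> n0; rewrite expf_neq0 // gt_eqF // sqrtr_gt0 ltr0n.
have eqv := equiv_scaled (fun n => w ^+ n / D n) l0 s0 cv.
(* The tilting produces a product over all adversaries; those with zeta = 1 contribute factors 1. *)
have DE n : \prod_j zeta j ^ (Num.ceil (beta j * n%:R) - 1) = D n.
  rewrite (bigID (mem S)) /= [X in _ * X]big1 ?mulr1; last first.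
    move=> j; rewrite inE -leNgt => z1.
    by rewrite (_ : zeta j = 1) ?exp1rz //; apply/eqP; rewrite eq_le zeta_le1.
  by apply: eq_bigr => j _; rewrite ffunE.
set f := (F in F ~_\oo _); set g := (F in _ ~_\oo F).
have -> : f = fun n => w ^+ n / D n *
    iter n (walk (tilted p tau)) (prodf (fun j => geo (zeta j))) (y n).
  apply/funext => n; rewrite /f (@win_prob_tilted _ _ p zeta w).
  - by rewrite DE.
  - by move=> j; rewrite gt_eqF.
  - by rewrite gt_eqF.
have -> : g = fun n => w ^+ n / D n / Num.sqrt n%:R ^+ #|S| *
    (kap * (gauss_const (tilted p tau) * J)).
  apply/funext => n; rewrite /g IJ HE.
  have -> : \prod_(j in S) ((1 - zeta j) * zeta j ^ (Num.ceil (beta j * n%:R) - 1)) =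
      kap^-1 * D n.
    rewrite big_split /= /kap -prodfV; congr (_ * _).
      by apply: eq_bigr => j _; rewrite invrK.
    by apply: eq_bigr => j _; rewrite ffunE.
  have -> : Num.sqrt ((2 * pi) ^+ k * n%:R ^+ #|S| * \det (wcov (tilted p tau))) =
      (gauss_const (tilted p tau))^-1 * Num.sqrt n%:R ^+ #|S|.
    rewrite mulrAC mulrC /gauss_const invrK sqrtrM ?exprn_ge0 // mulrC; congr (_ * _).
    by elim: #|S| => [|i IH]; rewrite ?sqrtr1 // !exprS sqrtrM // IH.
  by rewrite !invfM !invrK mul1r; ring.
exact: eqv.
Qed.
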